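(* (i) Let $\Gamma$ be a non-trivial torsion free countable group and $H_0$ a non-trivial finite abelian group. Then there exists a torsion free countable group $\Lambda$ with $\mathrm{L}(\Lambda) \cong \mathrm{L}(H_0 \wr \Gamma)$. In particular, $\Lambda \not\cong H_0 \wr \Gamma$. (ii) Let $n \geq 2$ and let $H_0$ be a non-trivial finite abelian group. There are infinitely many non-isomorphic countable groups $\Lambda$ for which $\mathrm{L}\Lambda \cong \mathrm{L}(H_0 \wr \mathrm{PSL}(n,\mathbb{Z}))$.
   Context: All groups are countable and discrete. $\mathrm{L}G$ denotes the group von Neumann algebra of $G$ (generated by the left regular representation on $\ell^2 G$), and $\cong$ between von Neumann algebras denotes $*$-isomorphism. The plain wreath product is $H_0 \wr \Gamma = H_0^{(\Gamma)} \rtimes \Gamma$, where $H_0^{(\Gamma)}$ is the direct sum of copies of $H_0$ indexed by $\Gamma$ and $\Gamma$ acts by shifting coordinates via left translation. *)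

(* Defs.v *)
From HB Require Import structures.
From mathcomp Require Import all_boot all_order all_algebra all_fingroup.
From mathcomp Require Import generic_quotient finmap.
From mathcomp Require Import all_classical all_reals all_analysis.
From mathcomp Require Import complex ring.

Set Implicit Arguments.
Unset Strict Implicit.
Unset Printing Implicit Defensive.

Import Order.TTheory GRing.Theory Num.Theory.
Import Normc.

Local Open Scope classical_set_scope.
Local Open Scope ring_scope.

Definition torsion_free (G : groupType) : Prop :=
  forall (g : G) (n : nat), (0 < n)%N -> (g ^+ n = 1 -> g = 1)%g.

Definition group_isomorphic (G H : groupType) : Prop :=
  exists f : {multiplicative G -> H}, bijective f.

Section DirectSum.
Variables (H : groupType) (I : choiceType).
Local Open Scope group_scope.

Definition dsum : Type := {fsfun I -> H with 1}.

HB.instance Definition _ := Choice.on dsum.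

Implicit Types f g : dsum.

Definition dsum_fun (f : dsum) : I -> H := fun x => f x.

Lemma dsumP f g : dsum_fun f =1 dsum_fun g -> f = g.
Proof. by move=> fg; apply/fsfunP. Qed.

Definition dsum_one : dsum := [fsfun].

Definition dsum_mul f g : dsum :=
  [fsfun x in (finsupp f `|` finsupp g)%fset => dsum_fun f x * dsum_fun g x].

Definition dsum_inv f : dsum := [fsfun x in finsupp f => (dsum_fun f x)^-1].

Lemma dsum_oneE x : dsum_fun dsum_one x = 1.
Proof. by rewrite /dsum_fun fsfunE. Qed.

Lemma dsum_mulE f g x :
  dsum_fun (dsum_mul f g) x = dsum_fun f x * dsum_fun g x.
Proof.
rewrite {1}/dsum_fun fsfunE inE; case: ifPn => //; rewrite negb_or.
by case/andP=> xf xg; rewrite /dsum_fun !fsfun_dflt ?mulg1.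
Qed.

Lemma dsum_invE f x : dsum_fun (dsum_inv f) x = (dsum_fun f x)^-1.
Proof.
rewrite {1}/dsum_fun fsfunE; case: ifPn => // xf.
by rewrite /dsum_fun fsfun_dflt ?invg1.
Qed.

Lemma dsum_mulA : associative dsum_mul.
Proof. by move=> f g h; apply: dsumP => x; rewrite !dsum_mulE mulgA. Qed.

Lemma dsum_mul1g : left_id dsum_one dsum_mul.
Proof. by move=> f; apply: dsumP => x; rewrite dsum_mulE dsum_oneE mul1g. Qed.

Lemma dsum_mulg1 : right_id dsum_one dsum_mul.
Proof. by move=> f; apply: dsumP => x; rewrite dsum_mulE dsum_oneE mulg1. Qed.

Lemma dsum_mulVg : left_inverse dsum_one dsum_inv dsum_mul.
Proof.
by move=> f; apply: dsumP => x; rewrite dsum_mulE dsum_oneE dsum_invE mulVg.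
Qed.

Lemma dsum_mulgV : right_inverse dsum_one dsum_inv dsum_mul.
Proof.
by move=> f; apply: dsumP => x; rewrite dsum_mulE dsum_oneE dsum_invE mulgV.
Qed.

HB.instance Definition _ := isGroup.Build dsum
  dsum_mulA dsum_mul1g dsum_mulg1 dsum_mulVg dsum_mulgV.

End DirectSum.

Section Wreath.
Variables (H Gam : groupType).
Local Open Scope group_scope.

Implicit Types (c d : Gam) (f g : dsum H Gam).

Definition dsum_shift c f : dsum H Gam :=
  [fsfun x in [fset c * y | y in finsupp f]%fset => dsum_fun f (c^-1 * x)].

Lemma dsum_shiftE c f x : dsum_fun (dsum_shift c f) x = dsum_fun f (c^-1 * x).
Proof.
rewrite {1}/dsum_fun fsfunE; case: ifPn => // xf.
rewrite /dsum_fun fsfun_dflt //; apply: contra xf => xf.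
by apply/imfsetP; exists (c^-1 * x) => //; rewrite mulKVg.
Qed.

Definition wreath : Type := (dsum H Gam * Gam)%type.

HB.instance Definition _ := Choice.on wreath.

Implicit Types u v : wreath.

Definition wreath_one : wreath := (1, 1).

Definition wreath_mul u v : wreath :=
  (u.1 * dsum_shift u.2 v.1, u.2 * v.2).

Definition wreath_inv u : wreath := (dsum_shift u.2^-1 u.1^-1, u.2^-1).

Lemma dsum_shift_is_mul c f g :
  dsum_shift c (f * g) = dsum_shift c f * dsum_shift c g.
Proof.
by apply: dsumP => x; rewrite dsum_mulE !dsum_shiftE dsum_mulE.
Qed.

Lemma dsum_shift_mul c d f :
  dsum_shift (c * d) f = dsum_shift c (dsum_shift d f).
Proof. by apply: dsumP => x; rewrite !dsum_shiftE invgM mulgA. Qed.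

Lemma dsum_shift1 f : dsum_shift 1 f = f.
Proof. by apply: dsumP => x; rewrite dsum_shiftE invg1 mul1g. Qed.

Lemma dsum_shift_one c : dsum_shift c 1 = 1.
Proof. by apply: dsumP => x; rewrite dsum_shiftE !dsum_oneE. Qed.

Lemma wreath_mulA : associative wreath_mul.
Proof.
move=> [f c] [g d] [h e]; rewrite /wreath_mul/=.
by rewrite dsum_shift_is_mul dsum_shift_mul !mulgA.
Qed.

Lemma wreath_mul1g : left_id wreath_one wreath_mul.
Proof. by move=> [f c]; rewrite /wreath_mul/= dsum_shift1 !mul1g. Qed.

Lemma wreath_mulg1 : right_id wreath_one wreath_mul.
Proof. by move=> [f c]; rewrite /wreath_mul/= dsum_shift_one !mulg1. Qed.

Lemma wreath_mulVg : left_inverse wreath_one wreath_inv wreath_mul.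
Proof.
move=> [f c]; rewrite /wreath_mul/= -dsum_shift_is_mul !mulVg.
by rewrite dsum_shift_one.
Qed.

Lemma wreath_mulgV : right_inverse wreath_one wreath_inv wreath_mul.
Proof.
by move=> [f c]; rewrite /wreath_mul/= -dsum_shift_mul !mulgV dsum_shift1 mulgV.
Qed.

HB.instance Definition _ := isGroup.Build wreath
  wreath_mulA wreath_mul1g wreath_mulg1 wreath_mulVg wreath_mulgV.

End Wreath.

Section SpecialLinear.
Variables (A : comNzRingType) (n : nat).

Definition SL : Type := {M : 'M[A]_n | \det M == 1}.

HB.instance Definition _ := SubChoice.on SL.

Implicit Types M N : SL.

Fact SL_one_subproof : \det (1%:M : 'M[A]_n) == 1.
Proof. by rewrite det1. Qed.

Fact SL_mul_subproof M N : \det (val M *m val N) == 1.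
Proof. by rewrite det_mulmx (eqP (valP M)) (eqP (valP N)) mulr1. Qed.

Fact SL_inv_subproof M : \det (\adj (val M)) == 1.
Proof.
have := congr1 determinant (mul_mx_adj (val M)).
by rewrite det_mulmx (eqP (valP M)) mul1r det1 => ->.
Qed.

Definition SL_one : SL := Sub 1%:M SL_one_subproof.
Definition SL_mul M N : SL := Sub (val M *m val N) (SL_mul_subproof M N).
(* The adjugate is the inverse, the determinant being 1. *)
Definition SL_inv M : SL := Sub (\adj (val M)) (SL_inv_subproof M).

Lemma SL_mulA : associative SL_mul.
Proof. by move=> M N P; apply: val_inj; rewrite /= mulmxA. Qed.

Lemma SL_mul1g : left_id SL_one SL_mul.
Proof. by move=> M; apply: val_inj; rewrite /= mul1mx. Qed.

Lemma SL_mulg1 : right_id SL_one SL_mul.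
Proof. by move=> M; apply: val_inj; rewrite /= mulmx1. Qed.

Lemma SL_mulVg : left_inverse SL_one SL_inv SL_mul.
Proof.
by move=> M; apply: val_inj; rewrite /= mul_adj_mx (eqP (valP M)).
Qed.

Lemma SL_mulgV : right_inverse SL_one SL_inv SL_mul.
Proof.
by move=> M; apply: val_inj; rewrite /= mul_mx_adj (eqP (valP M)).
Qed.

HB.instance Definition _ := isGroup.Build SL
  SL_mulA SL_mul1g SL_mulg1 SL_mulVg SL_mulgV.

End SpecialLinear.

Section CentralQuotient.
Variable G : groupType.
Local Open Scope group_scope.
Local Open Scope quotient_scope.

Implicit Types x y z : G.

Definition central x : Prop := forall z, commute x z.

Definition eq_mod_center x y : bool := `[< central (x^-1 * y) >].

Lemma eq_mod_center_refl : reflexive eq_mod_center.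
Proof.
by move=> x; apply/asboolP => z; rewrite mulVg; apply/commute_sym/commute1.
Qed.

Lemma eq_mod_center_sym : symmetric eq_mod_center.
Proof.
suff sub x y : eq_mod_center x y -> eq_mod_center y x.
  by move=> x y; apply/idP/idP; exact: sub.
move=> /asboolP xyC; apply/asboolP => z.
have -> : y^-1 * x = (x^-1 * y)^-1 by rewrite invgM invgK.
by apply: commute_sym; apply: commuteV; apply: commute_sym; exact: xyC.
Qed.

Lemma eq_mod_center_trans : transitive eq_mod_center.
Proof.
move=> y x z /asboolP xyC /asboolP yzC; apply/asboolP => t.
have -> : x^-1 * z = (x^-1 * y) * (y^-1 * z) by rewrite -mulgA mulVKg.
by apply: commute_sym; apply: commuteM; apply: commute_sym.
Qed.

Canonical eq_mod_center_equiv := EquivRel eq_mod_center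
  eq_mod_center_refl eq_mod_center_sym eq_mod_center_trans.

Definition center_quotient : Type := {eq_quot eq_mod_center}.

HB.instance Definition _ := Choice.on center_quotient.
HB.instance Definition _ := EqQuotient.on center_quotient.

Definition cquo_one : center_quotient := lift_cst center_quotient 1.
Definition cquo_mul := lift_op2 center_quotient (fun x y : G => x * y).
Definition cquo_inv := lift_op1 center_quotient (fun x : G => x^-1).

Lemma eq_mod_centerP x y :
  reflect (central (x^-1 * y)) (x == y %[mod center_quotient]).
Proof. by rewrite piE; exact: asboolP. Qed.

Canonical pi_cquo_one := PiConst cquo_one.

Lemma pi_cquo_mul : {morph \pi : x y / x * y >-> cquo_mul x y}.
Proof.
move=> x y; unlock cquo_mul; apply/eqP/eq_mod_centerP => z.
have: y == repr (\pi_center_quotient y) %[mod center_quotient] by rewrite reprK.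
have: x == repr (\pi_center_quotient x) %[mod center_quotient] by rewrite reprK.
move: (repr _) (repr _) => y' x' /eq_mod_centerP xC /eq_mod_centerP yC.
have -> : (x * y)^-1 * (x' * y') = (x^-1 * x') * (y^-1 * y').
  by rewrite [RHS]mulgA (xC y^-1) invgM !mulgA.
by apply: commute_sym; apply: commuteM; apply: commute_sym.
Qed.

Canonical pi_cquo_mul_morph := PiMorph2 pi_cquo_mul.

Lemma pi_cquo_inv : {morph \pi : x / x^-1 >-> cquo_inv x}.
Proof.
move=> x; unlock cquo_inv; apply/eqP/eq_mod_centerP => z.
have: x == repr (\pi_center_quotient x) %[mod center_quotient] by rewrite reprK.
move: (repr _) => x' /eq_mod_centerP xC.
have -> : x^-1^-1 * x'^-1 = (x^-1 * x')^-1.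
  have /commuteV xx' : commute x x'.
    by rewrite -(mulVKg x x'); apply: commuteM => //; apply/commute_sym/xC.
  by rewrite invgM invgK xx'.
by apply: commute_sym; apply: commuteV; apply: commute_sym.
Qed.

Canonical pi_cquo_inv_morph := PiMorph1 pi_cquo_inv.

Lemma cquo_mulA : associative cquo_mul.
Proof. by elim/quotW=> x; elim/quotW=> y; elim/quotW=> z; rewrite !piE mulgA. Qed.

Lemma cquo_mul1g : left_id cquo_one cquo_mul.
Proof. by elim/quotW=> x; rewrite !piE mul1g. Qed.

Lemma cquo_mulg1 : right_id cquo_one cquo_mul.
Proof. by elim/quotW=> x; rewrite !piE mulg1. Qed.

Lemma cquo_mulVg : left_inverse cquo_one cquo_inv cquo_mul.
Proof. by elim/quotW=> x; rewrite !piE mulVg. Qed.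

Lemma cquo_mulgV : right_inverse cquo_one cquo_inv cquo_mul.
Proof. by elim/quotW=> x; rewrite !piE mulgV. Qed.

HB.instance Definition _ := isGroup.Build center_quotient
  cquo_mulA cquo_mul1g cquo_mulg1 cquo_mulVg cquo_mulgV.

End CentralQuotient.

Definition PSLZ (n : nat) : groupType := center_quotient (SL int n).

Section L2.
Variables (R : realType) (G : choiceType).

Local Notation C := R[i].

Definition square_summable (f : G -> C) : Prop :=
  summable [set: G] (fun x => ((normc (f x)) ^+ 2)%:E).

Definition l2_pred : {pred G -> C} := [pred f | `[< square_summable f >]].

Lemma l2_predP f : reflect (square_summable f) (f \in l2_pred).
Proof. exact: asboolP. Qed.

Lemma square_summableE f : square_summable f =
  (\esum_(x in [set: G]) ((normc (f x)) ^+ 2)%:E < +oo)%E.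
Proof.
rewrite /square_summable /summable; congr (_ < _)%E; apply: eq_esum => x _.
by rewrite gee0_abs // lee_fin sqr_ge0.
Qed.

Fact l2_submod_closed : submod_closed l2_pred.
Proof.
split=> [|a f g /l2_predP + /l2_predP].
  apply/l2_predP; rewrite square_summableE esum1 ?ltry // => x _.
  by rewrite normc0 expr0n.
rewrite !square_summableE => fS gS; apply/l2_predP; rewrite square_summableE.
have para (u v w : R) :
    2 * u ^+ 2 * v ^+ 2 + 2 * w ^+ 2 - (u * v + w) ^+ 2 = (u * v - w) ^+ 2.
  by ring.
have sq0 (z : R) : (0 <= (z ^+ 2)%:E)%E by rewrite lee_fin sqr_ge0.
pose b : R := 2 * normc a ^+ 2.
have b0 : 0 <= b by rewrite mulr_ge0 ?sqr_ge0.
pose F x := ((normc (f x)) ^+ 2)%:E; pose K x := ((normc (g x)) ^+ 2)%:E.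
have fin (k : R) (L : G -> \bar R) : 0 <= k -> (forall x, 0 <= L x)%E ->
    (\esum_(x in [set: G]) L x < +oo)%E ->
    (\esum_(x in [set: G]) (k%:E * L x) < +oo)%E.
  move=> k0 L0 Lfin; apply: (@le_lt_trans _ _
      (k%:E * \esum_(x in [set: G]) L x)%E); last first.
    have S0 : (0 <= \esum_(x in [set: G]) L x)%E by apply: esum_ge0.
    by apply: lte_mul_pinfty.
  apply: ge_ereal_sup => _ [A [finA AG] <-].
  rewrite -ge0_mule_fsumr //; apply: lee_wpmul2l => //.
  by apply: ereal_sup_ubound; exists A.
apply: (@le_lt_trans _ _
    (\esum_(x in [set: G]) (b%:E * F x + 2%:E * K x))%E).
  apply: le_esum => x _; rewrite -!EFinM -EFinD lee_fin.
  have := @le_normcD R (a * f x) (g x); rewrite normcM.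
  have -> : (a *: f + g) x = a * f x + g x by [].
  set u := normc (_ + _); set v := normc a; set p := normc _; set q := normc _.
  have u0 : 0 <= u by rewrite /u; case: (_ + _) => ? ?; rewrite sqrtr_ge0.
  move=> uvp; have /le_trans : u ^+ 2 <= (v * p + q) ^+ 2 
    by rewrite lerXn2r ?nnegrE // (le_trans u0).
  by apply; rewrite -subr_ge0 /b -/v para sqr_ge0.
have F0 x : (0 <= F x)%E by exact: sq0.
have K0 x : (0 <= K x)%E by exact: sq0.
rewrite esumD => [|x _|x _]; [|exact: mule_ge0|exact: mule_ge0].
by apply: lte_add_pinfty; exact: fin.
Qed.

HB.instance Definition _ :=
  GRing.isSubmodClosed.Build C (G -> C) l2_pred l2_submod_closed.

Definition l2 : Type := {f : G -> C | f \in l2_pred}.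

HB.instance Definition _ := SubChoice.on l2.
HB.instance Definition _ := [SubChoice_isSubLmodule of l2 by <:].

Implicit Types u v : l2.

(* For a real or complex family the sum is meant for absolutely summable
   families only: it is the sum of the positive part minus the sum of the
   negative part, of the real and imaginary parts separately. *)
Definition real_sum (a : G -> R) : R :=
  fine (\esum_(x in [set: G]) (Num.max (a x) 0)%:E) -
  fine (\esum_(x in [set: G]) (Num.max (- a x) 0)%:E).

Definition complex_sum (a : G -> C) : C :=
  (real_sum (fun x => complex.Re (a x)) +i*
   real_sum (fun x => complex.Im (a x)))%C.

Definition l2_dot u v : C := complex_sum (fun x => val u x * (val v x)^*%C).

Definition l2_norm u : R :=
  Num.sqrt (fine (\esum_(x in [set: G]) ((normc (val u x)) ^+ 2)%:E)).

Implicit Types (S T : l2 -> l2) (M : set (l2 -> l2)).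

Definition bounded_op T : Prop :=
  linear T /\ exists K : R, forall u, l2_norm (T u) <= K * l2_norm u.

Definition is_adjoint T T' : Prop :=
  forall u v, l2_dot (T u) v = l2_dot u (T' v).

Definition commutant M : set (l2 -> l2) :=
  [set T | bounded_op T /\ forall S, M S -> S \o T = T \o S].

(* The redundant algebraic closure properties are listed next to M'' = M to
   match the textbook definition of a self-adjoint unital subalgebra of the
   bounded operators that equals its bicommutant. *)
Record von_neumann_algebra M : Prop := VonNeumannAlgebra {
  vna_bounded : M `<=` bounded_op;
  vna_id : M id;
  vna_add : forall S T, M S -> M T -> M (S + T);
  vna_scale : forall (a : C) T, M T -> M (a *: T);
  vna_comp : forall S T, M S -> M T -> M (S \o T);
  vna_adjoint : forall T, M T -> exists2 T', M T' & is_adjoint T T';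
  vna_bicommutant : commutant (commutant M) = M
}.

Definition vn_generated M : set (l2 -> l2) :=
  \bigcap_(N in [set N | von_neumann_algebra N /\ M `<=` N]) N.

End L2.

Section StarIsomorphism.
Variables (R : realType) (G H : choiceType).

(* The values of phi outside M are irrelevant. *)
Definition star_isomorphic (M : set (l2 R G -> l2 R G))
    (N : set (l2 R H -> l2 R H)) : Prop :=
  exists phi : (l2 R G -> l2 R G) -> (l2 R H -> l2 R H),
  [/\ set_bij M N phi,
      forall S T, M S -> M T -> phi (S + T) = phi S + phi T,
      forall (a : R[i]) T, M T -> phi (a *: T) = a *: phi T,
      forall S T, M S -> M T -> phi (S \o T) = phi S \o phi T &
      forall S T, M S -> M T -> is_adjoint S T -> is_adjoint (phi S) (phi T)].

End StarIsomorphism.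

Section GroupVonNeumannAlgebra.
Variables (R : realType) (G : groupType).

Fact left_regular_subproof (g : G) (u : l2 R G) :
  (fun x => val u (g^-1 * x)%g) \in @l2_pred R G.
Proof.
have /l2_predP := valP u; rewrite /square_summable /summable => uS.
apply/l2_predP; rewrite /square_summable /summable.
rewrite -(reindex_esum [set: G] [set: G] (fun x => (g^-1 * x)%g)
  (fun x => `|((normc (val u x)) ^+ 2)%:E|%E)) //.
split=> // [x y _ _ /mulgI //|x _].
by exists (g * x)%g; rewrite // mulKg.
Qed.

Definition left_regular (g : G) (u : l2 R G) : l2 R G :=
  Sub (fun x => val u (g^-1 * x)%g) (left_regular_subproof g u).

Definition group_vna : set (l2 R G -> l2 R G) :=
  vn_generated (range left_regular).

End GroupVonNeumannAlgebra.

Arguments group_vna : clear implicits.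

(* Main.v *)
(** Let [k = #|H0|] and let [g] in [Gam] have infinite order. The group [Lam] is
    the semidirect product of [Gam] with the module induced from the action of
    [<g>] on [Z[1/k]] in which [g] multiplies by [k]; its elements are functions
    [F] on [Gam] with [F (x g) = F x / k]. At each place [i] of the wreath product
    the [k] characters of [H0] give orthogonal projections [P_(i,j)] with sum [1],
    and [F] acts on [l^2] of the wreath product as the infinite product over [i] of
    [\sum_j exp (2 pi i j F(i)) P_(i,j)]. A generator of the induced module, with
    values [1/k, 1/k^2, ...] at [c g, c g^2, ...] and integers elsewhere, thus acts
    as the identity function of the circle in terms of base [k] digits, and an
    operator commutes with it if and only if it commutes with each digit. Hence
    [Lam] acts with the same commutant as the wreath product, and its action has
    the right trace; yet [Lam] is torsion free when [Gam] is.

    For [PSL(n, Z)] take for [g] the powers [t^(2^(i E))] of the class [t] of an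
    elementary matrix. If [Lam] contains a Baumslag-Solitar relation
    [b a b^-1 = a^k] with [b] a [2^e]-th power, then some [2^e d]-th power in
    [PSL(n, Z)] is conjugate to [g^d]; since high powers of matrices are congruent
    to [1] modulo high powers of [2], this bounds [e] and separates the groups. *)
Require Import Defs.
From HB Require Import structures.
From mathcomp Require Import all_boot all_order all_algebra all_fingroup all_solvable.
From mathcomp Require Import generic_quotient finmap.
From mathcomp Require Import all_classical all_reals all_analysis.
From mathcomp Require Import complex ring lra zify.

Set Implicit Arguments.
Unset Strict Implicit.
Unset Printing Implicit Defensive.

Import Order.TTheory GRing.Theory Num.Theory.
Import Normc.
Import numFieldNormedType.Exports.

Local Open Scope classical_set_scope.
Local Open Scope ring_scope.

(** * Summable families and [l^2] *)

(** Behind the construction lies a conjugacy of measure-preserving actions. The dual of the direct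
    sum of copies of [H0] is a space of [k]-valued functions on [Gam]: one two-sided digit sequence
    for each coset of [<g>]. Such a sequence spells a point of the solenoid dual to Z[1/k],
    bijectively up to null sets, and the shift along the coset becomes multiplication by [k]. This
    is where the module and its multiplier come from; the torsion of [H0] disappears because Z[1/k]
    has none. The obstacle is that a digit is a discontinuous function of the circle coordinate,
    hence no norm limit of polynomials in the unitary of a generator. In place of Borel functional
    calculus, an operator commuting with this unitary is cut into blocks between short arcs. Blocks
    between distant arcs vanish; adjacent arcs with different first digits occur only around
    finitely many endpoints, and their contribution to a matrix coefficient tends to 0 as the arcs
    shrink. Explicit rates of convergence are therefore carried through all limits. *)

Section RealSum.
Variables (R : realType) (G : choiceType).
Implicit Types (a b : G -> R) (c : R) (s : seq G).

Definition bounded_sums a c := forall s, uniq s -> \sum_(x <- s) a x <= c.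

Lemma esum_le a c : bounded_sums a c ->
  (\esum_(x in [set: G]) (a x)%:E <= c%:E)%E.
Proof.
move=> ac; apply: ge_ereal_sup => _ [A [finA _] <-].
rewrite fsbig_finite //= sumEFin lee_fin; apply: ac.
exact: fset_uniq.
Qed.

Lemma sum_le_esum a s : (forall x, 0 <= a x) -> uniq s ->
  ((\sum_(x <- s) a x)%:E <= \esum_(x in [set: G]) (a x)%:E)%E.
Proof.
move=> a0 us; apply: ereal_sup_ubound.
exists [set` s]; first by split => //; exact: finite_seq.
by rewrite -fsbig_seq // sumEFin.
Qed.

Lemma esum_fin_num a c : (forall x, 0 <= a x) -> bounded_sums a c ->
  (\esum_(x in [set: G]) (a x)%:E)%E \is a fin_num.
Proof.
move=> a0 /esum_le ac; rewrite ge0_fin_numE ?(le_lt_trans ac) ?ltry //.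
by apply: esum_ge0 => x _; rewrite lee_fin.
Qed.

Definition abs_summable a := exists c, bounded_sums (fun x => `|a x|) c.

Lemma bounded_sumsW a b c : (forall x, a x <= b x) -> bounded_sums b c ->
  bounded_sums a c.
Proof. by move=> ab bc s us; apply: le_trans (bc s us); exact: ler_sum. Qed.

Lemma abs_summableD a b :
  abs_summable a -> abs_summable b -> abs_summable (fun x => a x + b x).
Proof.
move=> [c ac] [d bd]; exists (c + d) => s us.
apply: le_trans (lerD (ac s us) (bd s us)); rewrite -big_split /=.
by apply: ler_sum => x _; exact: ler_normD.
Qed.

Lemma abs_summableW a b : (forall x, `|a x| <= `|b x|) -> abs_summable b ->
  abs_summable a.
Proof. by move=> ab [c bc]; exists c; exact: bounded_sumsW bc. Qed.

Lemma abs_summableZ c a : abs_summable a -> abs_summable (fun x => c * a x).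
Proof.
move=> [d ad]; exists (`|c| * d) => s us.
under eq_bigr do rewrite normrM.
by rewrite -mulr_sumr ler_wpM2l // ad.
Qed.

Lemma abs_summableN a : abs_summable a -> abs_summable (fun x => - a x).
Proof. by apply: abs_summableW => x; rewrite normrN. Qed.

Definition posp a x := Num.max (a x) 0.

Lemma posp_ge0 a x : 0 <= posp a x.
Proof. by rewrite /posp le_max lexx orbT. Qed.

Lemma posp_fin a : abs_summable a ->
  (\esum_(x in [set: G]) (posp a x)%:E)%E \is a fin_num.
Proof.
move=> [c ac]; apply: (@esum_fin_num _ c) => [x|]; first exact: posp_ge0.
apply: bounded_sumsW ac => x; rewrite /posp.
by rewrite ge_max ler_norm normr_ge0.
Qed.

Lemma fine_esumD a b : (forall x, 0 <= a x) -> (forall x, 0 <= b x) ->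
  (\esum_(x in [set: G]) (a x)%:E)%E \is a fin_num ->
  (\esum_(x in [set: G]) (b x)%:E)%E \is a fin_num ->
  fine (\esum_(x in [set: G]) (a x + b x)%:E) =
  fine (\esum_(x in [set: G]) (a x)%:E) + fine (\esum_(x in [set: G]) (b x)%:E).
Proof.
move=> a0 b0 fa fb; rewrite -fineD //; congr fine.
under eq_esum do rewrite EFinD.
by rewrite esumD // => x _; rewrite lee_fin.
Qed.

Lemma real_sumE a : real_sum a =
  fine (\esum_(x in [set: G]) (posp a x)%:E) -
  fine (\esum_(x in [set: G]) (posp (fun y => - a y) x)%:E).
Proof. by []. Qed.

Lemma eq_real_sum a b : a =1 b -> real_sum a = real_sum b.
Proof. by move=> /funext ->. Qed.

(** [\esum] is additive on nonnegative families only, so the negative parts are moved across: the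
    claim becomes (a+b)^+ + a^- + b^- = (a+b)^- + a^+ + b^+, which holds term by term. *)
Lemma real_sumD a b : abs_summable a -> abs_summable b ->
  real_sum (fun x => a x + b x) = real_sum a + real_sum b.
Proof.
move=> sa sb; rewrite !real_sumE.
have sab := abs_summableD sa sb.
have sNa := abs_summableN sa; have sNb := abs_summableN sb.
have sNab := abs_summableN sab.
set na := fun y => - a y; set nb := fun y => - b y.
set ab := fun y => a y + b y; set nab := fun y => - (a y + b y).
pose f (c : G -> R) := fine (\esum_(x in [set: G]) (posp c x)%:E).
suff : f ab + f na + f nb = f nab + f a + f b.
  by rewrite /f => E; lra.
have p0 := posp_ge0.
have fin3 p q r : abs_summable p -> abs_summable q -> abs_summable r ->
    f p + f q + f r =
    fine (\esum_(x in [set: G]) (posp p x + posp q x + posp r x)%:E).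
  move=> sp sq sr; rewrite /f.
  rewrite (fine_esumD (fun x => addr_ge0 (p0 p x) (p0 q x)) (p0 r)).
  - by rewrite (fine_esumD (p0 p) (p0 q)) ?(posp_fin sp) ?(posp_fin sq).
  - under eq_esum do rewrite EFinD.
    rewrite esumD; [|by move=> x _; rewrite lee_fin..].
    by rewrite fin_numD (posp_fin sp) (posp_fin sq).
  - exact: posp_fin sr.
rewrite (fin3 _ _ _ sab sNa sNb) (fin3 _ _ _ sNab sa sb).
congr fine; apply: eq_esum => x _; congr (_%:E).
have maxB (t : R) : Num.max t 0 - Num.max (- t) 0 = t.
  by rewrite !maxEle oppr_le0; case: (lerP 0 t); case: (lerP t 0) => *; lra.
have := (maxB (a x), maxB (b x), maxB (a x + b x)).
rewrite /posp /ab /na /nb /nab => -[[Ea Eb] Eab].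
move: (Num.max (a x) 0) (Num.max (b x) 0) (Num.max (- a x) 0) Ea Eb Eab.
move: (Num.max (- b x) 0) (Num.max (a x + b x) 0) (Num.max (- _) 0).
by move=> *; lra.
Qed.

Lemma real_sumN a : real_sum (fun x => - a x) = - real_sum a.
Proof.
rewrite !real_sumE opprB; congr (_ - fine _).
by apply: eq_esum => x _; rewrite /posp opprK.
Qed.

(** Bounding finite sums gives one inequality; the other is the same inequality for the factor
    c^-1. *)
Lemma fine_esumZ c a : 0 <= c -> (forall x, 0 <= a x) ->
  (\esum_(x in [set: G]) (a x)%:E)%E \is a fin_num ->
  fine (\esum_(x in [set: G]) (c * a x)%:E) =
  c * fine (\esum_(x in [set: G]) (a x)%:E).
Proof.
have half d b : 0 <= d -> (forall x, 0 <= b x) ->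
    (\esum_(x in [set: G]) (b x)%:E)%E \is a fin_num ->
    fine (\esum_(x in [set: G]) (d * b x)%:E) <=
      d * fine (\esum_(x in [set: G]) (b x)%:E)
    /\ (\esum_(x in [set: G]) (d * b x)%:E)%E \is a fin_num.
  move=> d0 b0 fb.
  have le : bounded_sums (fun x => d * b x)
      (d * fine (\esum_(x in [set: G]) (b x)%:E)).
    move=> s us; rewrite -mulr_sumr ler_wpM2l //.
    by rewrite -lee_fin fineK // sum_le_esum.
  have fdb := esum_fin_num (fun x => mulr_ge0 d0 (b0 x)) le.
  by split=> //; rewrite -lee_fin fineK // esum_le.
move=> c0 a0 fa; have [le fca] := half c a c0 a0 fa.
apply/eqP; rewrite eq_le le /=.
have [->|cn0] := eqVneq c 0.
  rewrite mul0r fine_ge0 //; apply: esum_ge0 => x _.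
  by rewrite mul0r.
have ci0 : 0 <= c^-1 by rewrite invr_ge0.
have [le2 _] := half _ _ ci0 (fun x => mulr_ge0 c0 (a0 x)) fca.
rewrite -ler_pdivlMl ?lt_def ?cn0 //; apply: le_trans le2.
by under [in leRHS]eq_esum do rewrite mulKf //.
Qed.

Lemma real_sumZ c a : abs_summable a ->
  real_sum (fun x => c * a x) = c * real_sum a.
Proof.
wlog c0 : c / 0 <= c => [hwlog sa|sa].
  have [/hwlog|c0] := leP 0 c; first exact.
  rewrite -[LHS]opprK -real_sumN.
  under eq_real_sum do rewrite -mulNr.
  by rewrite hwlog // ?mulNr ?opprK // oppr_ge0 ltW.
have pospM b x : posp (fun y => c * b y) x = c * posp b x.
  by rewrite /posp -[X in Num.max _ X](mulr0 c) -maxr_pMr.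
rewrite !real_sumE mulrBr; congr (_ - _).
  under eq_esum do rewrite pospM.
  by rewrite fine_esumZ ?posp_fin // => x; exact: posp_ge0.
under eq_esum do rewrite -[posp _ _]/(Num.max (- (c * a _)) 0) -mulrN.
under eq_esum do rewrite -[Num.max _ _]/(posp (fun y => c * - a y) _) pospM.
rewrite fine_esumZ ?posp_fin //; first by move=> x; exact: posp_ge0.
exact: abs_summableN.
Qed.

Lemma real_sum_ge0E a : (forall x, 0 <= a x) ->
  real_sum a = fine (\esum_(x in [set: G]) (a x)%:E).
Proof.
move=> a0; rewrite real_sumE.
have -> : (\esum_(x in [set: G]) (posp (fun y => - a y) x)%:E = 0)%E.
  by rewrite esum1 // => x _; rewrite /posp max_r // oppr_le0.
rewrite subr0; congr fine; apply: eq_esum => x _.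
by rewrite /posp max_l.
Qed.

Lemma real_sum1 a x0 : (forall x, x != x0 -> a x = 0) -> real_sum a = a x0.
Proof.
have pos b : (forall x, x != x0 -> b x = 0) -> (forall x, 0 <= b x) ->
    (\esum_(x in [set: G]) (b x)%:E = (b x0)%:E)%E.
  move=> b0 bp; rewrite -(@esum_set1 _ _ x0 (fun x => (b x)%:E)) ?lee_fin //.
  rewrite [RHS]esum_mkcond; apply: eq_esum => x _.
  case: (eqVneq x x0) => [->|xx0]; first by rewrite mem_set.
  by rewrite memNset ?b0 //; exact/eqP.
move=> a0; rewrite real_sumE !pos //=; first last.
- by move=> x; exact: posp_ge0.
- by move=> x /a0 ax0; rewrite /posp ax0 maxxx.
- by move=> x; exact: posp_ge0.
- by move=> x /a0 ax0; rewrite /posp ax0 oppr0 maxxx.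
by rewrite /posp !maxEle oppr_le0; case: (lerP 0 (a x0)); case: (lerP (a x0) 0) => *; lra.
Qed.

End RealSum.

Lemma real_sum_reindex (R : realType) (G H : choiceType) (f : H -> G)
    (a : G -> R) : bijective f ->
  real_sum (fun x => a (f x)) = real_sum a.
Proof.
move=> [f' fK f'K].
have E (b : G -> \bar R) :
    \esum_(x in [set: H]) b (f x) = \esum_(x in [set: G]) b x.
  rewrite -(@reindex_esum _ _ _ [set: H] [set: G] f) //.
  split=> // [x y _ _|x _]; first by move/(can_inj fK).
  by exists (f' x).
rewrite /real_sum (E (fun x => (Num.max (a x) 0)%:E)).
by rewrite (E (fun x => (Num.max (- a x) 0)%:E)).
Qed.

(** * Complex modulus and absolutely summable complex families *)

Section ComplexModulus.
Variable R : rcfType.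
Implicit Types x y : R[i].

Lemma normc_ge0 x : 0 <= normc x.
Proof. by case: x => a b; exact: sqrtr_ge0. Qed.

Lemma normCE x : `|x| = (normc x)%:C%C.
Proof. by []. Qed.

Lemma normc_conj x : normc x^*%C = normc x.
Proof. by case: x => a b /=; rewrite sqrrN. Qed.

Lemma normc_real (a : R) : normc a%:C%C = `|a|.
Proof. by rewrite /= expr0n addr0 sqrtr_sqr. Qed.

Lemma conjcD x y : (x + y)^*%C = x^*%C + y^*%C.
Proof. exact: rmorphD. Qed.

Lemma conjcM x y : (x * y)^*%C = x^*%C * y^*%C.
Proof. exact: rmorphM. Qed.

Lemma conjcN x : (- x)^*%C = - x^*%C.
Proof. exact: rmorphN. Qed.

Lemma mul_conjc x : x * x^*%C = (normc x ^+ 2)%:C%C.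
Proof. by rewrite -sqr_normc normCE rmorphXn. Qed.

Lemma sqr_normcE x : normc x ^+ 2 = complex.Re x ^+ 2 + complex.Im x ^+ 2.
Proof. by case: x => a b /=; rewrite sqr_sqrtr // addr_ge0 ?sqr_ge0. Qed.

Lemma normc_Re x : `|complex.Re x| <= normc x.
Proof.
rewrite -[leLHS]ger0_norm // -ler_sqr ?nnegrE ?normc_ge0 ?normr_ge0 //.
by rewrite normr_id real_normK ?num_real // sqr_normcE lerDl sqr_ge0.
Qed.

Lemma normc_Im x : `|complex.Im x| <= normc x.
Proof.
rewrite -[leLHS]ger0_norm // -ler_sqr ?nnegrE ?normc_ge0 ?normr_ge0 //.
by rewrite normr_id real_normK ?num_real // sqr_normcE lerDr sqr_ge0.
Qed.

Lemma normc_le_ReIm x : normc x <= `|complex.Re x| + `|complex.Im x|.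
Proof.
rewrite -ler_sqr ?nnegrE ?normc_ge0 ?addr_ge0 // sqr_normcE.
rewrite sqrrD !real_normK ?num_real // lerD2r lerDl mulrn_wge0 //.
Qed.

End ComplexModulus.

Section ComplexSum.
Variables (R : realType) (G : choiceType).
Local Notation C := R[i].
Implicit Types (a b : G -> C) (c : C).

Definition csummable a := abs_summable (fun x => normc (a x)).

Lemma csummable_Re a : csummable a -> abs_summable (fun x => complex.Re (a x)).
Proof.
apply: abs_summableW => x.
by rewrite [leRHS]ger0_norm ?normc_ge0 ?normc_Re.
Qed.

Lemma csummable_Im a : csummable a -> abs_summable (fun x => complex.Im (a x)).
Proof.
apply: abs_summableW => x.
by rewrite [leRHS]ger0_norm ?normc_ge0 ?normc_Im.
Qed.

Lemma complex_sumD a b : csummable a -> csummable b ->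
  complex_sum (fun x => a x + b x) = complex_sum a + complex_sum b.
Proof.
move=> sa sb; rewrite /complex_sum.
under eq_real_sum do rewrite raddfD.
rewrite real_sumD; try exact: csummable_Re.
under [X in (_ +i* X)%C = _]eq_real_sum do rewrite raddfD.
by rewrite real_sumD; try exact: csummable_Im.
Qed.

Lemma complex_sumZ c a : csummable a ->
  complex_sum (fun x => c * a x) = c * complex_sum a.
Proof.
move=> sa; rewrite /complex_sum; case: c => u v.
have sR := csummable_Re sa; have sI := csummable_Im sa.
have -> : real_sum (fun x => complex.Re ((u +i* v)%C * a x)) =
    u * real_sum (fun x => complex.Re (a x)) -
    v * real_sum (fun x => complex.Im (a x)).
  rewrite -!real_sumZ // -real_sumN -real_sumD.
  - by apply: eq_real_sum => x; case: (a x).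
  - exact: abs_summableZ.
  - by apply: abs_summableN; exact: abs_summableZ.
have -> : real_sum (fun x => complex.Im ((u +i* v)%C * a x)) =
    u * real_sum (fun x => complex.Im (a x)) +
    v * real_sum (fun x => complex.Re (a x)).
  rewrite -!real_sumZ // -real_sumD.
  - by apply: eq_real_sum => x; case: (a x) => ? ? /=; rewrite addrC.
  - exact: abs_summableZ.
  - exact: abs_summableZ.
by apply/eqP; rewrite eq_complex /=; apply/andP; split; apply/eqP.
Qed.

Lemma complex_sum_conj a :
  complex_sum (fun x => (a x)^*%C) = (complex_sum a)^*%C.
Proof.
rewrite /complex_sum /=; congr (_ +i* _)%C.
  by apply: eq_real_sum => x; case: (a x).
by rewrite -real_sumN; apply: eq_real_sum => x; case: (a x).
Qed.

Lemma complex_sum1 a x0 : (forall x, x != x0 -> a x = 0) ->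
  complex_sum a = a x0.
Proof.
move=> a0; rewrite /complex_sum !(@real_sum1 _ _ _ x0).
- by case: (a x0).
- by move=> x /a0 ->.
- by move=> x /a0 ->.
Qed.

Lemma eq_complex_sum a b : a =1 b -> complex_sum a = complex_sum b.
Proof. by move=> /funext ->. Qed.

End ComplexSum.

(** * The Hilbert space l^2 and its canonical basis *)

Section HilbertSpace.
Variables (R : realType) (G : choiceType).
Local Notation C := R[i].
Implicit Types (u v w : l2 R G) (c : C) (x y : G) (s : seq G).

Lemma l2_ext u v : val u =1 val v -> u = v.
Proof. by move=> /funext uv; exact: val_inj. Qed.

Lemma l2_valD u v x : val (u + v) x = val u x + val v x.
Proof. by []. Qed.

Lemma l2_valN u x : val (- u) x = - val u x.
Proof. by []. Qed.

Lemma l2_valZ c u x : val (c *: u) x = c * val u x.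
Proof. by []. Qed.

Lemma square_summableP (f : G -> C) : square_summable f <->
  exists c : R, bounded_sums (fun x => normc (f x) ^+ 2) c.
Proof.
rewrite square_summableE; split=> [ff|[c fc]].
  exists (fine (\esum_(x in [set: G]) (normc (f x) ^+ 2)%:E)) => s us.
  rewrite -lee_fin fineK; last first.
    by rewrite ge0_fin_numE // esum_ge0 // => x _; rewrite lee_fin sqr_ge0.
  by apply: sum_le_esum => // x; exact: sqr_ge0.
by apply: le_lt_trans (esum_le fc) _; rewrite ltry.
Qed.

Lemma l2_normE u : l2_norm u ^+ 2 = real_sum (fun x => normc (val u x) ^+ 2).
Proof.
rewrite /l2_norm sqr_sqrtr ?real_sum_ge0E //.
  by move=> x; exact: sqr_ge0.
by apply: fine_ge0; apply: esum_ge0 => x _; rewrite lee_fin sqr_ge0.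
Qed.

Lemma l2_norm_ge0 u : 0 <= l2_norm u.
Proof. exact: sqrtr_ge0. Qed.

Lemma sum_le_l2_norm u s : uniq s ->
  \sum_(x <- s) normc (val u x) ^+ 2 <= l2_norm u ^+ 2.
Proof.
move=> us; have /l2_predP/square_summableP[c uc] := valP u.
have n0 x : 0 <= normc (val u x) ^+ 2 by exact: sqr_ge0.
rewrite l2_normE real_sum_ge0E // -lee_fin fineK.
  exact: sum_le_esum.
exact: esum_fin_num uc.
Qed.

Lemma l2_norm_le u (c : R) : 0 <= c ->
  bounded_sums (fun x => normc (val u x) ^+ 2) (c ^+ 2) -> l2_norm u <= c.
Proof.
move=> c0 uc; rewrite -ler_sqr ?nnegrE ?l2_norm_ge0 //.
have n0 x : 0 <= normc (val u x) ^+ 2 by exact: sqr_ge0.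
rewrite l2_normE real_sum_ge0E // -lee_fin fineK ?esum_le //.
exact: esum_fin_num uc.
Qed.

Lemma normc_le_l2 u x : normc (val u x) <= l2_norm u.
Proof.
rewrite -ler_sqr ?nnegrE ?l2_norm_ge0 ?normc_ge0 //.
by have := sum_le_l2_norm u (isT : uniq [:: x]); rewrite big_seq1.
Qed.

Lemma l2_norm_eq0 u : l2_norm u = 0 -> u = 0.
Proof.
move=> u0; apply: l2_ext => x; apply: eq0_normc.
by apply/eqP; rewrite eq_le normc_ge0 andbT -u0 normc_le_l2.
Qed.

Lemma csummable_dot u v : csummable (fun x => val u x * (val v x)^*%C).
Proof.
have /l2_predP/square_summableP[c uc] := valP u.
have /l2_predP/square_summableP[d vd] := valP v.
exists (c + d) => s us; apply: le_trans (lerD (uc s us) (vd s us)).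
rewrite -big_split /=; apply: ler_sum => x _.
rewrite normcM normc_conj ger0_norm ?mulr_ge0 ?normc_ge0 //.
set p := normc (val u x); set q := normc (val v x).
have : 0 <= (p - q) ^+ 2 by exact: sqr_ge0.
have p0 : 0 <= p by exact: normc_ge0.
have q0 : 0 <= q by exact: normc_ge0.
by nra.
Qed.

Lemma l2_dotDl u v w : l2_dot (u + v) w = l2_dot u w + l2_dot v w.
Proof.
rewrite -complex_sumD; try exact: csummable_dot.
by apply: eq_complex_sum => x; rewrite -mulrDl.
Qed.

Lemma l2_dotZl c u v : l2_dot (c *: u) v = c * l2_dot u v.
Proof.
rewrite -complex_sumZ; last exact: csummable_dot.
by apply: eq_complex_sum => x; rewrite mulrA.
Qed.

Lemma l2_dotC u v : l2_dot u v = (l2_dot v u)^*%C.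
Proof.
rewrite -complex_sum_conj; apply: eq_complex_sum => x.
by rewrite rmorphM /= conjcK mulrC.
Qed.

Lemma l2_dotDr u v w : l2_dot u (v + w) = l2_dot u v + l2_dot u w.
Proof. by rewrite (l2_dotC u) l2_dotDl conjcD -!l2_dotC. Qed.

Lemma l2_dotZr c u v : l2_dot u (c *: v) = c^*%C * l2_dot u v.
Proof. by rewrite (l2_dotC u) l2_dotZl conjcM -l2_dotC. Qed.

Lemma l2_dotNl u v : l2_dot (- u) v = - l2_dot u v.
Proof. by rewrite -scaleN1r l2_dotZl mulN1r. Qed.

Lemma l2_dotNr u v : l2_dot u (- v) = - l2_dot u v.
Proof. by rewrite (l2_dotC u) l2_dotNl conjcN -l2_dotC. Qed.

Lemma l2_dot0l v : l2_dot 0 v = 0.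
Proof. by rewrite -(scale0r 0) l2_dotZl mul0r. Qed.

Lemma l2_dot0r v : l2_dot v 0 = 0.
Proof. by rewrite l2_dotC l2_dot0l conjc0. Qed.

Lemma l2_dot_suml I (r : seq I) (P : pred I) (F : I -> l2 R G) v :
  l2_dot (\sum_(i <- r | P i) F i) v = \sum_(i <- r | P i) l2_dot (F i) v.
Proof.
by apply: (big_morph (fun u => l2_dot u v)) => [u w|]; rewrite ?l2_dotDl ?l2_dot0l.
Qed.

Lemma l2_dot_sumr I (r : seq I) (P : pred I) (F : I -> l2 R G) v :
  l2_dot v (\sum_(i <- r | P i) F i) = \sum_(i <- r | P i) l2_dot v (F i).
Proof.
by apply: (big_morph (l2_dot v)) => [u w|]; rewrite ?l2_dotDr ?l2_dot0r.
Qed.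

Lemma l2_dot_self u : l2_dot u u = (l2_norm u ^+ 2)%:C%C.
Proof.
rewrite l2_normE /l2_dot /complex_sum.
apply/eqP; rewrite eq_complex /=; apply/andP; split; apply/eqP.
  by apply: eq_real_sum => x; rewrite mul_conjc.
(* Every imaginary part is 0, but [real_sum1] asks for a point of the index type, so the empty type
   is treated apart. *)
case: (pselect (exists x : G, True)) => [[x0 _]|nG].
  by rewrite (@real_sum1 _ _ _ x0) => [|x _]; rewrite mul_conjc.
rewrite /real_sum; rewrite !esum1 ?subrr //.
all: by move=> x; case: nG; exists x.
Qed.

(** Expands the square norm of |v|^2 u - <u, v> v, a multiple of the component of [u] orthogonal to
    [v]; this form avoids a division. *)
Lemma l2_cauchy_schwarz u v : normc (l2_dot u v) <= l2_norm u * l2_norm v.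
Proof.
have [v0|v0] := eqVneq (l2_norm v) 0.
  by rewrite (l2_norm_eq0 v0) l2_dot0r normc0 mulr_ge0 ?l2_norm_ge0.
have vp : 0 < l2_norm v by rewrite lt_def v0 l2_norm_ge0.
pose t := l2_dot u v; pose n : R := l2_norm v ^+ 2.
pose w := n%:C%C *: u - t *: v.
have : l2_dot w w = (n * (l2_norm u ^+ 2 * n - normc t ^+ 2))%:C%C.
  rewrite /w l2_dotDl !l2_dotDr !l2_dotNl !l2_dotNr !l2_dotZl !l2_dotZr.
  rewrite !l2_dot_self -/n -/t [l2_dot v u]l2_dotC -/t conjc_real.
  have -> : (n * (l2_norm u ^+ 2 * n - normc t ^+ 2))%:C%C =
      n%:C%C * ((l2_norm u ^+ 2)%:C%C * n%:C%C - t * t^*%C).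
    by rewrite mul_conjc !(rmorphM, rmorphB).
  by ring.
rewrite l2_dot_self => /complexI E.
have : 0 <= n * (l2_norm u ^+ 2 * n - normc t ^+ 2) by rewrite -E sqr_ge0.
rewrite pmulr_rge0 ?exprn_gt0 // subr_ge0 /n -exprMn.
by rewrite ler_sqr ?nnegrE ?mulr_ge0 ?l2_norm_ge0 ?normc_ge0.
Qed.

Lemma l2_normZ c u : l2_norm (c *: u) = normc c * l2_norm u.
Proof.
apply/eqP; rewrite -(@eqrXn2 _ 2) ?mulr_ge0 ?l2_norm_ge0 ?normc_ge0 //.
apply/eqP; apply: complexI; rewrite -l2_dot_self l2_dotZl l2_dotZr.
by rewrite l2_dot_self exprMn mulrA mul_conjc [RHS](rmorphM (real_complex R)).
Qed.

Lemma l2_normD u v : l2_norm (u + v) <= l2_norm u + l2_norm v.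
Proof.
rewrite -ler_sqr ?nnegrE ?addr_ge0 ?l2_norm_ge0 //.
have : complex.Re (l2_dot (u + v) (u + v)) = 
    l2_norm u ^+ 2 + l2_norm v ^+ 2 + complex.Re (l2_dot u v) *+ 2.
  rewrite l2_dotDl !l2_dotDr [l2_dot v u]l2_dotC !l2_dot_self !raddfD /=.
  by case: (l2_dot u v) => p q /=; ring.
rewrite l2_dot_self [LHS]/= => ->.
have := le_trans (normc_Re (l2_dot u v)) (l2_cauchy_schwarz u v).
rewrite ler_norml => /andP[_].
by move=> H; lra.
Qed.

Lemma l2_normN u : l2_norm (- u) = l2_norm u.
Proof. by rewrite -scaleN1r l2_normZ normcN normc1 mul1r. Qed.

Lemma l2_norm0 : l2_norm (0 : l2 R G) = 0.
Proof. by rewrite -(scale0r 0) l2_normZ normc0 mul0r. Qed.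

Lemma l2_normB u v : l2_norm (u - v) <= l2_norm u + l2_norm v.
Proof. by rewrite (le_trans (l2_normD _ _)) // l2_normN. Qed.

Lemma l2_distC u v : l2_norm (u - v) = l2_norm (v - u).
Proof. by rewrite -l2_normN opprB. Qed.

Lemma l2_dist_triangle w u v :
  l2_norm (u - v) <= l2_norm (u - w) + l2_norm (w - v).
Proof. by rewrite -[u - v](subrKA w) l2_normD. Qed.

Lemma l2_norm_sum I (r : seq I) (P : pred I) (F : I -> l2 R G) :
  l2_norm (\sum_(i <- r | P i) F i) <= \sum_(i <- r | P i) l2_norm (F i).
Proof.
elim/big_rec2: _ => [|i a u _ ua]; first by rewrite l2_norm0.
by rewrite (le_trans (l2_normD _ _)) // lerD2l.
Qed.

Lemma square_summable_delta x :
  (fun y => (y == x)%:R : C) \in @l2_pred R G.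
Proof.
apply/l2_predP/square_summableP; exists 1 => s us.
rewrite -(big_filter_cond _ xpredT) /= => //.
rewrite (bigID (pred1 x)) /= [X in _ + X]big1 => [|y /negPf ->]; last first.
  by rewrite normc0 expr0n.
rewrite addr0 (eq_bigr (fun=> 1)) => [|y ->]; last by rewrite normc1 expr1n.
rewrite big_const_seq iter_addr_0 count_uniq_mem ?filter_uniq //.
by case: (x \in _); rewrite ?ler01.
Qed.

Definition delta x : l2 R G := 
  Sub (fun y => (y == x)%:R : C) (square_summable_delta x).

Lemma deltaE x y : val (delta x) y = (y == x)%:R.
Proof. by []. Qed.

Lemma l2_dot_delta u x : l2_dot u (delta x) = val u x.
Proof.
rewrite /l2_dot (@complex_sum1 _ _ _ x) => [|y yx].
  by rewrite deltaE eqxx conjc1 mulr1.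
by rewrite deltaE (negPf yx) conjc0 mulr0.
Qed.

Lemma l2_dot_deltal u x : l2_dot (delta x) u = (val u x)^*%C.
Proof. by rewrite l2_dotC l2_dot_delta. Qed.

Lemma l2_norm_delta x : l2_norm (delta x) = 1.
Proof.
have := l2_dot_self (delta x); rewrite l2_dot_delta deltaE eqxx => /complexI.
move=> /esym/eqP; rewrite sqrf_eq1 => /orP[/eqP //|/eqP E].
by have := l2_norm_ge0 (delta x); rewrite E ler0N1.
Qed.

Lemma val_sum I (r : seq I) (P : pred I) (F : I -> l2 R G) x :
  val (\sum_(i <- r | P i) F i) x = \sum_(i <- r | P i) val (F i) x.
Proof. by elim/big_rec2: _ => // i a u _ <-. Qed.

(** Density of finitely supported vectors: the finite set comes within e^2 of the supremum defining
    the sum of squares, so any finite set outside it adds at most e^2. *)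
Lemma l2_truncate u (e : R) : 0 < e -> exists2 s, uniq s &
  l2_norm (u - \sum_(x <- s) val u x *: delta x) <= e.
Proof.
move=> e0; pose r x := normc (val u x) ^+ 2.
have r0 x : 0 <= r x by exact: sqr_ge0.
have /l2_predP/square_summableP[c uc] := valP u.
have fr : (\esum_(x in [set: G]) (r x)%:E)%E \is a fin_num.
  exact: esum_fin_num uc.
have [_ [A [finA _] <-]] := ub_ereal_sup_adherent (exprn_gt0 2 e0) fr.
rewrite -/(esum _ _) fsbig_finite //= sumEFin => lt.
exists (fset_set A); first exact: fset_uniq.
set s : seq G := fset_set A in lt *.
have us : uniq s by exact: fset_uniq.
apply: l2_norm_le (ltW e0) _ => t ut.
have vE x : normc (val (u - \sum_(x <- s) val u x *: delta x) x) ^+ 2 =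
    if x \in s then 0 else r x.
  rewrite l2_valD l2_valN val_sum (eq_bigr (fun y => val u y * (x == y)%:R)) //.
  case: ifPn => xs.
    rewrite (bigD1_seq x) //= big1 => [|y yx].
      by rewrite eqxx addr0 mulr1 subrr normc0 expr0n.
    by rewrite eq_sym (negPf yx) mulr0.
  rewrite big_seq big1 ?subr0 // => y ys.
  by case: eqP xs => [->|]; rewrite ?ys ?mulr0.
rewrite (eq_bigr _ (fun x _ => vE x)).
rewrite -lee_fin -(@leeD2lE _ (\sum_(x <- s) r x)%:E) //.
rewrite -[X in (X <= _)%E]EFinD.
have -> : \sum_(x <- s) r x + \sum_(x <- t) (if x \in s then 0 else r x) =
    \sum_(x <- s ++ [seq x <- t | x \notin s]) r x.
  rewrite big_cat big_filter /=; congr (_ + _).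
  by rewrite [RHS]big_mkcond; apply: eq_bigr => x _; case: ifP.
apply: (@le_trans _ _ (\esum_(x in [set: G]) (r x)%:E)%E).
  apply: sum_le_esum => //; rewrite cat_uniq us filter_uniq //= andbT.
  by apply/hasPn => x; rewrite mem_filter => /andP[].
by rewrite -leeBlDr ?fin_num_fine //; exact: ltW.
Qed.

End HilbertSpace.

(** * Bounded operators and group von Neumann algebras *)

Section BoundedMaps.
Variable R : realType.
Local Notation C := R[i].

Section Linear.
Variables (G H : choiceType) (T : l2 R G -> l2 R H).
Hypothesis linT : linear T.

Lemma lin_D u v : T (u + v) = T u + T v.
Proof. by rewrite -[u in LHS]scale1r linT scale1r. Qed.

Lemma lin_0 : T 0 = 0.
Proof. by apply: (addrI (T 0)); rewrite addr0 -lin_D addr0. Qed.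

Lemma lin_Z a u : T (a *: u) = a *: T u.
Proof. by rewrite -[_ *: _ in LHS]addr0 linT lin_0 addr0. Qed.

Lemma lin_N u : T (- u) = - T u.
Proof. by rewrite -scaleN1r lin_Z scaleN1r. Qed.

Lemma lin_B u v : T (u - v) = T u - T v.
Proof. by rewrite lin_D lin_N. Qed.

Lemma lin_sum I (r : seq I) (P : pred I) (F : I -> l2 R G) :
  T (\sum_(i <- r | P i) F i) = \sum_(i <- r | P i) T (F i).
Proof. exact: (big_morph T lin_D lin_0). Qed.

End Linear.

Definition bounded_map (G H : choiceType) (T : l2 R G -> l2 R H) :=
  linear T /\ exists K : R, forall u, l2_norm (T u) <= K * l2_norm u.

Lemma bounded_map_pos (G H : choiceType) (T : l2 R G -> l2 R H) :
  bounded_map T ->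
  exists2 K : R, 0 < K & forall u, l2_norm (T u) <= K * l2_norm u.
Proof.
move=> [_ [K TK]]; exists (Num.max K 1); first by rewrite lt_max ltr01 orbT.
move=> u; apply: le_trans (TK u) _; rewrite ler_wpM2r ?l2_norm_ge0 //.
by rewrite le_max lexx.
Qed.

Lemma bounded_map_comp (G H K : choiceType) (S : l2 R H -> l2 R K)
    (T : l2 R G -> l2 R H) :
  bounded_map S -> bounded_map T -> bounded_map (S \o T).
Proof.
move=> bS bT; have [linS _] := bS; have [linT _] := bT.
split=> [a u v|]; first by rewrite /= linT linS.
have [k k0 Sk] := bounded_map_pos bS; have [l l0 Tl] := bounded_map_pos bT.
exists (k * l) => u /=; apply: le_trans (Sk _) _.
by rewrite -mulrA ler_wpM2l // ltW.
Qed.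

Lemma bounded_map_id (G : choiceType) : bounded_map (@id (l2 R G)).
Proof. by split=> //; exists 1 => u; rewrite mul1r. Qed.

Lemma isometry_bounded (G H : choiceType) (T : l2 R G -> l2 R H) :
  linear T -> (forall u, l2_norm (T u) = l2_norm u) -> bounded_map T.
Proof. by move=> linT isoT; split=> //; exists 1 => u; rewrite mul1r isoT. Qed.

Lemma l2_small (G : choiceType) (u : l2 R G) (K : R) :
  (forall e : R, 0 < e -> l2_norm u <= K * e) -> u = 0.
Proof.
move=> uK; apply: l2_norm_eq0; apply/eqP; rewrite eq_le l2_norm_ge0 andbT.
pose k := `|K| + 1; have k0 : 0 < k by rewrite ltr_wpDl.
apply/ler_addgt0Pl => e e0; rewrite addr0.
apply: le_trans (uK (e / k) (divr_gt0 e0 k0)) _.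
rewrite mulrA ler_pdivrMr // mulrC ler_pM2l // (le_trans (ler_norm _)) //.
by rewrite lerDl.
Qed.

Lemma bounded_map_ext (G H : choiceType) (S T : l2 R G -> l2 R H) :
  bounded_map S -> bounded_map T ->
  (forall x, S (delta R x) = T (delta R x)) -> S = T.
Proof.
move=> bS bT ST; apply/funext => u; apply/eqP; rewrite -subr_eq0; apply/eqP.
have [linS _] := bS; have [linT _] := bT.
have [k k0 Sk] := bounded_map_pos bS; have [l l0 Tl] := bounded_map_pos bT.
apply: (@l2_small _ _ (k + l)) => e e0.
have [s us ue] := l2_truncate u e0.
set v := \sum_(x <- s) _ in ue.
have STv : S v = T v.
  rewrite /v (lin_sum linS) (lin_sum linT); apply: eq_bigr => x _.
  by rewrite (lin_Z linS) (lin_Z linT) ST.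
have -> : S u - T u = S (u - v) - T (u - v).
  by rewrite (lin_B linS) (lin_B linT) STv opprB addrA subrK.
apply: le_trans (l2_normB _ _) _; rewrite mulrDl.
by apply: lerD; [apply: le_trans (Sk _) _|apply: le_trans (Tl _) _];
  rewrite ler_pM2l.
Qed.

Lemma l2_dot_inj (G : choiceType) (u v : l2 R G) :
  (forall w, l2_dot w u = l2_dot w v) -> u = v.
Proof.
move=> uv; apply: l2_ext => x; apply: (can_inj (@conjcK R)).
by rewrite -!l2_dot_deltal uv.
Qed.

(** By polarisation the norm determines the real part of the inner product, and the imaginary part
    of <w, z> is the real part of <w, i z>. *)
Lemma isometry_dot (G H : choiceType) (T : l2 R G -> l2 R H) :
  linear T -> (forall u, l2_norm (T u) = l2_norm u) ->
  forall u v, l2_dot (T u) (T v) = l2_dot u v.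
Proof.
move=> linT isoT u v.
have polar (K : choiceType) (w z : l2 R K) : complex.Re (l2_dot w z) =
    (l2_norm (w + z) ^+ 2 - l2_norm w ^+ 2 - l2_norm z ^+ 2) / 2.
  have : complex.Re (l2_dot (w + z) (w + z)) = 
      l2_norm w ^+ 2 + l2_norm z ^+ 2 + complex.Re (l2_dot w z) *+ 2.
    rewrite l2_dotDl !l2_dotDr [l2_dot z w]l2_dotC !l2_dot_self !raddfD /=.
    by case: (l2_dot w z) => p q /=; ring.
  rewrite l2_dot_self [LHS]/= => ->.
  by rewrite -mulr_natr; field.
have ReT w z : complex.Re (l2_dot (T w) (T z)) = complex.Re (l2_dot w z).
  by rewrite !polar -(lin_D linT) !isoT.
have ImRe (K : choiceType) (w z : l2 R K) :
    complex.Im (l2_dot w z) = complex.Re (l2_dot w ('i%C *: z)).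
  by rewrite l2_dotZr; case: (l2_dot w z) => p q /=; ring.
apply/eqP; rewrite eq_complex ReT eqxx andTb; apply/eqP.
by rewrite !ImRe -(lin_Z linT) ReT.
Qed.

(** The coefficients <v, T delta_x> of [T' v] are forced. Over a finite set their square sum q is
    both |w|^2 and <v, T w> for w the vector with these coefficients, so q <= |v| k |w|, which
    yields q <= (k |v|)^2. Truncation extends the adjunction to all vectors. *)
Lemma adjoint_exists (G H : choiceType) (T : l2 R G -> l2 R H) :
  bounded_map T -> exists2 T' : l2 R H -> l2 R G,
    bounded_map T' & forall u v, l2_dot (T u) v = l2_dot u (T' v).
Proof.
move=> bT; have [linT _] := bT; have [k k0 Tk] := bounded_map_pos bT.
pose f v x := l2_dot v (T (delta R x)).
have fk v s : uniq s -> \sum_(x <- s) normc (f v x) ^+ 2 <= (k * l2_norm v) ^+ 2.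
  move=> us; set q := \sum_(x <- s) _.
  have q0 : 0 <= q by apply: sumr_ge0 => x _; exact: sqr_ge0.
  pose w : l2 R G := \sum_(x <- s) f v x *: delta R x.
  have wE : l2_norm w ^+ 2 = q.
    apply: complexI; rewrite -l2_dot_self /q rmorph_sum {1}/w l2_dot_suml.
    rewrite big_seq [RHS]big_seq; apply: eq_bigr => x xs.
    rewrite l2_dotZl l2_dot_deltal val_sum.
    rewrite -[RHS]mul_conjc; congr (_ * _^*%C).
    rewrite (eq_bigr (fun y => f v y * (x == y)%:R)) //.
    rewrite (bigD1_seq x) //= big1 => [|y yx].
      by rewrite eqxx mulr1 addr0.
    by rewrite eq_sym (negPf yx) mulr0.
  have qE : l2_dot v (T w) = q%:C%C.
    rewrite /w (lin_sum linT) l2_dot_sumr /q rmorph_sum; apply: eq_bigr => x _.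
    by rewrite (lin_Z linT) l2_dotZr mulrC mul_conjc.
  have : q <= l2_norm v * (k * l2_norm w).
    have := l2_cauchy_schwarz v (T w); rewrite qE normc_real ger0_norm //.
    move=> /le_trans; apply; rewrite ler_wpM2l ?l2_norm_ge0 //.
  rewrite mulrA [_ * k]mulrC -wE.
  have [->|w0] := eqVneq (l2_norm w) 0; first by rewrite expr0n /= sqr_ge0.
  have wp : 0 < l2_norm w by rewrite lt_def w0 l2_norm_ge0.
  rewrite {1}expr2 ler_pM2r // => wk.
  by rewrite ler_sqr // nnegrE ?mulr_ge0 ?l2_norm_ge0 // ltW.
have fl2 v : f v \in @l2_pred R G.
  by apply/l2_predP/square_summableP; exists ((k * l2_norm v) ^+ 2) => s /fk.
pose T' v : l2 R G := Sub (f v) (fl2 v).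
have bT' : bounded_map T'.
  split=> [a u v|].
    by apply: l2_ext => x; rewrite [LHS]/(f _ _) /f l2_dotDl l2_dotZl.
  exists k => u; apply: l2_norm_le; first by rewrite mulr_ge0 ?l2_norm_ge0 ?ltW.
  by move=> s us; exact: fk.
exists T' => // u v.
apply/eqP; rewrite -subr_eq0; apply/eqP; apply: eq0_normc.
have [linT' _] := bT'; have [k' k'0 T'k] := bounded_map_pos bT'.
apply/eqP; rewrite eq_le normc_ge0 andbT.
apply/ler_addgt0Pl => e e0; rewrite addr0.
pose m := (k + k') * l2_norm v + 1.
have m0 : 0 < m.
  by rewrite ltr_wpDl // mulr_ge0 ?l2_norm_ge0 // addr_ge0 // ltW.
have [s us ue] := l2_truncate u (divr_gt0 e0 m0).
set w := \sum_(x <- s) _ in ue.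
have Ew : l2_dot (T w) v = l2_dot w (T' v).
  rewrite /w (lin_sum linT) !l2_dot_suml; apply: eq_bigr => x _.
  rewrite (lin_Z linT) !l2_dotZl l2_dot_deltal; congr (_ * _).
  by rewrite l2_dotC.
have -> : l2_dot (T u) v - l2_dot u (T' v) =
    l2_dot (T (u - w)) v - l2_dot (u - w) (T' v).
  by rewrite (lin_B linT) !l2_dotDl !l2_dotNl Ew; ring.
apply: le_trans (le_normcD _ _) _; rewrite normcN.
apply: le_trans (lerD (l2_cauchy_schwarz _ _) (l2_cauchy_schwarz _ _)) _.
have nv := l2_norm_ge0 v; have nu := l2_norm_ge0 (u - w).
apply: (@le_trans _ _ (l2_norm (u - w) * ((k + k') * l2_norm v))).
  rewrite mulrDl mulrDr; apply: lerD.
    by rewrite mulrA ler_wpM2r // [leRHS]mulrC.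
  by rewrite ler_wpM2l.
apply: (@le_trans _ _ (l2_norm (u - w) * m)).
  by rewrite ler_wpM2l // lerDl.
by rewrite -ler_pdivlMr.
Qed.

End BoundedMaps.

Section LeftRegular.
Variables (R : realType) (G : groupType).
Implicit Types (x y g : G) (u v : l2 R G).

Lemma left_regularE g u x : val (left_regular g u) x = val u (g^-1 * x)%g.
Proof. by []. Qed.

Lemma left_regular_linear g : linear (@left_regular R G g).
Proof. by move=> a u v; apply: l2_ext => x. Qed.

Lemma left_regular_norm g u : l2_norm (left_regular g u) = l2_norm u.
Proof.
apply/eqP; rewrite -(@eqrXn2 _ 2) ?l2_norm_ge0 // !l2_normE; apply/eqP.
apply: (@real_sum_reindex R G G (fun x => (g^-1 * x)%g)
  (fun x => normc (val u x) ^+ 2)).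
by exists (fun x => (g * x)%g) => x; rewrite ?mulKVg ?mulKg.
Qed.

Lemma left_regularM g h : left_regular (g * h)%g =
  left_regular g \o left_regular h :> (l2 R G -> l2 R G).
Proof.
apply/funext => u; apply: l2_ext => x.
by rewrite /= invgM mulgA.
Qed.

Lemma left_regular1 : left_regular 1%g = id :> (l2 R G -> l2 R G).
Proof. by apply/funext => u; apply: l2_ext => x; rewrite /= invg1 mul1g. Qed.

Lemma left_regular_delta g x :
  left_regular g (delta R x) = delta R (g * x)%g.
Proof.
apply: l2_ext => y; rewrite left_regularE !deltaE; congr (nat_of_bool _)%:R.
by apply/eqP/eqP => [<-|->]; rewrite ?mulKVg ?mulKg.
Qed.

Lemma left_regular_adj g u v :
  l2_dot (left_regular g u) v = l2_dot u (left_regular g^-1%g v).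
Proof.
rewrite -(isometry_dot (left_regular_linear g^-1%g)
  (left_regular_norm g^-1%g)).
rewrite -[left_regular _ (left_regular _ u)]/((_ \o _) u).
by rewrite -left_regularM mulVg left_regular1.
Qed.

Lemma left_regular_bounded g : bounded_op (@left_regular R G g).
Proof.
exact: isometry_bounded (left_regular_linear g) (left_regular_norm g).
Qed.

Lemma commutant_antitone (M N : set (l2 R G -> l2 R G)) :
  M `<=` N -> commutant N `<=` commutant M.
Proof. by move=> MN T [bT NT]; split=> // S /MN; exact: NT. Qed.

(** [group_vna] is an intersection of algebras [N], and the bicommutant is monotone and fixes each
    [N]. Membership is thus reduced to commutation with the commutant. *)
Lemma bicommutant_sub_vna :
  commutant (commutant (range (@left_regular R G))) `<=` group_vna R G.
Proof.
move=> T TM N [vN MN]; rewrite -(vna_bicommutant vN).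
by apply: commutant_antitone TM; exact: commutant_antitone.
Qed.

End LeftRegular.

(** * Spatial isomorphisms of von Neumann algebras *)

Section UnitaryConjugation.
Variables (R : realType) (G H : choiceType).

Record inverse_unitaries (U : l2 R G -> l2 R H) (W : l2 R H -> l2 R G) : Prop :=
  InverseUnitaries {
    iu_bounded : bounded_map U;
    iu_bounded_inv : bounded_map W;
    iu_UK : cancel U W;
    iu_WK : cancel W U;
    iu_adj : forall u v, l2_dot (U u) v = l2_dot u (W v)
  }.

End UnitaryConjugation.

Lemma inverse_unitaries_sym (R : realType) (G H : choiceType)
    (U : l2 R G -> l2 R H) (W : l2 R H -> l2 R G) :
  inverse_unitaries U W -> inverse_unitaries W U.
Proof.
move=> [bU bW UK WK adj]; split=> // u v.
by rewrite l2_dotC -adj -l2_dotC.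
Qed.

Definition conj_op (R : realType) (G H : choiceType)
    (U : l2 R G -> l2 R H) (W : l2 R H -> l2 R G)
    (T : l2 R G -> l2 R G) : l2 R H -> l2 R H := U \o T \o W.

Section ConjugateAlgebra.
Variables (R : realType) (G H : choiceType).
Variables (U : l2 R G -> l2 R H) (W : l2 R H -> l2 R G).
Hypothesis UW : inverse_unitaries U W.
Implicit Types S T : l2 R G -> l2 R G.

Let linU : linear U := (iu_bounded UW).1.
Let linW : linear W := (iu_bounded_inv UW).1.

Lemma conj_opK T : conj_op W U (conj_op U W T) = T.
Proof. by apply/funext => u; rewrite /conj_op /= !(iu_UK UW). Qed.

Lemma conj_op_id : conj_op U W id = id.
Proof. by apply/funext => u; rewrite /conj_op /= (iu_WK UW). Qed.

Lemma conj_op_bounded T : bounded_op T -> bounded_op (conj_op U W T).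
Proof.
move=> bT; apply: (bounded_map_comp _ (iu_bounded_inv UW)).
exact: bounded_map_comp (iu_bounded UW) bT.
Qed.

Lemma conj_opD S T : conj_op U W (S + T) = conj_op U W S + conj_op U W T.
Proof. by apply/funext => u; rewrite /conj_op /= (lin_D linU). Qed.

Lemma conj_opZ a T : conj_op U W (a *: T) = a *: conj_op U W T.
Proof. by apply/funext => u; rewrite /conj_op /= (lin_Z linU). Qed.

Lemma conj_op_comp S T : conj_op U W (S \o T) = conj_op U W S \o conj_op U W T.
Proof. by apply/funext => u; rewrite /conj_op /= (iu_UK UW). Qed.

Lemma conj_op_adjoint S T :
  is_adjoint S T -> is_adjoint (conj_op U W S) (conj_op U W T).
Proof.
move=> ST u v; rewrite /conj_op /= (iu_adj UW) ST.
by rewrite (iu_adj (inverse_unitaries_sym UW)).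
Qed.

End ConjugateAlgebra.

Section ConjugateVNA.
Variables (R : realType) (G H : choiceType).
Variables (U : l2 R G -> l2 R H) (W : l2 R H -> l2 R G).
Hypothesis UW : inverse_unitaries U W.
Let WU := inverse_unitaries_sym UW.

Lemma commutant_conj (N : set (l2 R H -> l2 R H)) :
  commutant (conj_op U W @^-1` N) = conj_op U W @^-1` commutant N.
Proof.
apply/seteqP; split=> T.
  move=> [bT TN]; split=> [|S NS]; first exact: conj_op_bounded.
  have : (conj_op U W @^-1` N) (conj_op W U S).
    by rewrite /preimage /= (conj_opK WU).
  move=> /TN /(congr1 (conj_op U W)).
  by rewrite (conj_op_comp UW _ T) (conj_op_comp UW T) (conj_opK WU).
move=> [bT TN]; split=> [|S NS].
  by rewrite -(conj_opK UW T); exact: (conj_op_bounded WU).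
have /(congr1 (conj_op W U)) := TN _ NS.
rewrite (conj_op_comp WU (conj_op U W S)) (conj_op_comp WU (conj_op U W T)).
by rewrite !(conj_opK UW).
Qed.

Lemma vna_conj (N : set (l2 R H -> l2 R H)) :
  von_neumann_algebra N -> von_neumann_algebra (conj_op U W @^-1` N).
Proof.
move=> vN; split.
- move=> T /(vna_bounded vN) bT.
  by rewrite -(conj_opK UW T); exact: (conj_op_bounded WU).
- by rewrite /preimage /= (conj_op_id UW); exact: vna_id.
- by move=> S T; rewrite /preimage /= (conj_opD UW); exact: vna_add.
- by move=> a T; rewrite /preimage /= (conj_opZ UW); exact: vna_scale.
- by move=> S T; rewrite /preimage /= (conj_op_comp UW); exact: vna_comp.
- move=> T /(vna_adjoint vN)[T' NT' TT']; exists (conj_op W U T').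
    by rewrite /preimage /= (conj_opK WU).
  by rewrite -(conj_opK UW T); exact: (conj_op_adjoint WU).
- by rewrite !commutant_conj (vna_bicommutant vN).
Qed.

End ConjugateVNA.

(** The intersection defining the generated algebra is handled one [N] at a time: the operators
    whose conjugate lies in [N] form a von Neumann algebra containing the translations. *)
Lemma group_vna_conj (R : realType) (G H : groupType)
    (U : l2 R G -> l2 R H) (W : l2 R H -> l2 R G) (T : l2 R G -> l2 R G) :
  inverse_unitaries U W ->
  (forall g, commutant (commutant (range (@left_regular R H)))
    (conj_op U W (left_regular g))) ->
  group_vna R G T -> group_vna R H (conj_op U W T).
Proof.
move=> UW Ug GT N [vN HN].
apply: (GT (conj_op U W @^-1` N)); split; first exact: vna_conj.
move=> _ [g _ <-]; apply: (bicommutant_sub_vna (Ug g)).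
by split.
Qed.

Lemma star_isomorphic_conj (R : realType) (G H : groupType)
    (U : l2 R G -> l2 R H) (W : l2 R H -> l2 R G) :
  inverse_unitaries U W ->
  (forall g, commutant (commutant (range (@left_regular R H)))
    (conj_op U W (left_regular g))) ->
  (forall h, commutant (commutant (range (@left_regular R G)))
    (conj_op W U (left_regular h))) ->
  star_isomorphic (group_vna R G) (group_vna R H).
Proof.
move=> UW Ug Wh; have WU := inverse_unitaries_sym UW.
exists (conj_op U W); split.
- split.
  + by move=> T; exact: group_vna_conj.
  + by move=> S T _ _ /(congr1 (conj_op W U)); rewrite !(conj_opK UW).
  + move=> T HT; exists (conj_op W U T); first exact: group_vna_conj.
    by rewrite (conj_opK WU).
- by move=> S T _ _; rewrite (conj_opD UW).
- by move=> a T _; rewrite (conj_opZ UW).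
- by move=> S T _ _; rewrite (conj_op_comp UW).
- by move=> S T _ _; exact: conj_op_adjoint.
Qed.

(** * Representations with the trace and the commutant of the regular one *)

Section Implementation.
Variables (R : realType) (L G : groupType).
Variable pi : L -> l2 R G -> l2 R G.
Hypothesis pi_lin : forall x, linear (pi x).
Hypothesis pi_norm : forall x u, l2_norm (pi x u) = l2_norm u.
Hypothesis pi1 : pi 1%g = id.
Hypothesis piM : forall x y, pi (x * y)%g = pi x \o pi y.
Hypothesis pi_trace : forall x, x != 1%g -> val (pi x (delta R 1%g)) 1%g = 0.
Hypothesis pi_commutant : forall S, bounded_op S ->
  ((forall x, S \o pi x = pi x \o S) <->
   (forall y, S \o left_regular y = left_regular y \o S)).

Let e x := pi x (delta R 1%g).

Let pi_dot x u v : l2_dot (pi x u) (pi x v) = l2_dot u v.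
Proof. exact: isometry_dot (@pi_lin x) (@pi_norm x) u v. Qed.

Let piVK x : cancel (pi x^-1%g) (pi x).
Proof. by move=> u; rewrite -[LHS]/((pi _ \o pi _) u) -piM mulgV pi1. Qed.

Let pi_adj x u v : l2_dot (pi x u) v = l2_dot u (pi x^-1%g v).
Proof. by rewrite -{1}[v](piVK x) pi_dot. Qed.

(** By unitarity this is the coefficient of [pi (y^-1 * x)] at the identity, so the trace hypothesis
    makes the orbit of [delta 1] orthonormal. *)
Let e_dot x y : l2_dot (e x) (e y) = (x == y)%:R.
Proof.
rewrite /e l2_dotC pi_adj l2_dotC conjcK -[pi _ (pi _ _)]/((pi _ \o pi _) _).
rewrite -piM l2_dot_delta; case: eqVneq => [->|xy].
  by rewrite mulVg pi1 deltaE eqxx.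
rewrite pi_trace //; apply: contra_neq xy => yx.
by rewrite -[x](mulKVg y) yx mulg1.
Qed.

Let wt w x := l2_dot w (e x).

(** Bessel's inequality places the coefficients of [w] along the orbit in l^2 before the orbit is
    known to span. *)
Let bessel w s : uniq s -> \sum_(x <- s) normc (wt w x) ^+ 2 <= l2_norm w ^+ 2.
Proof.
move=> us; set q := \sum_(x <- s) _.
pose v := \sum_(x <- s) wt w x *: e x.
have wv : l2_dot w v = q%:C%C.
  rewrite /v l2_dot_sumr /q rmorph_sum; apply: eq_bigr => x _.
  by rewrite l2_dotZr mulrC mul_conjc.
have vv : l2_dot v v = q%:C%C.
  rewrite {1}/v l2_dot_suml /q rmorph_sum big_seq [RHS]big_seq.
  apply: eq_bigr => x xs; rewrite l2_dotZl -[RHS]mul_conjc; congr (_ * _).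
  rewrite /v l2_dot_sumr (bigD1_seq x) //= big1 => [|y yx].
    by rewrite l2_dotZr e_dot eqxx mulr1 addr0.
  by rewrite l2_dotZr e_dot eq_sym (negPf yx) mulr0.
have : l2_dot (w - v) (w - v) = (l2_norm w ^+ 2 - q)%:C%C.
  rewrite l2_dotDl !l2_dotDr !l2_dotNl !l2_dotNr vv wv.
  rewrite [l2_dot v w]l2_dotC wv conjc_real l2_dot_self.
  by rewrite [RHS]rmorphB; ring.
by rewrite l2_dot_self => /complexI E; rewrite -subr_ge0 -E sqr_ge0.
Qed.

Let wt_l2 w : wt w \in @l2_pred R L.
Proof. by apply/l2_predP/square_summableP; exists (l2_norm w ^+ 2) => s /bessel. Qed.

Let W w : l2 R L := Sub (wt w) (wt_l2 w).

Let WE w x : val (W w) x = l2_dot w (e x).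
Proof. by []. Qed.

Let bW : bounded_map W.
Proof.
split=> [a u v|].
  by apply: l2_ext => x; rewrite [LHS]/(wt _ _) /wt l2_dotDl l2_dotZl.
exists 1 => w; rewrite mul1r; apply: l2_norm_le (l2_norm_ge0 w) _ => s.
exact: bessel.
Qed.

Let We x : W (e x) = delta R x.
Proof. by apply: l2_ext => y; rewrite deltaE eq_sym -e_dot. Qed.

(* The coefficient map [W] intertwines [pi] with the regular representation, and
   so does its adjoint [U]. Thus [U \o W] commutes with [pi], hence with
   [left_regular]; as it fixes [delta 1], it is the identity. *)
Theorem star_isomorphic_implementation :
  star_isomorphic (group_vna R L) (group_vna R G).
Proof.
have [U bU adj] := adjoint_exists bW.
have adj' v w : l2_dot (U v) w = l2_dot v (W w).
  by rewrite l2_dotC -adj -l2_dotC.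
have linU := bU.1; have linW := bW.1.
have WU : cancel U W.
  move=> v; apply: l2_ext => x.
  by rewrite WE adj' We l2_dot_delta.
have Ud x : U (delta R x) = e x.
  apply: l2_ext => y; rewrite -!(l2_dot_delta _ y) adj' l2_dot_deltal.
  by rewrite WE -l2_dotC.
have Wpi x w : W (pi x w) = left_regular x (W w).
  apply: l2_ext => y; rewrite left_regularE !WE pi_adj.
  rewrite /e -[pi _ (pi _ _)]/((pi _ \o pi _) _).
  by rewrite -piM.
have Upi x v : U (left_regular x v) = pi x (U v).
  apply: l2_dot_inj => w; rewrite -adj l2_dotC left_regular_adj -l2_dotC -Wpi adj.
  by rewrite l2_dotC -pi_adj -l2_dotC.
have UWpi x : (U \o W) \o pi x = pi x \o (U \o W).
  by apply/funext => w; rewrite /= Wpi Upi.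
have bUW : bounded_op (U \o W) by exact: bounded_map_comp bU bW.
have /(pi_commutant bUW) UWlam := UWpi.
have UWid : U \o W = id.
  apply: bounded_map_ext bUW (bounded_map_id _ _) _ => y.
  have -> : delta R y = left_regular y (delta R 1%g).
    by rewrite left_regular_delta mulg1.
  have /(congr1 (fun T => T (delta R 1%g))) /= -> := UWlam y.
  have -> : delta R (1%g : G) = e 1%g by rewrite /e pi1.
  by rewrite We Ud.
have UWK : cancel W U by move=> w; rewrite -[LHS]/((U \o W) w) UWid.
have iu : inverse_unitaries U W by split.
have piE x : conj_op U W (left_regular x) = pi x.
  by apply/funext => w; rewrite /conj_op /= Upi UWK.
apply: (star_isomorphic_conj iu) => [x|y].
  rewrite piE; split=> [|S [bS Sl]].
    exact: isometry_bounded (@pi_lin x) (@pi_norm x).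
  apply: ((pi_commutant bS).2 _ x) => y.
  by apply/esym/Sl; exists y.
have iu' := inverse_unitaries_sym iu.
split; first exact: (conj_op_bounded iu') (left_regular_bounded _ y).
move=> S [bS Sl]; have bUS := conj_op_bounded iu bS.
have /(pi_commutant bUS) : forall x,
    conj_op U W S \o pi x = pi x \o conj_op U W S.
  move=> x; rewrite -piE -(conj_op_comp iu S) -(conj_op_comp iu _ S).
  congr (conj_op U W _).
  by apply/esym/Sl; exists x.
move=> /(_ y) /(congr1 (conj_op W U)).
rewrite (conj_op_comp iu' (conj_op U W S)) (conj_op_comp iu' _ (conj_op U W S)).
by rewrite (conj_opK iu).
Qed.

End Implementation.

(** * Characters of a finite abelian group *)

Section UnitCircle.
Variable R : realType.
Local Notation C := R[i].
Implicit Types (r s x y : R).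

Definition expi r : C := (cos (2 * pi * r) +i* sin (2 * pi * r))%C.

Lemma expiD r s : expi (r + s) = expi r * expi s.
Proof.
rewrite /expi mulrDr cosD sinD.
by apply/eqP; rewrite eq_complex /=; apply/andP; split; apply/eqP; ring.
Qed.

Lemma expi0 : expi 0 = 1.
Proof. by rewrite /expi mulr0 cos0 sin0. Qed.

Lemma expi1 : expi 1 = 1.
Proof. by rewrite /expi mulr1 mulr_natl cos2pi sin2pi. Qed.

Lemma expiMn r n : expi (r * n%:R) = expi r ^+ n.
Proof.
elim: n => [|n IHn]; first by rewrite mulr0 expi0.
by rewrite -natr1 mulrDr mulr1 expiD IHn exprSr.
Qed.

Lemma expiN r : expi (- r) = (expi r)^*%C.
Proof. by rewrite /expi mulrN cosN sinN. Qed.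

Lemma normc_expi r : normc (expi r) = 1.
Proof. by rewrite /= cos2Dsin2 sqrtr1. Qed.

Lemma expi_nat n : expi n%:R = 1.
Proof. by rewrite -[n%:R]mul1r expiMn expi1 expr1n. Qed.

Lemma expi_int r : r \is a Num.int -> expi r = 1.
Proof.
move=> /intrP[[n|n] ->]; first exact: expi_nat.
by rewrite NegzE mulrNz expiN expi_nat conjc1.
Qed.

Lemma expiDint r s : s \is a Num.int -> expi (r + s) = expi r.
Proof. by move=> /expi_int E; rewrite expiD E mulr1. Qed.

Lemma abs_sin_le x : `|sin x| <= `|x|.
Proof.
wlog x0 : x / 0 < x => [hwlog|].
  have [x0|x0|<-] := ltrgtP 0 x; first exact: hwlog.
    have := hwlog (- x); rewrite sinN !normrN oppr_gt0; exact.
  by rewrite sin0.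
have [|c _] := @MVT R sin cos 0 x x0 (fun z _ => is_derive_sin z).
  by apply: continuous_subspaceT => z; exact: continuous_sin.
rewrite sin0 !subr0 => ->; rewrite normrM ler_piMl ?normr_ge0 //.
exact: cos_max.
Qed.

(** The left side is 2 |sin (pi r)|; the constant 8 comes from the crude bound pi <= 4. *)
Lemma normc_expiB1 r : normc (expi r - 1) <= 8 * `|r|.
Proof.
have E : normc (expi r - 1) ^+ 2 = (2 * sin (pi * r)) ^+ 2.
  rewrite sqr_normcE /=.
  have -> : 2 * pi * r = pi * r + pi * r by ring.
  rewrite cosD sinD; set c := cos _; set s := sin _.
  have cs : c ^+ 2 = 1 - s ^+ 2 by rewrite -(cos2Dsin2 (pi * r)) addrK.
  have -> : (c * c - s * s + -1) ^+ 2 + (s * c + c * s + -0) ^+ 2 =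
    (c ^+ 2 - s ^+ 2 - 1) ^+ 2 + 4 * s ^+ 2 * c ^+ 2 by ring.
  by rewrite cs; ring.
rewrite -ler_sqr ?nnegrE ?normc_ge0 ?mulr_ge0 // E.
rewrite -[leLHS]real_normK ?num_real // ler_sqr ?nnegrE ?mulr_ge0 //.
rewrite normrM ger0_norm //; have := abs_sin_le (pi * r).
rewrite normrM (ger0_norm (pi_ge0 R)) => sr.
have [/andP[_ pi2] _] := pihalf_02_cos_pihalf R.
have pi4 : (pi : R) <= 4 by lra.
have : pi * `|r| <= 4 * `|r| by rewrite ler_wpM2r.
by lra.
Qed.

Lemma normc_expiXB1 r n : normc (expi r ^+ n - 1) <= n%:R * normc (expi r - 1).
Proof.
elim: n => [|n IHn]; first by rewrite expr0 subrr normc0 mul0r.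
have -> : expi r ^+ n.+1 - 1 = (expi r ^+ n - 1) + expi r ^+ n * (expi r - 1).
  by rewrite exprSr; ring.
rewrite -natr1 mulrDl mul1r (le_trans (le_normcD _ _)) // lerD //.
by rewrite -expiMn normcM normc_expi mul1r.
Qed.

(** On this quarter of the circle the cosine is nonpositive, so the real part of [expi x - 1] is at
    most -1. *)
Lemma normc_expi_half x : 1 / 4 <= x <= 1 / 2 -> 1 <= normc (expi x - 1).
Proof.
move=> /andP[x4 x2]; apply: le_trans (normc_Re _).
have p0 : 0 < (pi : R) := pi_gt0 R.
have : 0 <= cos (pi - 2 * pi * x).
  apply: cos_ge0_pihalf; apply/andP; split; first by nra.
  by nra.
have -> : pi - 2 * pi * x = - (2 * pi * x) + pi by ring.
rewrite cosDpi cosN => c0.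
by rewrite /= ler_normr; apply/orP; right; lra.
Qed.

Lemma normc_expi_lb x : 0 <= x <= 1 / 2 -> x <= normc (expi x - 1).
Proof.
move=> /andP[x0 x2].
have [x4|x4] := lerP (1 / 4) x.
  by apply: (@le_trans _ _ 1); [lra|apply: normc_expi_half; rewrite x4].
have [->|xn0] := eqVneq x 0; first exact: normc_ge0.
have xp : 0 < x by rewrite lt_def xn0.
(* A small angle is magnified: the integer part [m] of 1/(2x) brings m x into [1/4, 1/2], and |z^m -
   1| <= m |z - 1| brings the bound back to [x]. *)
have yp : 0 <= (2 * x)^-1 by rewrite invr_ge0; lra.
have /andP[mle mgt] := truncn_itv yp.
set m := Num.truncn _ in mle mgt.
have xV : (2 * x)^-1 * x = 1 / 2 by field.
have mx : m%:R * x <= 1 / 2 by rewrite -xV ler_wpM2r.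
have mx' : 1 / 2 < m.+1%:R * x by rewrite -xV ltr_pM2r.
have := normc_expiXB1 x m; rewrite -expiMn.
have /normc_expi_half : 1 / 4 <= x * m%:R <= 1 / 2.
  rewrite [x * _]mulrC; apply/andP; split=> //.
  by move: mx'; rewrite -[m.+1%:R]natr1 mulrDl mul1r; lra.
move=> /le_trans h /h{h} h; have := normc_ge0 (expi x - 1).
move: (normc _) h => q h q0.
have m0 : 0 <= m%:R :> R by [].
have : m%:R * x <= m%:R * q by lra.
have mp : 0 < m%:R :> R by rewrite lt_def m0 andbT; apply/eqP => E; move: h; rewrite E; lra.
by rewrite ler_pM2l.
Qed.

Lemma expi_eq1 r : expi r = 1 -> r \is a Num.int.
Proof.
move=> r1; pose x := r - (Num.floor r)%:~R.
have xint : (Num.floor r)%:~R \is a @Num.int R by exact: intr_int.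
have x1 : expi x = 1 by rewrite expiDint // rpredN.
have /andP[fl fu] := floor_itv r.
have x0 : 0 <= x by rewrite /x; lra.
have xl1 : x < 1 by move: fu; rewrite intrD /x; lra.
suff -> : r = (Num.floor r)%:~R by [].
apply/eqP; rewrite -subr_eq0 -/x; apply/eqP.
have [xh|xh] := lerP x (1 / 2).
  have := @normc_expi_lb x; rewrite x0 xh x1 subrr normc0 => /(_ isT).
  by lra.
have : expi (1 - x) = 1 by rewrite addrC expiD expi1 mulr1 expiN x1 conjc1.
have := @normc_expi_lb (1 - x); have -> : 0 <= 1 - x <= 1 / 2 by lra.
by move=> /(_ isT) + E; rewrite E subrr normc0; lra.
Qed.

Lemma normc_expi_frac (d K : nat) : (d <= K)%N -> (0 < K)%N ->
  (minn d (K - d))%:R / K%:R <= normc (expi (d%:R / K%:R) - 1).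
Proof.
move=> dK K0; have Kp : 0 < K%:R :> R by rewrite ltr0n.
have KV : K%:R / K%:R = 1 :> R by rewrite divff ?gt_eqF.
case: (leqP d.*2 K) => dK2.
  have -> : minn d (K - d) = d by lia.
  apply: normc_expi_lb; rewrite divr_ge0 //=.
  rewrite ler_pdivrMr //; have : (d.*2)%:R <= K%:R :> R by rewrite ler_nat.
  by rewrite -muln2 natrM; lra.
have -> : minn d (K - d) = (K - d)%N by lia.
have -> : normc (expi (d%:R / K%:R) - 1) =
    normc (expi ((K - d)%:R / K%:R) - 1).
  rewrite natrB // mulrBl KV [1 - _]addrC expiD expi1 mulr1 expiN.
  by rewrite -[in RHS]conjc1 -conjcN -conjcD normc_conj.
apply: normc_expi_lb; rewrite divr_ge0 //=.
rewrite ler_pdivrMr //; have : ((K - d).*2)%:R <= K%:R :> R by rewrite ler_nat; lia.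
by rewrite -muln2 natrM; lra.
Qed.

Lemma sum_expi_eq0 (k : nat) r : r * k%:R \is a Num.int ->
  r \isn't a Num.int -> \sum_(j < k) expi (r * j%:R) = 0.
Proof.
move=> rk rn; have e1 : expi r - 1 != 0.
  by apply: contra rn; rewrite subr_eq0 => /eqP/expi_eq1.
apply: (mulfI e1); rewrite mulr0.
under eq_bigr do rewrite expiMn.
by rewrite -subrX1 -expiMn expi_int ?subrr.
Qed.

End UnitCircle.

(** The limit is the supremum of the lower bounds [a n - eps n], each of which lies below every
    upper bound [a m + eps m]; this gives the rate together with the limit. *)
Lemma shrinking_limit (R : realType) (a eps : nat -> R) :
  (forall n m, (n <= m)%N -> `|a n - a m| <= eps n) ->
  exists l, forall n, `|a n - l| <= eps n.
Proof.
move=> cau; have e0 n : 0 <= eps n.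
  by apply: le_trans (cau n n _); rewrite ?leqnn.
have cross n m : a n - eps n <= a m + eps m.
  case: (leqP n m) => [nm|/ltnW nm]; have := cau _ _ nm;
    have := e0 n; have := e0 m; rewrite ler_norml => ? ? /andP[]; lra.
pose A := [set a n - eps n | n in [set: nat]].
have Aub m : ubound A (a m + eps m) by move=> _ [n _ <-].
have supA : has_sup A by split; [exists (a 0%N - eps 0%N), 0%N|exists (a 0%N + eps 0%N)].
exists (sup A) => n; rewrite ler_distl; apply/andP; split.
  by rewrite lerBlDr; apply: ge_sup supA.1 (Aub n).
by rewrite -lerBlDr; apply: ub_le_sup; [exists (a 0%N + eps 0%N)|exists n].
Qed.

Lemma expi_prim_root (R : realType) n : (0 < n)%N ->
  n.-primitive_root (expi (n%:R^-1 : R)).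
Proof.
move=> n0; have np : 0 < n%:R :> R by rewrite ltr0n.
rewrite /primitive_root_of_unity n0; apply/forallP => i; apply/eqP.
rewrite unity_rootE -expiMn; apply/eqP/eqP => [/expi_eq1|->]; last first.
  by rewrite mulVf ?expi1 // gt_eqF.
move=> /intrP[m mE].
have mn : (i.+1%:R : R) = m%:~R * n%:R by rewrite -mE mulrAC mulVf ?mul1r ?gt_eqF.
have : (i.+1%:Z = m * n%:Z)%R.
  by apply/eqP; rewrite -(eqr_int R) intrM; apply/eqP.
have := ltn_ord i; have [m0|m0] := leP m 0.
  have : m * n%:Z <= 0 by exact: mulr_le0_ge0.
  lia.
have [m2|m2] := leP 2 m; last first.
  have -> : m = 1 by lia.
  by rewrite mul1r => _ [].
have : 2 * n%:Z <= m * n%:Z by rewrite ler_wpM2r.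
lia.
Qed.

(** The characters are numbered in an arbitrary order, because the number of a character will serve
    as a base [k] digit. Commutativity of [H] is carried along so that what follows depends on the
    table alone. *)
Record character_table (R : realType) (H : finGroupType)
    (chi : 'I_#|H| -> H -> R[i]) : Prop := CharacterTable {
  ct_abelian : forall g h : H, (g * h = h * g)%g;
  ct_1 : forall j, chi j 1%g = 1;
  ct_M : forall j g h, chi j (g * h)%g = chi j g * chi j h;
  ct_V : forall j h, chi j h^-1%g = (chi j h)^*%C;
  ct_ortho : forall i j, \sum_h (chi i h)^*%C * chi j h = #|H|%:R * (i == j)%:R;
  ct_ortho' : forall g h, \sum_j (chi j g)^*%C * chi j h = #|H|%:R * (g == h)%:R
}.

Section Characters.
Variables (R : realType) (H : finGroupType).
Local Notation F := R[i].
Hypothesis abH : abelian [set: H]%G.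

Let in_group (x : H) : x \in [set: H]%G.
Proof. by rewrite inE. Qed.

Lemma expg_cardT (x : H) : (x ^+ #|H| = 1)%g.
Proof.
by rewrite -cardsT (expg_cardG (in_group x)).
Qed.

(** The minimal polynomial divides X^#|H| - 1, which splits into distinct linear factors over the
    complex numbers. *)
Lemma group_mx_diagonalizable n (rep : H -> 'M[F]_n) :
  rep 1%g = 1%:M -> (forall x y, rep (x * y)%g = rep x *m rep y) ->
  forall h, diagonalizable (rep h).
Proof.
case: n rep => [|n] rep rep1 repM h.
  by exists 1%:M; rewrite ?unitmx1 //; apply/is_diag_mxP => -[].
have repX i : rep (h ^+ i)%g = rep h ^+ i.
  by elim: i => [|i IHi]; rewrite ?rep1 // expgS repM IHi exprS.
have k0 : (0 < #|H|)%N by rewrite -cardsT cardG_gt0.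
have pz := expi_prim_root R k0; set z := expi _ in pz.
apply/diagonalizableP.
exists [seq z ^+ i | i <- index_iota 0 #|H|].
  rewrite map_inj_in_uniq ?iota_uniq // => i j.
  rewrite !mem_index_iota /= => ik jk /eqP.
  by rewrite (eq_prim_root_expr pz) !modn_small // => /eqP.
rewrite big_map (factor_Xn_sub_1 pz); apply: mxminpoly_min.
rewrite rmorphB rmorph1 rmorphXn /= horner_mx_X -repX.
by rewrite expg_cardT rep1 subrr.
Qed.

(** Simultaneous diagonalisation of the regular representation: the diagonal entries are the
    characters, and they are pairwise distinct because the matrices [rep h] are linearly
    independent. *)
Lemma character_table_exists :
  exists chi : 'I_#|H| -> H -> F, character_table chi.
Proof.
have k0 : (0 < #|H|)%N by rewrite -cardsT cardG_gt0.
set k := #|H| in k0 *.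
have kn0 : (k%:R : F) != 0 by rewrite pnatr_eq0 -lt0n.
pose rep h : 'M[F]_k := \matrix_(a, b) (enum_val a * h == enum_val b)%g%:R.
have rep1 : rep 1%g = 1%:M.
  apply/matrixP => a b; rewrite !mxE mulg1 (inj_eq enum_val_inj).
  by [].
have repM x y : rep (x * y)%g = rep x *m rep y.
  apply/matrixP => a b; rewrite !mxE (bigD1 (enum_rank (enum_val a * x)%g)) //=.
  rewrite !mxE enum_rankK eqxx mul1r big1 ?addr0 ?mulgA // => c cx.
  rewrite !mxE; case: eqP => [E|]; rewrite ?mul0r //.
  by case/eqP: cx; rewrite E enum_valK.
have [P uP /allP DP] : codiagonalizable [seq rep h | h <- enum H].
  apply/codiagonalizableP; split.
    move=> _ _ /mapP[x _ ->] /mapP[y _ ->]; rewrite /comm_mx -!repM.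
    by rewrite (centsP abH x (in_group x) y (in_group y)).
  by move=> _ /mapP[x _ ->]; exact: group_mx_diagonalizable.
have {}DP h : is_diag_mx (conjmx P (rep h)).
  by have := DP _ (map_f rep (mem_enum H h)).
pose D h := P *m rep h *m invmx P.
have diagD h i j : i != j -> D h i j = 0.
  by have := DP h; rewrite conjumx // => /is_diag_mxP; exact.
pose chi j h := D h j j.
have DM x y : D (x * y)%g = D x *m D y.
  by rewrite /D repM !mulmxA mulmxKV.
have chi1 j : chi j 1%g = 1.
  by rewrite /chi /D rep1 mulmx1 mulmxV // mxE eqxx.
have chiM j x y : chi j (x * y)%g = chi j x * chi j y.
  rewrite /chi DM mxE (bigD1 j) //= big1 ?addr0 // => i ij.
  by rewrite (diagD y) ?mulr0.
have chiX j x i : chi j (x ^+ i)%g = chi j x ^+ i.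
  by elim: i => [|i IHi]; rewrite ?chi1 // expgS chiM IHi exprS.
have chi_norm j x : normc (chi j x) = 1.
  have : normc (chi j x) ^+ k = 1.
    have -> : normc (chi j x) ^+ k = normc (chi j x ^+ k).
      elim: (k) => [|i IHi]; first by rewrite !expr0 normc1.
      by rewrite !exprS normcM IHi.
    by rewrite -chiX expg_cardT chi1 normc1.
  by move=> /eqP; rewrite pexpr_eq1 ?normc_ge0 // => /eqP.
have chi_conj j x : (chi j x)^*%C * chi j x = 1.
  by rewrite mulrC mul_conjc chi_norm expr1n.
have chiV j x : chi j x^-1%g = (chi j x)^*%C.
  by rewrite -[LHS]mul1r -(chi_conj j x) -mulrA -chiM mulgV chi1 mulr1.
pose X : 'M[F]_k := \matrix_(i, j) chi j (enum_val i).
(* A relation between the rows of [X] kills every diagonal entry of the corresponding combination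
   [M] of the [rep h], hence [M] itself, whose row at the identity lists the coefficients. *)
have Xfree (c : 'rV[F]_k) : c *m X = 0 -> c = 0.
  move=> cX; pose M := \sum_i c 0 i *: rep (enum_val i).
  have PMP : P *m M *m invmx P = 0.
    rewrite mulmx_sumr mulmx_suml; apply/matrixP => i j; rewrite mxE summxE.
    have [<-|ij] := eqVneq i j.
      transitivity ((c *m X) 0 i); last by rewrite cX mxE.
      rewrite mxE.
      apply: eq_bigr => l _; rewrite -scalemxAr -scalemxAl mxE.
      by rewrite [X in _ = _ * X]mxE.
    apply: big1 => l _; rewrite -scalemxAr -scalemxAl mxE.
    by have := diagD (enum_val l) i j ij; rewrite /D => ->; rewrite mulr0.
  have M0 : M = 0.
    by rewrite -[M](mulKmx uP) -[P *m M](mulmxKV uP) PMP mul0mx mulmx0.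
  apply/rowP => i; rewrite mxE.
  transitivity (M (enum_rank 1%g) i); last by rewrite M0 mxE.
  apply/esym; rewrite /M summxE (bigD1 i) //= big1 => [|j ji].
    by rewrite !mxE enum_rankK mul1g eqxx mulr1 addr0.
  rewrite !mxE enum_rankK mul1g (inj_eq enum_val_inj) (negPf ji).
  by rewrite mulr0.
clearbody chi.
have uX : X \in unitmx.
  rewrite -row_free_unit -kermx_eq0; apply/eqP/row_matrixP => i.
  by rewrite row0; apply: Xfree; rewrite -row_mul mulmx_ker row0.
have chi_inj i j : chi i =1 chi j -> i = j.
  move=> Eij; apply/eqP/negPn/negP => ij.
  pose v : 'cV[F]_k := delta_mx i 0 - delta_mx j 0.
  have : X *m v = 0.
    rewrite mulmxBr -!colE; apply/matrixP => a b.
    by rewrite !mxE Eij subrr.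
  move=> /(congr1 (mulmx (invmx X))); rewrite mulmxA mulVmx // mul1mx mulmx0.
  move=> /matrixP/(_ i 0)/eqP; rewrite !mxE !eqxx (negPf ij) subr0.
  by rewrite oner_eq0.
have ortho1 i j : \sum_h (chi i h)^*%C * chi j h = k%:R * (i == j)%:R.
  have [<-|ij] := eqVneq i j.
    rewrite (eq_bigr (fun=> 1)) => [|h _]; last exact: chi_conj.
    by rewrite sumr_const mulr1.
  rewrite mulr0; have [g gP] : exists g, chi i g != chi j g.
    apply/existsP; apply: contraNT ij; rewrite negb_exists => /forallP E.
    by apply/eqP/chi_inj => g; apply/eqP; have := E g; rewrite negbK.
  set S := \sum_h _.
  have : (chi i g)^*%C * chi j g * S = S.
    rewrite /S mulr_sumr [RHS](reindex_inj (mulgI g)); apply: eq_bigr => h _.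
    by rewrite (chiM i g) (chiM j g) conjcM; ring.
  move=> /eqP; rewrite -subr_eq0 -{2}[S]mul1r -mulrBl mulf_eq0 => /orP[|/eqP //].
  rewrite subr_eq0 => /eqP E; case/eqP: gP.
  by rewrite -[RHS]mul1r -(chi_conj i g) [_ * chi i g]mulrC -mulrA E mulr1.
exists chi; split=> // g h.
  by exact: (centsP abH) (in_group g) _ (in_group h).
(* The first orthogonality relation says Y X = k. For square matrices this gives X Y = k, which is
   the second one. *)
pose Y : 'M[F]_k := \matrix_(i, j) (chi i (enum_val j))^*%C.
have YX : Y *m X = k%:R%:M.
  apply/matrixP => i j; rewrite !mxE -[RHS]mulr_natr -ortho1 [RHS](reindex (fun l : 'I_k => enum_val l : H)) /=.
    by apply: eq_bigr => l _; rewrite !mxE.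
  by exists enum_rank => x _; rewrite ?enum_valK ?enum_rankK.
have XY : X *m Y = k%:R%:M.
  have : (k%:R^-1 *: Y) *m X = 1%:M.
    by rewrite -scalemxAl YX scale_scalar_mx mulVf.
  move=> /mulmx1C; rewrite -scalemxAr => /(congr1 (fun N : ('M[F]_k) => k%:R *: N)).
  by rewrite scalerA divff // scale1r scale_scalar_mx mulr1.
transitivity ((X *m Y) (enum_rank h) (enum_rank g)); last first.
  by rewrite XY !mxE (inj_eq enum_rank_inj) [h == g]eq_sym mulr_natr.
rewrite mxE.
by apply: eq_bigr => j _; rewrite !mxE !enum_rankK mulrC.
Qed.

End Characters.

(** * Phase operators on the wreath product *)

Section WreathElements.
Variables (H : finGroupType) (Gam : groupType).
Hypothesis HC : forall g h : H, (g * h = h * g)%g.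
Local Open Scope group_scope.
Implicit Types (i x c : Gam) (h : H) (y : wreath H Gam).

Definition single i h : dsum H Gam := [fsfun x in [fset i]%fset => h].

Lemma singleE i h x : dsum_fun (single i h) x = if x == i then h else 1.
Proof. by rewrite /dsum_fun fsfunE inE. Qed.

Definition wsingle i h : wreath H Gam := (single i h, 1).
Definition wtop c : wreath H Gam := (1, c).

Lemma wreathME (y z : wreath H Gam) :
  y * z = (y.1 * dsum_shift y.2 z.1, y.2 * z.2).
Proof. by []. Qed.

Lemma wsingleM i g h : wsingle i (g * h) = wsingle i g * wsingle i h.
Proof.
rewrite wreathME /= mulg1 dsum_shift1; congr (_, _); apply: dsumP => x.
by rewrite dsum_mulE !singleE; case: eqP => // _; rewrite mulg1.
Qed.

Lemma wsingle1 i : wsingle i 1 = 1.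
Proof.
congr (_, _); apply: dsumP => x.
by rewrite singleE dsum_oneE; case: eqP.
Qed.

Lemma wsingleV i h : (wsingle i h)^-1 = wsingle i h^-1.
Proof. by apply: (mulgI (wsingle i h)); rewrite mulgV -wsingleM mulgV wsingle1. Qed.

Lemma dsum_mulC (f g : dsum H Gam) : f * g = g * f.
Proof.
by apply: dsumP => x; rewrite !dsum_mulE HC.
Qed.

Lemma wsingleC i g j h : wsingle i g * wsingle j h = wsingle j h * wsingle i g.
Proof. by rewrite !wreathME /= !dsum_shift1 dsum_mulC. Qed.

Lemma wtopM c d : wtop (c * d) = wtop c * wtop d.
Proof. by rewrite wreathME /= dsum_shift_one mulg1. Qed.

Lemma wtop1 : wtop 1 = 1.
Proof. by []. Qed.

Lemma wtop_single c i h : wtop c * wsingle i h = wsingle (c * i) h * wtop c.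
Proof.
rewrite !wreathME /= mulg1 mul1g !mul1g; congr (_, _); apply: dsumP => x.
rewrite dsum_shift_one mulg1 dsum_shiftE !singleE; congr (if _ then _ else _).
by apply/eqP/eqP => [<-|->]; rewrite ?mulKVg ?mulKg.
Qed.

Lemma wsingle_mul1 i h y x :
  dsum_fun (wsingle i h * y).1 x =
  (if x == i then h * dsum_fun y.1 x else dsum_fun y.1 x).
Proof.
rewrite wreathME /= dsum_shift1 dsum_mulE singleE.
by case: eqP; rewrite ?mul1g.
Qed.

Lemma wsingle_mul2 i h y : (wsingle i h * y).2 = y.2.
Proof. by rewrite wreathME /= mul1g. Qed.

(** [wtop] and [wsingle] generate the group; the induction clears the support one place at a
    time. *)
Lemma wreath_ind (Q : wreath H Gam -> Prop) :
  (forall c, Q (wtop c)) ->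
  (forall i h y, Q y -> Q (wsingle i h * y)) -> forall y, Q y.
Proof.
move=> Qtop Qs [f c].
have [n] := ubnP #|` finsupp f|; elim: n => // n IHn in f *; rewrite ltnS => fn.
have [f0|] := fset_0Vmem (finsupp f).
  have -> : f = 1; last exact: Qtop.
  apply: dsumP => x; rewrite dsum_oneE /dsum_fun fsfun_dflt //.
  by rewrite f0 inE.
move=> [i fi]; pose f' : dsum H Gam := single i (dsum_fun f i)^-1 * f.
have f'E x : dsum_fun f' x = if x == i then 1 else dsum_fun f x.
  rewrite dsum_mulE singleE; case: eqP => [->|_]; last by rewrite mul1g.
  by rewrite mulVg.
have -> : (f, c) = wsingle i (dsum_fun f i) * (f', c) :> wreath H Gam.
  rewrite wreathME /= mul1g dsum_shift1; congr (_, _).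
  apply: dsumP => x; rewrite dsum_mulE singleE f'E.
  by case: eqP => [->|_]; rewrite ?mulg1 ?mul1g.
apply: Qs; apply: IHn; apply: leq_trans fn; apply: fproper_ltn_card.
rewrite fproperE; apply/andP; split.
  apply/fsubsetP => x; rewrite !mem_finsupp.
  by have := f'E x; rewrite /dsum_fun => ->; case: (x == i); rewrite ?eqxx.
apply/fsubsetPn; exists i => //.
by rewrite mem_finsupp; have := f'E i; rewrite /dsum_fun eqxx => ->; rewrite eqxx.
Qed.

End WreathElements.

(** * Spectral projections and finite products of phases *)

Section Projections.
Variables (R : realType) (H : finGroupType) (Gam : groupType).
Local Notation C := R[i].
Local Notation k := #|H|.
Variable chi : 'I_k -> H -> C.
Hypothesis tab : character_table chi.
Let chi1 := ct_1 tab.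
Let chiM := ct_M tab.
Let chiV := ct_V tab.
Let chi_ortho := ct_ortho tab.
Let chi_ortho' := ct_ortho' tab.
Let HC := ct_abelian tab.

Local Notation G := (wreath H Gam).
Local Notation lam := (@left_regular R G).
Implicit Types (u v w : l2 R G) (i : Gam) (j : 'I_k) (h : H) (r : R).

Lemma cardH_gt0 : (0 < k)%N.
Proof. by rewrite -cardsT cardG_gt0. Qed.

Let kC : (k%:R : C) != 0.
Proof. by rewrite pnatr_eq0 -lt0n cardH_gt0. Qed.

(* The projection onto the vectors on which the [i]-th copy of [H] acts through
   the character [chi j]. *)
Definition wproj i j u : l2 R G :=
  k%:R^-1 *: \sum_h (chi j h)^*%C *: lam (wsingle i h) u.

Lemma wproj_linear i j : linear (wproj i j).
Proof.
move=> a u v; rewrite /wproj scalerA mulrC -scalerA -scalerDr; congr (_ *: _).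
rewrite scaler_sumr -big_split /=; apply: eq_bigr => h _.
by rewrite left_regular_linear scalerDr !scalerA [a * _]mulrC.
Qed.

(** The source of the commutation rules below: translations by the abelian copies of [H] commute
    with each other, hence with the projections, hence the projections and phases with each
    other. *)
Lemma wproj_comm (S : l2 R G -> l2 R G) i j : linear S ->
  (forall h u, S (lam (wsingle i h) u) = lam (wsingle i h) (S u)) ->
  forall u, S (wproj i j u) = wproj i j (S u).
Proof.
move=> linS Sl u; rewrite /wproj (lin_Z linS) (lin_sum linS); congr (_ *: _).
by apply: eq_bigr => h _; rewrite (lin_Z linS) Sl.
Qed.

Lemma lamM x y u : lam x (lam y u) = lam (x * y)%g u.
Proof. by rewrite left_regularM. Qed.

Lemma lam_wproj i j h u : lam (wsingle i h) (wproj i j u) = chi j h *: wproj i j u.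
Proof.
rewrite /wproj (lin_Z (left_regular_linear _)) (lin_sum (left_regular_linear _)).
rewrite scalerA mulrC -scalerA; congr (_ *: _).
rewrite scaler_sumr [RHS](reindex_inj (mulgI h)); apply: eq_bigr => g _ /=.
rewrite (lin_Z (left_regular_linear _)) lamM -wsingleM scalerA.
by rewrite (chiM j h) conjcM mulrA -(chiV j h) -(chiM j h) mulgV chi1 mul1r.
Qed.

Lemma wprojK i j j' u : wproj i j (wproj i j' u) = if j == j' then wproj i j u else 0.
Proof.
rewrite {1}/wproj; under eq_bigr do rewrite lam_wproj scalerA.
rewrite -scaler_suml chi_ortho scalerA mulKf //.
by case: eqP => [->|_]; rewrite ?scale1r ?scale0r.
Qed.

Lemma sum_wproj i u : \sum_j wproj i j u = u.
Proof.
rewrite -scaler_sumr exchange_big /=.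
rewrite (bigD1 1%g) //= [X in _ *: (_ + X)]big1 ?addr0 => [|h h1].
  rewrite -scaler_suml (eq_bigr (fun j => (chi j 1%g)^*%C * chi j 1%g)).
    by rewrite chi_ortho' eqxx mulr1 scalerA mulVf // scale1r wsingle1 left_regular1.
  by move=> j _; rewrite chi1 mulr1.
rewrite -scaler_suml (eq_bigr (fun j => (chi j h)^*%C * chi j 1%g)).
  by rewrite chi_ortho' (negPf h1) mulr0 scale0r.
by move=> j _; rewrite chi1 mulr1.
Qed.

Lemma lam_single i h u : lam (wsingle i h) u = \sum_j chi j h *: wproj i j u.
Proof.
rewrite -{1}[u](sum_wproj i) (lin_sum (left_regular_linear _)).
by apply: eq_bigr => j _; rewrite lam_wproj.
Qed.

Lemma conjc_natV : ((k%:R^-1 : C)^*)%C = k%:R^-1.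
Proof. by rewrite conjc_inv conjc_nat. Qed.

Lemma wproj_adj i j u v : l2_dot (wproj i j u) v = l2_dot u (wproj i j v).
Proof.
rewrite /wproj l2_dotZl l2_dotZr conjc_natV; congr (_ * _).
rewrite l2_dot_suml l2_dot_sumr [RHS](reindex_inj invg_inj).
apply: eq_bigr => h _; rewrite l2_dotZl l2_dotZr conjcK chiV.
by rewrite left_regular_adj wsingleV.
Qed.

Lemma wproj_norm i j u : l2_norm (wproj i j u) <= l2_norm u.
Proof.
have [->|n0] := eqVneq (l2_norm (wproj i j u)) 0; first exact: l2_norm_ge0.
have np : 0 < l2_norm (wproj i j u) by rewrite lt_def n0 l2_norm_ge0.
rewrite -(ler_pM2l np) -[leLHS]ger0_norm ?mulr_ge0 ?l2_norm_ge0 //.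
rewrite -normc_real -expr2 -l2_dot_self wproj_adj wprojK eqxx l2_dotC normc_conj.
exact: l2_cauchy_schwarz.
Qed.

Lemma wproj_bounded i j : bounded_map (wproj i j).
Proof.
by split; [exact: wproj_linear|exists 1 => u; rewrite mul1r wproj_norm].
Qed.

Lemma wprojC i j i' j' u : wproj i j (wproj i' j' u) = wproj i' j' (wproj i j u).
Proof.
apply: (@wproj_comm (wproj i j) _ _ (wproj_linear i j)) => h {}u; apply/esym.
apply: (@wproj_comm (lam _) _ _ (left_regular_linear _)) => h' {}u.
by rewrite !lamM (wsingleC HC).
Qed.

Lemma wproj_shift c i j u : lam (wtop H c) (wproj i j u) =
  wproj (c * i)%g j (lam (wtop H c) u).
Proof.
rewrite /wproj (lin_Z (left_regular_linear _)) (lin_sum (left_regular_linear _)).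
congr (_ *: _); apply: eq_bigr => h _.
by rewrite (lin_Z (left_regular_linear _)) !lamM wtop_single.
Qed.

Definition phase i r u : l2 R G := \sum_(j < k) expi (r * j%:R) *: wproj i j u.

Lemma phase_linear i r : linear (phase i r).
Proof.
move=> a u v; rewrite /phase scaler_sumr -big_split /=; apply: eq_bigr => j _.
by rewrite wproj_linear scalerDr !scalerA [a * _]mulrC.
Qed.

Lemma phase_comm (S : l2 R G -> l2 R G) i r : linear S ->
  (forall h u, S (lam (wsingle i h) u) = lam (wsingle i h) (S u)) ->
  forall u, S (phase i r u) = phase i r (S u).
Proof.
move=> linS Sl u; rewrite /phase (lin_sum linS); apply: eq_bigr => j _.
by rewrite (lin_Z linS) wproj_comm.
Qed.

Lemma wproj_phase i j r u : wproj i j (phase i r u) = expi (r * j%:R) *: wproj i j u.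
Proof.
rewrite /phase (lin_sum (wproj_linear _ _)) (bigD1 j) //= big1 => [|j' jj'].
  by rewrite (lin_Z (wproj_linear _ _)) wprojK eqxx addr0.
by rewrite (lin_Z (wproj_linear _ _)) wprojK eq_sym (negPf jj') scaler0.
Qed.

Lemma phase_wproj i j r u : phase i r (wproj i j u) = expi (r * j%:R) *: wproj i j u.
Proof.
rewrite /phase (bigD1 j) //= big1 => [|j' jj'].
  by rewrite wprojK eqxx addr0.
by rewrite wprojK (negPf jj') scaler0.
Qed.

Lemma phaseD i r s u : phase i (r + s) u = phase i r (phase i s u).
Proof.
rewrite [RHS]/phase; apply: eq_bigr => j _.
by rewrite wproj_phase scalerA -expiD mulrDl.
Qed.

Lemma phase_int i r u : r \is a Num.int -> phase i r u = u.
Proof.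
move=> rint; rewrite -[RHS](sum_wproj i); apply: eq_bigr => j _.
by rewrite expi_int ?scale1r // rpredM ?natr_int.
Qed.

Lemma phase_adj i r u v : l2_dot (phase i r u) v = l2_dot u (phase i (- r) v).
Proof.
rewrite /phase l2_dot_suml l2_dot_sumr; apply: eq_bigr => j _.
by rewrite l2_dotZl l2_dotZr wproj_adj mulNr expiN conjcK.
Qed.

Lemma phase_norm i r u : l2_norm (phase i r u) = l2_norm u.
Proof.
apply/eqP; rewrite -(@eqrXn2 _ 2) ?l2_norm_ge0 //; apply/eqP/complexI.
by rewrite -!l2_dot_self phase_adj -phaseD addNr phase_int // rpred0.
Qed.

Lemma phaseC i r i' r' u : phase i r (phase i' r' u) = phase i' r' (phase i r u).
Proof.
apply: (@phase_comm (phase i r) _ _ (phase_linear i r)) => h {}u; apply/esym.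
apply: (@phase_comm (lam _) _ _ (left_regular_linear _)) => h' {}u.
by rewrite !lamM (wsingleC HC).
Qed.

Lemma phase_wprojC i r i' j u : phase i r (wproj i' j u) = wproj i' j (phase i r u).
Proof.
apply: (@wproj_comm (phase i r) _ _ (phase_linear i r)) => h {}u; apply/esym.
apply: (@phase_comm (lam _) _ _ (left_regular_linear _)) => h' {}u.
by rewrite !lamM (wsingleC HC).
Qed.

Lemma phase_shift c i r u : lam (wtop H c) (phase i r u) =
  phase (c * i)%g r (lam (wtop H c) u).
Proof.
rewrite /phase (lin_sum (left_regular_linear _)); apply: eq_bigr => j _.
by rewrite (lin_Z (left_regular_linear _)) wproj_shift.
Qed.

(** The factor 8 comes from [normc_expiB1]; one [k] bounds the digit [j], the other counts the
    projections in [phase]. *)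
Definition phase_const : R := 8 * k%:R ^+ 2.

Lemma phase_const_gt0 : 0 < phase_const.
Proof. by rewrite mulr_gt0 // exprn_gt0 // ltr0n cardH_gt0. Qed.

Lemma phase_near i r u :
  l2_norm (phase i r u - u) <= phase_const * `|r| * l2_norm u.
Proof.
rewrite -{2}[u](sum_wproj i) /phase -sumrB (le_trans (l2_norm_sum _ _ _)) //.
apply: (@le_trans _ _ (\sum_(j < k) 8 * (`|r| * k%:R) * l2_norm u)).
  apply: ler_sum => j _; rewrite -{2}[wproj i j u]scale1r -scalerBl l2_normZ.
  apply: ler_pM; rewrite ?normc_ge0 ?l2_norm_ge0 ?wproj_norm //.
  apply: le_trans (normc_expiB1 _) _; rewrite ler_wpM2l // normrM ler_wpM2l //.
  by rewrite ger0_norm // ler_nat ltnW.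
by rewrite sumr_const card_ord -mulr_natr /phase_const; lra.
Qed.

Fixpoint phases (F : Gam -> R) (s : seq Gam) u : l2 R G :=
  if s is i :: s' then phase i (F i) (phases F s' u) else u.

Lemma phases_cat F s t u : phases F (s ++ t) u = phases F s (phases F t u).
Proof. by elim: s => //= i s ->. Qed.

Lemma phases_linear F s : linear (phases F s).
Proof. by elim: s => //= i s IHs a u v; rewrite IHs phase_linear. Qed.

Lemma phases_norm F s u : l2_norm (phases F s u) = l2_norm u.
Proof. by elim: s => //= i s IHs; rewrite phase_norm. Qed.

Lemma phases_comm (S : l2 R G -> l2 R G) F s : linear S ->
  (forall i h u, S (lam (wsingle i h) u) = lam (wsingle i h) (S u)) ->
  forall u, S (phases F s u) = phases F s (S u).
Proof. by move=> linS Sl u; elim: s => //= i s IHs; rewrite phase_comm // IHs. Qed.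

Lemma phase_phasesC F s i r u :
  phase i r (phases F s u) = phases F s (phase i r u).
Proof.
apply: (@phases_comm (phase i r) _ _ (phase_linear i r)) => i' h {}u; apply/esym.
apply: (@phase_comm (lam _) _ _ (left_regular_linear _)) => h' {}u.
by rewrite !lamM (wsingleC HC).
Qed.

Lemma wproj_phasesC F s i j u :
  wproj i j (phases F s u) = phases F s (wproj i j u).
Proof. by elim: s => //= i' s IHs; rewrite -phase_wprojC IHs. Qed.

Lemma phases_rem F s i u : i \in s ->
  phases F s u = phase i (F i) (phases F (rem i s) u).
Proof.
elim: s => //= i' s IHs; rewrite inE eq_sym; case: eqP => [->//|_] /= si.
by rewrite IHs //= phaseC.
Qed.

Lemma phases_perm F s t u : perm_eq s t -> phases F s u = phases F t u.
Proof.
elim: s t => [|i s IHs] t st; first by move: st; rewrite perm_sym => /perm_nilP->.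
have ti : i \in t by rewrite -(perm_mem st) mem_head.
rewrite /= (phases_rem _ _ ti) (IHs (rem i t)) //.
by rewrite -(perm_cons i) (perm_trans st) // perm_to_rem.
Qed.

Lemma phasesD F F' s u :
  phases (fun i => F i + F' i) s u = phases F s (phases F' s u).
Proof.
elim: s => //= i s ->; rewrite phaseD; congr (phase _ _ _).
by rewrite phase_phasesC.
Qed.

Lemma phases_int F s u : (forall i, i \in s -> F i \is a Num.int) ->
  phases F s u = u.
Proof.
elim: s => //= i s IHs sF; rewrite IHs => [|i' si']; last by rewrite sF ?inE ?si' ?orbT.
by rewrite phase_int // sF ?mem_head.
Qed.

Lemma phases_shift F c s u : lam (wtop H c) (phases F s u) =
  phases (fun i => F (c^-1 * i)%g) [seq (c * i)%g | i <- s] (lam (wtop H c) u).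
Proof. by elim: s => //= i s IHs; rewrite phase_shift IHs mulKg. Qed.

End Projections.

(** Completeness of l^2 with a rate. Real and imaginary parts converge separately at each
    coordinate, whence the factor 2. *)
Lemma l2_limit (R : realType) (G : choiceType) (v : nat -> l2 R G)
    (eps : nat -> R) :
  (forall n m, (n <= m)%N -> eps m <= eps n) ->
  (forall n m, (n <= m)%N -> l2_norm (v n - v m) <= eps n) ->
  (forall e, 0 < e -> exists n, eps n <= e) ->
  exists l, forall n, l2_norm (v n - l) <= 2 * eps n.
Proof.
move=> mono cau small.
have e0 n : 0 <= eps n by apply: le_trans (cau n n (leqnn n)); exact: l2_norm_ge0.
have cauR x n m : (n <= m)%N ->
    `|complex.Re (val (v n) x) - complex.Re (val (v m) x)| <= eps n.
  move=> /cau; apply: le_trans; apply: le_trans (normc_le_l2 _ x).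
  by rewrite l2_valD l2_valN -raddfB; exact: normc_Re.
have cauI x n m : (n <= m)%N ->
    `|complex.Im (val (v n) x) - complex.Im (val (v m) x)| <= eps n.
  move=> /cau; apply: le_trans; apply: le_trans (normc_le_l2 _ x).
  by rewrite l2_valD l2_valN -raddfB; exact: normc_Im.
have [lR lRP] := choice (fun x => shrinking_limit (@cauR x)).
have [lI lIP] := choice (fun x => shrinking_limit (@cauI x)).
pose f x : R[i] := (lR x +i* lI x)%C.
have fP n x : normc (val (v n) x - f x) <= 2 * eps n.
  apply: le_trans (normc_le_ReIm _) _; rewrite !raddfB /= mulr_natl mulr2n.
  exact: lerD (lRP x n) (lIP x n).
(* The coordinatewise limit is compared with a late term [v m] through |a + b|^2 <= 2 |a|^2 + 2
   |b|^2. The number [d] is such that eps m <= e / d gives both eps m <= 1, so (eps m)^2 <= eps m,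
   and 8 (size s) (eps m) <= e. *)
have sumP n s : uniq s ->
    \sum_(x <- s) normc (val (v n) x - f x) ^+ 2 <= 2 * eps n ^+ 2.
  move=> us; apply/ler_addgt0Pl => e ep.
  pose d : R := e + 8 * (size s)%:R + 1.
  have dp : 0 < d by rewrite ltr_wpDl // addr_ge0 ?mulr_ge0 // ltW.
  have [m0 m0P] := small _ (divr_gt0 ep dp).
  pose m := maxn n m0.
  have mP : eps m <= e / d by apply: le_trans m0P; apply: mono; exact: leq_maxr.
  have m1 : e / d <= 1.
    by rewrite ler_pdivrMr // mul1r /d -addrA lerDl addr_ge0 ?mulr_ge0.
  have m2 : 8 * (size s)%:R * (e / d) <= e.
    rewrite mulrA ler_pdivrMr // [e * d]mulrC ler_wpM2r // ?ltW // /d.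
    by have := ltW ep; lra.
  have cnm := cau n m (leq_maxl _ _).
  apply: (@le_trans _ _ (\sum_(x <- s)
      (2 * normc (val (v n - v m) x) ^+ 2 + 8 * eps m))).
    apply: ler_sum => x _.
    have := le_normcD (val (v n - v m) x) (val (v m) x - f x).
    rewrite [X in normc X]addrA subrK => /le_trans.
    move=> /(_ _ (lerD (lexx _) (fP m x))).
    set p := normc (val (v n - v m) x); set q := normc _ => qp.
    have p0 : 0 <= p by exact: normc_ge0.
    have q0 : 0 <= q by exact: normc_ge0.
    have em := e0 m; have em1 : eps m <= 1 by exact: le_trans m1.
    have : q ^+ 2 <= (p + 2 * eps m) ^+ 2.
      by rewrite ler_sqr // nnegrE addr_ge0 ?mulr_ge0.
    have : 0 <= (p - 2 * eps m) ^+ 2 by exact: sqr_ge0.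
    have : eps m ^+ 2 <= eps m by rewrite expr2 ler_piMr.
    by rewrite !expr2; lra.
  rewrite big_split /= -mulr_sumr big_const_seq count_predT iter_addr_0.
  have : \sum_(x <- s) normc (val (v n - v m) x) ^+ 2 <= eps n ^+ 2.
    apply: le_trans (sum_le_l2_norm _ us) _.
    by rewrite ler_sqr // nnegrE ?l2_norm_ge0 ?e0.
  have : 8 * eps m * (size s)%:R <= e.
    by apply: le_trans m2; rewrite mulrAC ler_wpM2l // mulr_ge0.
  by rewrite -mulr_natr; lra.
have gl2 : (fun x => val (v 0%N) x - f x) \in @l2_pred R G.
  by apply/l2_predP/square_summableP; exists (2 * eps 0%N ^+ 2) => s /sumP.
pose w : l2 R G := Sub (fun x => val (v 0%N) x - f x) gl2.
exists (v 0%N - w) => n; apply: l2_norm_le => [|s us].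
  by rewrite mulr_ge0.
apply: (@le_trans _ _ (2 * eps n ^+ 2)).
  rewrite -(eq_bigr _ (fun x _ => erefl)); apply: le_trans (sumP n s us).
  apply: ler_sum => x _; rewrite l2_valD l2_valN l2_valD l2_valN.
  by rewrite [val w x]/(val (v 0%N) x - f x) subKr.
by rewrite exprMn ler_wpM2r ?sqr_ge0 // expr2; lra.
Qed.

(** * Infinite products of phases *)

Section PhaseLimits.
Variables (R : realType) (H : finGroupType) (Gam : groupType).
Local Notation k := #|H|.
Variable chi : 'I_k -> H -> R[i].
Hypothesis tab : character_table chi.
Local Notation G := (wreath H Gam).
Local Notation lam := (@left_regular R G).
Local Notation phases := (@phases R H Gam chi).
Implicit Types (F : Gam -> R) (T : l2 R G -> l2 R G) (u : l2 R G).

(* [T] is the infinite product over [Gam], in operator norm and along finite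
   subsets, of the phases [F i]. *)
Definition phase_limit F T := linear T /\
  forall e, 0 < e -> exists s0 : seq Gam,
    forall s, uniq s -> {subset s0 <= s} ->
    forall u, l2_norm (phases F s u - T u) <= e * l2_norm u.

Lemma phase_limit2 F F' T T' e : phase_limit F T -> phase_limit F' T' -> 0 < e ->
  exists2 s, uniq s & forall u,
    l2_norm (phases F s u - T u) <= e * l2_norm u /\
    l2_norm (phases F' s u - T' u) <= e * l2_norm u.
Proof.
move=> [_ FT] [_ FT'] e0; have [s0 s0P] := FT e e0; have [s1 s1P] := FT' e e0.
exists (undup (s0 ++ s1)) => [|u]; first exact: undup_uniq.
split; [apply: s0P|apply: s1P]; rewrite ?undup_uniq // => i si;
  by rewrite mem_undup mem_cat si ?orbT.
Qed.

Lemma phase_limit_unique F T T' : phase_limit F T -> phase_limit F T' -> T = T'.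
Proof.
move=> FT FT'; apply/funext => u; apply/eqP; rewrite -subr_eq0; apply/eqP.
apply: (@l2_small _ _ _ (2 * l2_norm u)) => e e0.
have [s us /(_ u) [sT sT']] := phase_limit2 FT FT' e0.
apply: le_trans (l2_dist_triangle (phases F s u) _ _) _.
rewrite l2_distC -mulrA mulr_natl mulr2n [_ * e]mulrC.
exact: lerD.
Qed.

Lemma phase_limit_norm F T u : phase_limit F T -> l2_norm (T u) = l2_norm u.
Proof.
move=> FT; have n0 := l2_norm_ge0 u.
apply/eqP; rewrite eq_le; apply/andP; split; apply/ler_addgt0Pl => e e0.
  have e'0 : 0 < e / (l2_norm u + 1) by rewrite divr_gt0 // ltr_wpDl.
  have [s us /(_ u) [sT _]] := phase_limit2 FT FT e'0.
  have := l2_normB (phases F s u) (phases F s u - T u).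
  rewrite opprB addrC subrK (phases_norm tab) => /le_trans; apply.
  rewrite addrC lerD2r (le_trans sT) // mulrAC ler_pdivrMr ?ltr_wpDl //.
  by rewrite ler_pM2l // lerDl.
have e'0 : 0 < e / (l2_norm u + 1) by rewrite divr_gt0 // ltr_wpDl.
have [s us /(_ u) [sT _]] := phase_limit2 FT FT e'0.
have := l2_normD (phases F s u - T u) (T u).
rewrite subrK (phases_norm tab) => /le_trans; apply.
rewrite lerD2r (le_trans sT) // mulrAC ler_pdivrMr ?ltr_wpDl //.
by rewrite ler_pM2l // lerDl.
Qed.

Lemma phase_limit_int F : (forall i, F i \is a Num.int) -> phase_limit F id.
Proof.
move=> Fint; split=> // e e0; exists [::] => s _ _ u.
by rewrite phases_int // subrr l2_norm0 mulr_ge0 ?l2_norm_ge0 // ltW.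
Qed.

Lemma phase_limitD F F' T T' : phase_limit F T -> phase_limit F' T' ->
  phase_limit (fun i => F i + F' i) (T \o T').
Proof.
move=> FT FT'; split=> [a u v|e e0]; first by rewrite /= FT'.1 FT.1.
have e20 : 0 < e / 2 by rewrite divr_gt0.
have [s0 s0P] := FT.2 _ e20; have [s1 s1P] := FT'.2 _ e20.
exists (s0 ++ s1) => s us ss u; rewrite (phasesD tab).
have ss0 : {subset s0 <= s} by move=> i si; apply: ss; rewrite mem_cat si.
have ss1 : {subset s1 <= s} by move=> i si; apply: ss; rewrite mem_cat si orbT.
have {}s0P := s0P s us ss0; have {}s1P := s1P s us ss1.
apply: le_trans (l2_dist_triangle (phases F s (T' u)) _ _) _.
rewrite -(lin_B (phases_linear chi F s)) (phases_norm tab) /=.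
apply: le_trans (lerD (s1P u) (s0P (T' u))) _.
by rewrite (phase_limit_norm u FT') -mulrDl -splitr.
Qed.

Lemma phase_limit_shift F T c : phase_limit F T ->
  phase_limit (fun i => F (c^-1 * i)%g)
    (lam (wtop H c) \o T \o lam (wtop H c^-1)).
Proof.
move=> FT; split=> [a u v|e e0].
  by rewrite /= left_regular_linear FT.1 left_regular_linear.
have [s0 s0P] := FT.2 _ e0.
exists [seq (c * i)%g | i <- s0] => s us ss u.
pose t := [seq (c^-1 * i)%g | i <- s].
have st : s = [seq (c * i)%g | i <- t].
  by rewrite -map_comp -[LHS]map_id; apply: eq_map => i /=; rewrite mulKVg.
have {}s0P := s0P t.
have ut : uniq t by rewrite map_inj_uniq //; exact: mulgI.
have s0t : {subset s0 <= t}.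
  move=> i si; apply/mapP; exists (c * i)%g; last by rewrite mulKg.
  by apply: ss; exact: map_f.
pose v := lam (wtop H c^-1) u.
have uE : u = lam (wtop H c) v.
  by rewrite /v lamM -wtopM mulgV wtop1 left_regular1.
rewrite {1}uE st -phases_shift -(lin_B (left_regular_linear _)).
rewrite left_regular_norm -/v; apply: le_trans (s0P ut s0t v) _.
by rewrite /v left_regular_norm.
Qed.

(** One half of the equality of commutants: what commutes with every copy of [H] commutes with
    finite products of phases, hence with their limits. *)
Lemma phase_limit_comm F T (S : l2 R G -> l2 R G) : phase_limit F T ->
  bounded_map S ->
  (forall i h u, S (lam (wsingle i h) u) = lam (wsingle i h) (S u)) ->
  forall u, S (T u) = T (S u).
Proof.
move=> FT bS Sl u; apply/eqP; rewrite -subr_eq0; apply/eqP.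
have [K K0 SK] := bounded_map_pos bS.
apply: (@l2_small _ _ _ (2 * K * l2_norm u)) => e e0.
have [s us sP] := phase_limit2 FT FT e0.
apply: le_trans (l2_dist_triangle (S (phases F s u)) _ _) _.
rewrite -(lin_B bS.1) (phases_comm chi F s bS.1 Sl).
have h1 : l2_norm (S (T u - phases F s u)) <= K * (e * l2_norm u).
  apply: le_trans (SK _) _; rewrite ler_pM2l // l2_distC.
  by have [] := sP u.
have h2 : l2_norm (phases F s (S u) - T (S u)) <= e * (K * l2_norm u).
  by have [+ _] := sP (S u) => /le_trans; apply; rewrite ler_pM2l.
by apply: le_trans (lerD h1 h2) _; lra.
Qed.

Lemma phase_limit_wprojC F T i j u : phase_limit F T ->
  T (wproj chi i j u) = wproj chi i j (T u).
Proof.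
move=> FT; apply: (@wproj_comm _ _ _ _ T _ _ FT.1) => h {}u; apply/esym.
apply: (phase_limit_comm FT).
  exact: isometry_bounded (left_regular_linear _) (@left_regular_norm _ _ _).
by move=> i' h' {}u; rewrite !lamM (wsingleC (ct_abelian tab)).
Qed.

(** Serves the computation of the trace, where coefficients of large finite products vanish
    exactly. *)
Lemma phase_limit_eq0 F T u y (s0 : seq Gam) : phase_limit F T ->
  (forall s, uniq s -> {subset s0 <= s} -> val (phases F s u) y = 0) ->
  val (T u) y = 0.
Proof.
move=> FT Fy; apply: eq0_normc; apply/eqP; rewrite eq_le normc_ge0 andbT.
apply/ler_addgt0Pl => e e0; rewrite addr0.
have n0 := l2_norm_ge0 u.
have e'0 : 0 < e / (l2_norm u + 1) by rewrite divr_gt0 // ltr_wpDl.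
have [s1 s1P] := FT.2 _ e'0; pose s := undup (s0 ++ s1).
have us : uniq s by exact: undup_uniq.
have ss0 : {subset s0 <= s} by move=> i si; rewrite mem_undup mem_cat si.
have ss1 : {subset s1 <= s} by move=> i si; rewrite mem_undup mem_cat si orbT.
have := le_trans (normc_le_l2 (phases F s u - T u) y) (s1P s us ss1 u).
rewrite l2_valD l2_valN Fy // sub0r normcN => /le_trans; apply.
by rewrite mulrAC ler_pdivrMr ?ltr_wpDl // ler_pM2l // lerDl.
Qed.

Section Existence.
Variables (F : Gam -> R) (p : nat -> Gam) (a : R).
Hypothesis k2 : (2 <= k)%N.
Hypothesis a0 : 0 <= a.
Hypothesis Fint : forall i, F i \is a Num.int \/ exists n, i = p n.
Hypothesis Fsmall : forall n, `|F (p n)| <= a / k%:R ^+ n.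

Local Notation c := (phase_const R H).

Let k_ge2 : 2 <= k%:R :> R.
Proof. by rewrite (ler_nat R 2). Qed.

Let k_gt0 : 0 < k%:R :> R.
Proof. exact: lt_le_trans k_ge2. Qed.

Let c_gt0 : 0 < c := phase_const_gt0 R H.

Let ca_ge0 n : 0 <= c * a / k%:R ^+ n.
Proof. by rewrite divr_ge0 ?mulr_ge0 // ?exprn_ge0 ltW. Qed.

(** Induction on the length [M] of the window N <= n < N + M of places where [F] may be
    non-integral. The place [p N] costs c a / k^N, and as k >= 2 the remaining ones cost at most as
    much again. *)
Lemma phases_tail M N s u : uniq s ->
  (forall i, i \in s -> F i \is a Num.int \/
     exists n, [/\ (N <= n)%N, (n < N + M)%N & i = p n]) ->
  l2_norm (phases F s u - u) <= 2 * (c * a / k%:R ^+ N) * l2_norm u.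
Proof.
elim: M N s u => [|M IHM] N s u us sF.
  rewrite phases_int // => [|i si].
    by rewrite subrr l2_norm0 !mulr_ge0 ?l2_norm_ge0.
  by have [//|[n []]] := sF i si; rewrite addn0 ltnNge => ->.
have half : 2 * (c * a / k%:R ^+ N.+1) <= c * a / k%:R ^+ N.
  have k12 : 2 / k%:R <= 1 :> R by rewrite ler_pdivrMr // mul1r.
  have -> : 2 * (c * a / k%:R ^+ N.+1) = c * a / k%:R ^+ N * (2 / k%:R).
    by rewrite exprS invfM; ring.
  by rewrite ler_piMr.
have [pNs|pNs] := boolP (p N \in s); last first.
  apply: le_trans (IHM N.+1 s u us _) _ => [i si|].
    have [|[n [Nn nM iE]]] := sF i si; [by left|right; exists n].
    split=> //; last by rewrite addSnnS.
    by rewrite ltn_neqAle Nn andbT; apply: contraNneq pNs => ->; rewrite -iE.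
  by rewrite ler_wpM2r ?l2_norm_ge0 // (le_trans half) // ler_peMl // ler1n.
rewrite (phases_rem tab _ _ pNs); set t := rem _ s.
apply: le_trans (l2_dist_triangle (phases F t u) _ _) _.
have h1 : l2_norm (phases F t u - u) <= 2 * (c * a / k%:R ^+ N.+1) * l2_norm u.
  apply: IHM => [|i]; first exact: rem_uniq.
  rewrite mem_rem_uniq // inE => /andP[ip si].
  have [|[n [Nn nM iE]]] := sF i si; [by left|right; exists n].
  split=> //; last by rewrite addSnnS.
  by rewrite ltn_neqAle Nn andbT; apply: contraNneq ip => ->; rewrite iE.
have h2 := phase_near tab (p N) (F (p N)) (phases F t u).
rewrite (phases_norm tab) in h2.
have h3 : c * `|F (p N)| * l2_norm u <= c * a / k%:R ^+ N * l2_norm u.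
  by rewrite ler_wpM2r ?l2_norm_ge0 // -mulrA ler_pM2l.
have h4 : 2 * (c * a / k%:R ^+ N.+1) * l2_norm u <=
    c * a / k%:R ^+ N * l2_norm u by rewrite ler_wpM2r ?l2_norm_ge0.
by lra.
Qed.

(** [undup] because [p] is not assumed injective here; a repeated place would receive its phase
    twice. *)
Definition segment N := undup [seq p n | n <- iota 0 N].

Lemma phases_segment N s u : uniq s -> {subset segment N <= s} ->
  l2_norm (phases F s u - phases F (segment N) u) <=
  2 * (c * a / k%:R ^+ N) * l2_norm u.
Proof.
move=> us ss; pose t := [seq i <- s | i \notin segment N].
have st : perm_eq s (t ++ segment N).
  apply: uniq_perm => // [|i].
    rewrite cat_uniq filter_uniq // undup_uniq andbT /=.
    by apply/hasPn => i si; rewrite mem_filter si.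
  rewrite mem_cat mem_filter; case: (boolP (i \in segment N)) => /= [/ss ->//|_].
  by rewrite orbF.
(* An index is chosen for each place, so that the finite list [t] of new places fits into a window
   of bounded length. *)
have [f fP] : exists f : Gam -> nat, forall i, F i \is a Num.int \/ i = p (f i).
  have ex i : exists n, F i \is a Num.int \/ i = p n.
    by have [Fi|[n ->]] := Fint i; [exists 0%N; left|exists n; right].
  by have [f fP] := choice ex; exists f.
rewrite (phases_perm tab F u st) phases_cat -(phases_norm tab F (segment N) u).
apply: (@phases_tail (\max_(i <- t) f i).+1) => [|i it].
  exact: filter_uniq.
have [|iE] := fP i; [by left|right; exists (f i)]; split=> //.
  move: it; rewrite mem_filter leqNgt => /andP[+ _]; apply: contra => fN.
  by rewrite mem_undup iE; apply: map_f; rewrite mem_iota.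
rewrite addnS ltnS (leq_trans _ (leq_addl _ _)) //.
exact: (@leq_bigmax_seq _ _ _ f i it).
Qed.

(** The rate is part of the conclusion because arcs of length k^-N will be compared with an error of
    the same order. The factor 4 is 2 from [phases_segment] times 2 from [l2_limit]. *)
Lemma phase_limit_exists : exists2 T, phase_limit F T &
  forall N u, l2_norm (phases F (segment N) u - T u) <=
    4 * (c * a / k%:R ^+ N) * l2_norm u.
Proof.
pose eps N : R := 2 * (c * a / k%:R ^+ N).
have eps0 N : 0 <= eps N by rewrite mulr_ge0.
have mono n m : (n <= m)%N -> eps m <= eps n.
  move=> nm; rewrite /eps ler_wpM2l //; apply: ler_wpM2l.
    by rewrite mulr_ge0 // ltW.
  rewrite lef_pV2 ?posrE ?exprn_gt0 //.
  by rewrite ler_weXn2l // (le_trans _ k_ge2) // ler1n.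
have small e : 0 < e -> exists n, eps n <= e.
  move=> e0; exists (Num.bound (2 * (c * a) / e)).
  rewrite /eps mulrA ler_pdivrMr ?exprn_gt0 // [e * _]mulrC -ler_pdivrMr //.
  apply: le_trans (ltW (archi_boundP _)) _.
    by rewrite divr_ge0 ?mulr_ge0 // ltW.
  set n := Num.bound _; rewrite -natrX ler_nat.
  by apply: ltnW; apply: leq_trans (ltn_expl n (isT : 1 < 2)%N) _; rewrite leq_exp2r.
have seg n m : (n <= m)%N -> {subset segment n <= segment m}.
  move=> nm i; rewrite !mem_undup => /mapP[l + ->]; rewrite mem_iota /= => ln.
  by apply: map_f; rewrite mem_iota /=; exact: leq_trans nm.
have lim u : exists l, forall N,
    l2_norm (phases F (segment N) u - l) <= 2 * (eps N * l2_norm u).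
  apply: (@l2_limit _ _ _ (fun N => eps N * l2_norm u)) => [n m nm|n m nm|e e0].
  - by rewrite ler_wpM2r ?l2_norm_ge0 ?mono.
  - by rewrite l2_distC phases_segment ?undup_uniq //; exact: seg.
  - have n0 := l2_norm_ge0 u.
    have e'0 : 0 < e / (l2_norm u + 1) by rewrite divr_gt0 // ltr_wpDl.
    have [n nP] := small _ e'0; exists n.
    apply: le_trans (ler_wpM2r n0 nP) _.
    by rewrite mulrAC ler_pdivrMr ?ltr_wpDl // ler_pM2l // lerDl.
have [T TP] := choice lim.
have TP' N u : l2_norm (phases F (segment N) u - T u) <= 4 * (c * a / k%:R ^+ N) * l2_norm u.
  by apply: le_trans (TP u N) _; rewrite /eps; lra.
exists T => //; split=> [b u v|e e0].
  apply/eqP; rewrite -subr_eq0; apply/eqP.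
  apply: (@l2_small _ _ _ (2 * (l2_norm (b *: u + v) + normc b * l2_norm u + l2_norm v))) => e e0.
  have [n nP] := small _ e0; pose U := phases F (segment n).
  have -> : T (b *: u + v) - (b *: T u + T v) =
      (T (b *: u + v) - U (b *: u + v)) + (b *: (U u - T u) + (U v - T v)).
    have UE : U (b *: u + v) = b *: U u + U v by exact: phases_linear.
    rewrite UE scalerBr.
    by rewrite [X in _ = _ + X]addrACA -opprD addrA subrK.
  apply: le_trans (l2_normD _ _) _.
  apply: le_trans (lerD (lexx _) (l2_normD _ _)) _.
  rewrite l2_normZ (l2_distC (T (b *: u + v))).
  have ne w : l2_norm (U w - T w) <= 2 * (e * l2_norm w).
    by apply: le_trans (TP w n) _; rewrite ler_pM2l // ler_wpM2r ?l2_norm_ge0.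
  have h := ler_wpM2l (normc_ge0 b) (ne u).
  have h1 := ne (b *: u + v); have h2 := ne v.
  by lra.
(* The error is one [eps n] from [phases_segment] plus two from the rate of [T]. *)
have e30 : 0 < e / 3 by rewrite divr_gt0.
have [n nP] := small _ e30; exists (segment n) => s us ss u.
apply: le_trans (l2_dist_triangle (phases F (segment n) u) _ _) _.
have h1 := phases_segment u us ss; have h2 := TP u n.
have h3 : eps n * l2_norm u <= e / 3 * l2_norm u by rewrite ler_wpM2r ?l2_norm_ge0.
by rewrite -/(eps n) in h1; lra.
Qed.

End Existence.
End PhaseLimits.

Lemma geometric_small (R : realType) (k : nat) (B e : R) :
  (2 <= k)%N -> 0 <= B -> 0 < e -> exists N, B / k%:R ^+ N <= e.
Proof.
move=> k2 B0 e0; have k0 : 0 < k%:R :> R by rewrite ltr0n (leq_trans _ k2).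
exists (Num.bound (B / e)).
rewrite ler_pdivrMr ?exprn_gt0 // [e * _]mulrC -ler_pdivrMr //.
apply: le_trans (ltW (archi_boundP _)) _; first by rewrite divr_ge0 // ltW.
set n := Num.bound _; rewrite -natrX ler_nat.
by apply: ltnW; apply: leq_trans (ltn_expl n (isT : 1 < 2)%N) _; rewrite leq_exp2r.
Qed.

Lemma big_nat_mul_split (V : nmodType) (f : nat -> V) m k :
  \sum_(0 <= t < m * k) f t =
  \sum_(0 <= t < m) \sum_(0 <= j < k) f (t * k + j)%N.
Proof.
elim: m => [|m IHm]; first by rewrite !big_geq.
rewrite big_nat_recr //= -IHm mulSnr (big_cat_nat _ (leq_addr k (m * k))) //=.
congr (_ + _); rewrite -{1}[(m * k)%N]add0n big_addn addKn.
by apply: eq_bigr => j _; rewrite addnC.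
Qed.

(** * Commutants and base [k] digits *)

Section LocalSupport.
Variables (R : realType) (H : finGroupType) (Gam : groupType).
Local Notation k := #|H|.
Variable chi : 'I_k -> H -> R[i].
Hypothesis tab : character_table chi.
Local Notation G := (wreath H Gam).
Local Notation lam := (@left_regular R G).
Implicit Types (u v : l2 R G) (i : Gam) (z y : G).

(** Expresses independence from the place [i]: all nonzero coefficients sit at elements with the
    value of [z] at [i], so translates of the vector by distinct elements of the [i]-th copy of [H]
    are orthogonal. *)
Definition supported_at i z v :=
  forall y, dsum_fun y.1 i <> dsum_fun z.1 i -> val v y = 0.

Lemma supported_delta i z : supported_at i z (delta R z).
Proof. by move=> y yz; rewrite deltaE; case: eqP yz => // ->. Qed.

Lemma supported_wproj i z i' j v : i' != i ->
  supported_at i z v -> supported_at i z (wproj chi i' j v).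
Proof.
move=> i'i vz y yz; rewrite /wproj l2_valZ val_sum big1 ?mulr0 // => h _.
rewrite l2_valZ left_regularE wsingleV vz ?mulr0 //.
by rewrite wsingle_mul1 eq_sym (negPf i'i).
Qed.

Lemma supported_sum i z I (r : seq I) (P : pred I) (v : I -> l2 R G) :
  (forall j, supported_at i z (v j)) ->
  supported_at i z (\sum_(j <- r | P j) v j).
Proof. by move=> vz y yz; rewrite val_sum big1 // => j _; rewrite vz. Qed.

Lemma supported_phase i z i' r v : i' != i ->
  supported_at i z v -> supported_at i z (phase chi i' r v).
Proof.
move=> i'i vz; apply: supported_sum => j y yz.
by rewrite l2_valZ (supported_wproj _ i'i vz) ?mulr0.
Qed.

Lemma supported_phases i z F s v : i \notin s ->
  supported_at i z v -> supported_at i z (phases chi F s v).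
Proof.
elim: s => //= i' s IHs; rewrite inE negb_or eq_sym => /andP[i'i si] vz.
by apply: supported_phase => //; exact: IHs.
Qed.

Lemma lam_supported i z h v : h != 1%g -> supported_at i z v ->
  supported_at i (wsingle i h * z)%g (lam (wsingle i h) v).
Proof.
move=> h1 vz y yz; rewrite left_regularE wsingleV vz //.
rewrite !wsingle_mul1 eqxx in yz *.
by move=> E; apply: yz; rewrite -E mulKVg.
Qed.

Lemma dot_supported i z h u v : h != 1%g ->
  supported_at i z u -> supported_at i z v ->
  l2_dot (lam (wsingle i h) u) v = 0.
Proof.
move=> h1 uz vz; have E y : val (lam (wsingle i h) u) y * (val v y)^*%C = 0.
  have [yz|yz] := eqVneq (dsum_fun y.1 i) (dsum_fun z.1 i); last first.
    by rewrite (vz y) ?conjc0 ?mulr0 //; exact/eqP.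
  rewrite (lam_supported h1 uz) ?mul0r // wsingle_mul1 eqxx yz.
  move=> E; case/eqP: h1; apply: (mulIg (dsum_fun z.1 i)).
  by rewrite mul1g -E.
by rewrite /l2_dot (@complex_sum1 _ _ _ z).
Qed.

(** In <P v, v> the terms of the average over [H] with h <> 1 vanish and the fraction 1/k remains:
    the digit at [i] is uniformly distributed. *)
Lemma wproj_norm_supported i z j v : supported_at i z v ->
  l2_norm (wproj chi i j v) ^+ 2 = l2_norm v ^+ 2 / k%:R.
Proof.
move=> vz; apply: complexI; rewrite -l2_dot_self (wproj_adj tab).
rewrite (wprojK tab) eqxx l2_dotC /wproj l2_dotZl l2_dot_suml.
rewrite (bigD1 1%g) //= big1 => [|h h1].
  rewrite addr0 (ct_1 tab) conjc1 scale1r wsingle1 left_regular1 l2_dot_self.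
  rewrite conjcM conjc_inv conjc_nat conjc_real.
  have kE : ((k%:R : R)^-1)%:C%C = k%:R^-1.
    by rewrite (fmorphV (real_complex R)) rmorph_nat.
  by rewrite -kE mulrC -[LHS](rmorphM (real_complex R)).
by rewrite l2_dotZl (dot_supported h1 vz vz) mulr0.
Qed.

Lemma wproj_val_supported i z j v : supported_at i z v ->
  val (wproj chi i j v) z = k%:R^-1 * val v z.
Proof.
move=> vz; rewrite /wproj l2_valZ val_sum (bigD1 1%g) //.
rewrite [X in _ * (_ + X)]big1 => [|h /andP[_ h1]].
  by rewrite addr0 l2_valZ (ct_1 tab) conjc1 mul1r wsingle1 left_regular1.
rewrite l2_valZ (lam_supported h1 vz) ?mulr0 // wsingle_mul1 eqxx.
by move=> E; case/eqP: h1; apply: (mulIg (dsum_fun z.1 i)); rewrite mul1g -E.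
Qed.

(** Every projection has the same coefficient [k^-1 * val v z] at [z], so the sum of the phase
    factors splits off. *)
Lemma phase_val_supported i z r v : supported_at i z v ->
  \sum_(j < k) expi (r * j%:R) = 0 -> val (phase chi i r v) z = 0.
Proof.
move=> vz e0; rewrite /phase val_sum.
under eq_bigr do rewrite l2_valZ wproj_val_supported //.
by rewrite -mulr_suml e0 mul0r.
Qed.

Lemma phases_top c F s v : (forall y, y.2 <> c -> val v y = 0) ->
  forall y, y.2 <> c -> val (phases chi F s v) y = 0.
Proof.
move=> v0; elim: s => // i s IHs y yc; rewrite [phases _ _ _ _]/= /phase val_sum big1 // => j _.
rewrite l2_valZ /wproj l2_valZ val_sum big1 ?mulr0 // => h _.
by rewrite l2_valZ left_regularE wsingleV IHs ?mulr0 // wsingle_mul2.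
Qed.

End LocalSupport.

(** * Operators commuting with one circle coordinate *)

Section SpectralStep.
Variables (R : realType) (H : finGroupType) (Gam : groupType).
Local Notation k := #|H|.
Variable chi : 'I_k -> H -> R[i].
Hypothesis tab : character_table chi.
Local Notation G := (wreath H Gam).
Variables (F : Gam -> R) (p : nat -> Gam) (T S : l2 R G -> l2 R G) (c : R).
Hypothesis k2 : (2 <= k)%N.
Hypothesis p_inj : injective p.
Hypothesis Fp : forall n, F (p n) = k%:R ^- n.+1.
Hypothesis FT : phase_limit chi F T.
Hypothesis near_T : forall N u,
  l2_norm (phases chi F (segment p N) u - T u) <= c / k%:R ^+ N * l2_norm u.
Hypothesis c_gt0 : 0 < c.
Hypothesis bS : bounded_map S.
Hypothesis ST : forall u, S (T u) = T (S u).
Implicit Types (u v : l2 R G) (z w : G) (N t : nat).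

Let k_gt0 : (0 < k)%N := ltn_trans (isT : 0 < 1)%N k2.
Let kR : 0 < k%:R :> R.
Proof. by rewrite ltr0n. Qed.

Definition digit t : 'I_k := Ordinal (ltn_pmod t k_gt0).

(* The spectral projection onto [t / k^N, (t + 1) / k^N), that is, onto the
   sequences whose first digits, at the places [p 0], ..., [p (N - 1)], spell
   [t] in base [k]. *)
Fixpoint arc N t u : l2 R G :=
  if N is N'.+1 then wproj chi (p N') (digit t) (arc N' (t %/ k) u) else u.

Lemma arc_linear N t : linear (arc N t).
Proof. by elim: N t => //= N IHN t a u v; rewrite IHN wproj_linear. Qed.

Lemma arc_norm_le N t u : l2_norm (arc N t u) <= l2_norm u.
Proof. by elim: N t => //= N IHN t; apply: le_trans (IHN _); exact: wproj_norm. Qed.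

Lemma arc_wprojC N t i j u : wproj chi i j (arc N t u) = arc N t (wproj chi i j u).
Proof. by elim: N t => //= N IHN t; rewrite (wprojC tab) IHN. Qed.

Lemma arc_adj N t u v : l2_dot (arc N t u) v = l2_dot u (arc N t v).
Proof.
by elim: N t v => //= N IHN t v; rewrite (wproj_adj tab) IHN -arc_wprojC.
Qed.

Lemma arc_T N t u : T (arc N t u) = arc N t (T u).
Proof. by elim: N t => //= N IHN t; rewrite (phase_limit_wprojC tab _ _ _ FT) IHN. Qed.

Lemma arc_phasesC N t s u :
  phases chi F s (arc N t u) = arc N t (phases chi F s u).
Proof. by elim: N t => //= N IHN t; rewrite -(wproj_phasesC tab) IHN. Qed.

Lemma sum_arc N u : \sum_(0 <= t < k ^ N) arc N t u = u.
Proof.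
elim: N => [|N IHN]; first by rewrite expn0 big_nat1.
rewrite expnSr big_nat_mul_split -[RHS]IHN; apply: eq_bigr => t _.
rewrite -[RHS](sum_wproj tab (p N)) big_mkord; apply: eq_bigr => j _ /=.
rewrite divnMDl // divn_small // addn0; congr (wproj _ _ _ _).
by apply: val_inj; rewrite /= modnMDl modn_small.
Qed.

Lemma segmentE N : segment p N = [seq p n | n <- iota 0 N].
Proof. by rewrite /segment undup_id // map_inj_uniq ?iota_uniq. Qed.

(** The digits of [t], weighted by k^-1, ..., k^-N, add up to t / k^N, so the truncated product is a
    scalar on each arc. *)
Lemma phases_arc N t u : phases chi F (segment p N) (arc N t u) =
  expi (t%:R / k%:R ^+ N) *: arc N t u.
Proof.
elim: N t => [|N IHN] t; first by rewrite expr0 divr1 expi_nat scale1r.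
rewrite segmentE -addn1 iotaD map_cat phases_cat -segmentE addn1 /=.
rewrite (phase_wproj tab) (lin_Z (phases_linear _ _ _)) -(wproj_phasesC tab) IHN.
rewrite (lin_Z (wproj_linear _ _ _)) scalerA -expiD Fp; congr (expi _ *: _).
have kN : k%:R != 0 :> R by rewrite gt_eqF.
rewrite [in RHS](divn_eq t k) natrD natrM add0n exprS /=; field.
by rewrite kN expf_neq0.
Qed.

Lemma supported_arc N t n z : (N <= n)%N ->
  supported_at (p n) z (arc N t (delta R z)).
Proof.
elim: N t => [|N IHN] t Nn /=; first exact: supported_delta.
apply: supported_wproj; last by apply: IHN; exact: ltnW.
by apply: contraTneq Nn => /p_inj ->; rewrite ltnn.
Qed.

(** The places [p n] are distinct, so each projection meets a vector still supported at its place
    and divides the square norm by [k]. *)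
Lemma arc_norm N t z : l2_norm (arc N t (delta R z)) ^+ 2 = k%:R ^- N.
Proof.
elim: N t => [|N IHN] t /=; first by rewrite l2_norm_delta expr1n expr0 invr1.
rewrite (@wproj_norm_supported _ _ _ _ tab _ z); last exact: supported_arc.
by rewrite IHN exprSr invfM.
Qed.

Lemma wproj_arc N t j u : (t < k ^ N.+1)%N ->
  wproj chi (p 0%N) j (arc N.+1 t u) =
  if (t %/ k ^ N)%N == j :> nat then arc N.+1 t u else 0.
Proof.
elim: N t => [|N IHN] t tN.
  rewrite expn0 divn1 /= (wprojK tab) eq_sym -val_eqE /= modn_small //.
  by case: eqP => // tj; congr wproj; apply: val_inj; rewrite /= modn_small.
rewrite [arc _ _ _]/= (wprojC tab) IHN; last by rewrite ltn_divLR // -expnSr.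
rewrite -divnMA -expnS; case: ifP => // _.
by rewrite (lin_0 (wproj_linear _ _ _)).
Qed.

Let expi_dist (s t : R) : normc (expi s - expi t : R[i]) = normc (expi (s - t) - 1).
Proof.
have -> : expi s - expi t = expi t * (expi (s - t) - 1) :> R[i].
  by rewrite mulrBr mulr1 -expiD [t + _]addrC subrK.
by rewrite normcM normc_expi mul1r.
Qed.

(* [T] is within [c / k^N] of a scalar on each arc, so an operator commuting with
   [T] vanishes between arcs whose scalars are far apart; the proof improves the
   bound on this block by a factor [2] at each step. *)
Lemma arc_off_diagonal N t t' u :
  3 * (c / k%:R ^+ N) <=
    normc (expi (t'%:R / k%:R ^+ N) - expi (t%:R / k%:R ^+ N) : R[i]) ->
  arc N t' (S (arc N t u)) = 0.
Proof.
set e := c / _; set gap := normc _ => gapP.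
have e0 : 0 < e by rewrite divr_gt0 // exprn_gt0.
pose Z v := arc N t' (S (arc N t v)).
have [K K0 SK] := bounded_map_pos bS.
have ZK v : l2_norm (Z v) <= K * l2_norm v.
  apply: le_trans (arc_norm_le _ _ _) _; apply: le_trans (SK _) _.
  by rewrite ler_pM2l // arc_norm_le.
have linZ : linear Z by move=> a v w; rewrite /Z arc_linear bS.1 arc_linear.
pose D := phases chi F (segment p N).
have gapZ v : gap * l2_norm (Z v) <= l2_norm (D (Z v) - T (Z v)) +
    l2_norm (Z (D v - T v)).
  rewrite -l2_normZ scalerBl.
  have -> : expi (t'%:R / k%:R ^+ N) *: Z v = D (Z v) by rewrite /D phases_arc.
  have -> : expi (t%:R / k%:R ^+ N) *: Z v = Z (D v).
    rewrite /Z -arc_phasesC phases_arc (lin_Z bS.1).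
    by rewrite (lin_Z (arc_linear _ _)).
  have TZ : T (Z v) = Z (T v) by rewrite /Z arc_T -ST arc_T.
  apply: le_trans (l2_dist_triangle (T (Z v)) _ _) _.
  by rewrite (lin_B linZ) TZ [X in _ + X]l2_distC.
(* As gap >= 3 e, the error at [Z v] absorbs one e. The other error is bounded by the induction
   hypothesis at D v - T v, whose norm is at most e |v|, so 2 e |Z v| <= e (K / 2^n) |v|. *)
have half n v : l2_norm (Z v) <= K / 2 ^+ n * l2_norm v.
  elim: n v => [|n IHn] v; first by rewrite expr0 divr1.
  have h1 := gapZ v; have h2 := near_T N (Z v); have h3 := near_T N v.
  have h4 := IHn (D v - T v).
  have M0 : 0 <= K / 2 ^+ n by rewrite divr_ge0 ?exprn_ge0 // ltW.
  have h5 := ler_wpM2l M0 h3.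
  have h6 := ler_wpM2r (l2_norm_ge0 (Z v)) gapP.
  have -> : K / 2 ^+ n.+1 = (K / 2 ^+ n) / 2 by rewrite exprS; field.
  rewrite -/D -/e in h1 h2 h3 h4 h5 h6 *.
  have : e * (2 * l2_norm (Z v)) <= e * (K / 2 ^+ n * l2_norm v) by lra.
  by rewrite ler_pM2l //; lra.
apply: (@l2_small _ _ _ 1) => d d0.
have B0 : 0 <= K * l2_norm u by rewrite mulr_ge0 ?l2_norm_ge0 // ltW.
have [n nP] := @geometric_small R 2 _ _ isT B0 d0.
by rewrite mul1r; apply: le_trans (half n u) _; rewrite mulrAC.
Qed.

(** A separation by [c0] arcs, measured round the circle, suffices for the gap required in
    [arc_off_diagonal], since by [normc_expi_frac] chords dominate distances counted in full
    turns. *)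
Let c0 := Num.bound (3 * c).

(** [a] is the position of an arc inside a block of [M] consecutive arcs sharing their first digit;
    the condition asks that it be within [c0] of an end of the block. *)
Let near M a := (a < c0)%N || (M <= a + c0)%N.

(** Distinct first digits put the arcs into distinct blocks. Unless both are near an end, one of
    them has at least [c0] arcs of its own block on either side, so both ways round the circle are
    long. Both ways count, as the last block is adjacent to the block of digit 0. *)
Let arc_off N t t' u : (t < k ^ N.+1)%N -> (t' < k ^ N.+1)%N ->
  (t %/ k ^ N)%N != (t' %/ k ^ N)%N ->
  ~~ (near (k ^ N) (t %% k ^ N) && near (k ^ N) (t' %% k ^ N)) ->
  arc N.+1 t' (S (arc N.+1 t u)) = 0.
Proof.
move=> tK t'K qq far; apply: arc_off_diagonal; rewrite expi_dist.
set M := (k ^ N)%N in qq far; have M0 : (0 < M)%N by rewrite expn_gt0 k_gt0.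
have KE : (k ^ N.+1 = k * M)%N by rewrite expnS.
have c0P : 3 * c <= c0%:R by apply/ltW/archi_boundP; rewrite mulr_ge0 // ltW.
have dist (x y : nat) : (y < x)%N -> (x < k * M)%N ->
    (c0 <= minn (x - y) (k * M - (x - y)))%N ->
    3 * (c / k%:R ^+ N.+1) <=
      normc (expi (x%:R / k%:R ^+ N.+1 - y%:R / k%:R ^+ N.+1) - 1 : R[i]).
  move=> yx xK dc; rewrite -natrX KE -mulrBl -(natrB _ (ltnW yx)).
  have xyK : (x - y <= k * M)%N by apply: leq_trans (ltnW xK); exact: leq_subr.
  have kM0 : (0 < k * M)%N by rewrite muln_gt0 k_gt0.
  apply: le_trans (normc_expi_frac R xyK kM0).
  have kMV : 0 <= (k * M)%:R^-1 :> R by rewrite invr_ge0 ler0n.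
  rewrite mulrA; apply: ler_wpM2r kMV _ _ _; apply: le_trans c0P _.
  by rewrite ler_nat.
have tE := divn_eq t M; have t'E := divn_eq t' M.
have aM := ltn_pmod t M0; have a'M := ltn_pmod t' M0.
rewrite KE in tK t'K.
have qk : (t %/ M < k)%N by rewrite ltn_divLR.
have q'k : (t' %/ M < k)%N by rewrite ltn_divLR.
move: (t %/ M)%N (t %% M)%N (t' %/ M)%N (t' %% M)%N
  qk q'k aM a'M tE t'E qq far => q a q' a' qk q'k aM a'M tE t'E qq far.
have ordered x y b b' : (y < x)%N -> (x < k)%N -> (b < M)%N -> (b' < M)%N ->
    ~~ (near M b && near M b') ->
    (c0 <= minn (x * M + b - (y * M + b'))
      (k * M - (x * M + b - (y * M + b'))))%N.
  move=> yx xk bM b'M; rewrite /near => farb.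
  have [d dE] : exists d, x = (y + d.+1)%N by exists (x - y).-1; lia.
  have [d' d'E] : exists d', k = (x + d'.+1)%N by exists (k - x).-1; lia.
  rewrite d'E dE !mulnDl !mulSn; move: (d * M)%N (d' * M)%N (y * M)%N => *.
  by lia.
case: (ltngtP q q') => [qlt|qlt|qE]; last by rewrite qE eqxx in qq.
  rewrite [t']t'E [t]tE; apply: dist.
  - by have := leq_mul2r M q.+1 q'; rewrite qlt orbT mulSn; lia.
  - by rewrite -t'E.
  - by apply: ordered => //; rewrite andbC.
have -> : normc (expi (t'%:R / k%:R ^+ N.+1 - t%:R / k%:R ^+ N.+1) - 1 : R[i]) =
    normc (expi (t%:R / k%:R ^+ N.+1 - t'%:R / k%:R ^+ N.+1) - 1 : R[i]).
  rewrite -[_ / _ - t%:R / _]opprB expiN.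
  by rewrite -[X in _ - X]conjc1 -conjcN -conjcD normc_conj.
rewrite [t']t'E [t]tE; apply: dist.
- by have := leq_mul2r M q'.+1 q; rewrite qlt orbT mulSn; lia.
- by rewrite -tE.
- exact: ordered.
Qed.

Let count_near M : (\sum_(0 <= a < M) near M a <= 2 * c0)%N.
Proof.
have lt (n : nat) : (\sum_(0 <= a < n) (a < c0) <= c0)%N.
  rewrite -big_mkcond /= sum1_count; elim: n => // n IHn.
  rewrite /index_iota subn0 -addn1 iotaD count_cat /= add0n addn0.
  case: ltnP => nc; last by rewrite addn0; move: IHn; rewrite /index_iota subn0.
  have : (count (fun a => a < c0) (iota 0 n) <= size (iota 0 n))%N by exact: count_size.
  by rewrite size_iota; lia.
apply: (@leq_trans (\sum_(0 <= a < M) ((a < c0) + (M <= a + c0)))).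
  by apply: leq_sum => a _; rewrite /near; case: (a < c0)%N; case: (M <= _)%N.
rewrite big_split mul2n -addnn /= leq_add ?lt //.
rewrite big_nat_rev /= add0n big_nat (eq_bigr (fun a => (a < c0)%N : nat)) -?big_nat ?lt //.
by move=> a /andP[_ aM]; congr nat_of_bool; lia.
Qed.

(* Between arcs with distinct first digits only boundedly many blocks of [S] survive,
   those near the endpoints, and each contributes [O(k^-N)] to a matrix coefficient
   since [arc N t] maps [delta z] to a vector of norm [k^(-N/2)]. *)
Lemma wproj_off_diagonal i j u : i != j ->
  wproj chi (p 0%N) i (S (wproj chi (p 0%N) j u)) = 0.
Proof.
move=> ij; pose P := wproj chi (p 0%N).
have bP j' : bounded_map (P j') by exact: wproj_bounded.
have zero_bounded : bounded_map (fun _ : l2 R G => 0 : l2 R G).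
  by split=> [a v w|]; [rewrite scaler0 addr0|exists 0 => v; rewrite mul0r l2_norm0].
suff : P i \o S \o P j = (fun=> 0) by move=> /(congr1 (fun f => f u)).
apply: bounded_map_ext => [|//|z].
  exact: bounded_map_comp (bounded_map_comp (bP i) bS) (bP j).
apply: l2_ext => w; rewrite -[LHS]l2_dot_delta /= (wproj_adj tab).
rewrite -/(P i) -/(P j) [RHS]/(0 : R[i]).
have [K K0 SK] := bounded_map_pos bS.
apply: eq0_normc; apply/eqP; rewrite eq_le normc_ge0 andbT.
apply/ler_addgt0Pl => e e0; rewrite addr0.
(* Over the [k] blocks at most k (2 c0) arcs are near an end; the square counts pairs of them. *)
pose B : R := K * (k * (2 * c0))%:R ^+ 2.
have B0 : 0 <= B by rewrite mulr_ge0 ?sqr_ge0 // ltW.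
have [N NP] := @geometric_small R k _ _ k2 B0 e0.
apply: (le_trans _ NP).
have PE j' v : P j' v = \sum_(0 <= t < k ^ N.+1)
    (if (t %/ k ^ N)%N == j' :> nat then arc N.+1 t v else 0).
  rewrite /P -{1}[v](sum_arc N.+1) (lin_sum (wproj_linear _ _ _)).
  by apply: eq_big_nat => t /andP[_ tK]; exact: wproj_arc.
pose nr t := near (k ^ N) (t %% k ^ N).
have kN0 : 0 <= K / k%:R ^+ N by rewrite divr_ge0 ?exprn_ge0 // ltW.
have term t t' : (t < k ^ N.+1)%N -> (t' < k ^ N.+1)%N ->
    normc (l2_dot
      (S (if (t %/ k ^ N)%N == j :> nat then arc N.+1 t (delta R z) else 0))
      (if (t' %/ k ^ N)%N == i :> nat then arc N.+1 t' (delta R w) else 0)) <=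
    K / k%:R ^+ N * ((nr t)%:R * (nr t')%:R).
  move=> tK t'K.
  have r0 : 0 <= K / k%:R ^+ N * ((nr t)%:R * (nr t')%:R).
    by rewrite mulr_ge0 // mulr_ge0.
  case: eqP => [tj|_]; last by rewrite (lin_0 bS.1) l2_dot0l normc0.
  case: eqP => [t'i|_]; last by rewrite l2_dot0r normc0.
  have [nn|far] := boolP (nr t && nr t'); last first.
    rewrite -arc_adj arc_off ?l2_dot0l ?normc0 //.
    by rewrite tj t'i eq_sym.
  have /andP[-> ->] := nn; rewrite mulr1 mulr1.
  apply: le_trans (l2_cauchy_schwarz _ _) _.
  set r := l2_norm (arc N.+1 t' _).
  have -> : r = l2_norm (arc N.+1 t (delta R z)).
    by apply/eqP; rewrite -(@eqrXn2 _ 2) ?l2_norm_ge0 // !arc_norm.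
  apply: le_trans (ler_wpM2r (l2_norm_ge0 _) (SK _)) _.
  rewrite -mulrA -expr2 arc_norm ler_pM2l // lef_pV2 ?posrE ?exprn_gt0 //.
  have k1 : 1 <= k%:R :> R by rewrite ler1n.
  exact: ler_weXn2l k1 _ _ (leqnSn N).
rewrite (PE j) (PE i) (lin_sum bS.1) l2_dot_suml.
have normc_sum (I : Type) (r : seq I) (Q : pred I) (f : I -> R[i]) :
    normc (\sum_(t <- r | Q t) f t) <= \sum_(t <- r | Q t) normc (f t).
  elim/big_rec2: _ => [|t a b _ ba]; first by rewrite normc0.
  by apply: le_trans (le_normcD _ _) _; rewrite lerD2l.
apply: le_trans (normc_sum _ _ _ _) _.
apply: (@le_trans _ _ (\sum_(0 <= t < k ^ N.+1) \sum_(0 <= t' < k ^ N.+1)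
    K / k%:R ^+ N * ((nr t)%:R * (nr t')%:R))).
  rewrite big_nat [leRHS]big_nat; apply: ler_sum => t /andP[_ tK].
  rewrite l2_dot_sumr; apply: le_trans (normc_sum _ _ _ _) _.
  rewrite big_nat [leRHS]big_nat; apply: ler_sum => t' /andP[_ t'K].
  exact: term.
under eq_bigr do rewrite -mulr_sumr -mulr_sumr.
rewrite -mulr_sumr -mulr_suml -natr_sum -expr2.
have -> : B / k%:R ^+ N = K / k%:R ^+ N * (k * (2 * c0))%:R ^+ 2.
  by rewrite /B mulrAC.
apply: ler_wpM2l => //; rewrite ler_sqr ?nnegrE // ler_nat expnS big_nat_mul_split.
apply: (@leq_trans (\sum_(0 <= q < k) 2 * c0)%N); last first.
  by rewrite sum_nat_const_nat subn0.
apply: leq_sum => q _; apply: leq_trans (count_near (k ^ N)).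
apply: eq_leq; apply: eq_big_nat => a /andP[_ aM].
by rewrite /nr modnMDl modn_small.
Qed.

Lemma wproj_commutes j u :
  S (wproj chi (p 0%N) j u) = wproj chi (p 0%N) j (S u).
Proof.
rewrite -[LHS](sum_wproj tab (p 0%N)) (bigD1 j) //= big1 ?addr0 => [|i ij].
  rewrite -{2}[u](sum_wproj tab (p 0%N)) (lin_sum bS.1).
  rewrite (lin_sum (wproj_linear _ _ _)) (bigD1 j) //= big1 ?addr0 // => i ij.
  by rewrite wproj_off_diagonal // eq_sym.
exact: wproj_off_diagonal.
Qed.

End SpectralStep.

(** * The induced semidirect product *)

Section CosetFunction.
Variables (R : realType) (Gam : groupType) (g : Gam) (k : nat).
Local Open Scope group_scope.
Implicit Types (c d x : Gam) (a b n : nat).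

(** x = c g^(b - a), written with natural exponents only. *)
Definition same_coset c x (ab : nat * nat) := x * g ^+ ab.1 = c * g ^+ ab.2.

(* [k ^ (- n)] at [c g^n] for [n] an integer, and [0] off the coset [c <g>]. *)
Definition coset_fun c x : R :=
  if pselect (exists ab, same_coset c x ab) is left ex
  then (k%:R ^+ (projT1 (cid ex)).1 / k%:R ^+ (projT1 (cid ex)).2)%R else 0%R.

Lemma coset_fun_shift c d x : coset_fun c (d^-1 * x) = coset_fun (d * c) x.
Proof.
suff E : same_coset c (d^-1 * x) = same_coset (d * c) x by rewrite /coset_fun E.
apply/funext => ab; apply/propext; rewrite /same_coset; split=> E.
  by rewrite -mulgA -E -!mulgA mulKVg.
by rewrite -mulgA E -mulgA mulKg.
Qed.

Hypothesis g_inf : forall n, (0 < n)%N -> g ^+ n <> 1.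
Hypothesis k2 : (2 <= k)%N.

Let kR0 : (0 < k%:R :> R)%R.
Proof. by rewrite ltr0n (leq_trans _ k2). Qed.

Lemma expg_inj_inf : injective (fun n => g ^+ n).
Proof.
move=> m n; wlog mn : m n / (m <= n)%N => [hwlog E|E].
  by case/orP: (leq_total m n) => mn; [exact: hwlog|exact/esym/hwlog].
apply/eqP; rewrite eqn_leq mn leqNgt; apply/negP => lt.
apply: (g_inf (n := n - m)); first by rewrite subn_gt0.
by rewrite expgnFr // -E mulgV.
Qed.

Lemma same_coset_unique c x a b a' b' : same_coset c x (a, b) ->
  same_coset c x (a', b') -> (b + a' = b' + a)%N.
Proof.
rewrite /same_coset /= => E E'; apply: expg_inj_inf; rewrite !expgnDr.
apply: (mulgI c); rewrite !mulgA -E -E' -!mulgA -!expgnDr addnC.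
by [].
Qed.

(** The pair picked by [cid] is arbitrary, but the infinite order of [g] determines b - a and hence
    the value. *)
Lemma coset_funE c x a b : same_coset c x (a, b) ->
  coset_fun c x = (k%:R ^+ a / k%:R ^+ b)%R.
Proof.
move=> cx; rewrite /coset_fun; case: pselect => [ex|]; last by case; exists (a, b).
case: (cid ex) => -[a' b'] /= cx'; have E := same_coset_unique cx cx'.
have kn n : (k%:R ^+ n != 0 :> R)%R by rewrite gt_eqF ?exprn_gt0.
apply/eqP; rewrite eqr_div // -!exprD; apply/eqP.
by congr (_ ^+ _)%R; lia.
Qed.

Lemma coset_fun0 c x : (forall ab, ~ same_coset c x ab) -> coset_fun c x = 0%R.
Proof.
move=> cx; rewrite /coset_fun; case: pselect => // ex; exfalso.
by case: ex => ab; exact: cx.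
Qed.

Lemma coset_fun_neq0 c x : coset_fun c x <> 0%R -> exists ab, same_coset c x ab.
Proof. by rewrite /coset_fun; case: pselect. Qed.

Variant coset_fun_spec c x : R -> Prop :=
| CosetFunIn a b of same_coset c x (a, b) :
    coset_fun_spec c x (k%:R ^+ a / k%:R ^+ b)%R
| CosetFunOut of (forall ab, ~ same_coset c x ab) : coset_fun_spec c x 0%R.

Lemma coset_funP c x : coset_fun_spec c x (coset_fun c x).
Proof.
case: (pselect (exists ab, same_coset c x ab)) => [[[a b] cx]|cx].
  by rewrite (coset_funE cx); exact: CosetFunIn.
have cx' ab : ~ same_coset c x ab by move=> h; apply: cx; exists ab.
by rewrite coset_fun0 //; exact: CosetFunOut.
Qed.

Lemma coset_fun_right c x : coset_fun c (x * g) = (coset_fun c x / k%:R)%R.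
Proof.
case: (coset_funP c x) => [a b cx|cx].
  rewrite (@coset_funE _ _ a b.+1) ?exprSr ?invfM ?mulrA // /same_coset /=.
  by rewrite -mulgA -expgS expgSr mulgA cx expgSr mulgA.
rewrite mul0r coset_fun0 // => -[a b]; rewrite /same_coset /= => E.
by apply: (cx (a.+1, b)); rewrite /same_coset /= expgS mulgA.
Qed.

Lemma coset_fun_left c x : coset_fun (c * g) x = (k%:R * coset_fun c x)%R.
Proof.
case: (coset_funP c x) => [a b cx|cx].
  rewrite (@coset_funE _ _ a.+1 b) ?exprS ?mulrA // /same_coset /=.
  by rewrite expgSr mulgA cx /= -!mulgA -expgSr -expgS.
rewrite mulr0 coset_fun0 // => -[a b]; rewrite /same_coset /= => E.
by apply: (cx (a, b.+1)); rewrite /same_coset /= expgS mulgA.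
Qed.

Lemma coset_fun_self c : coset_fun c c = 1%R.
Proof. by rewrite (@coset_funE _ _ 0 0) ?divr1 ?expr0 ?divff ?oner_eq0. Qed.

End CosetFunction.

Section InducedModule.
Variables (R : realType) (Gam : groupType) (g : Gam) (k : nat).
Implicit Types (F : Gam -> R) (s : seq (int * Gam)).

Local Notation coset_fun := (@coset_fun R Gam g k).

Definition combination s : Gam -> R :=
  fun x => \sum_(q <- s) q.1%:~R * coset_fun q.2 x.

Definition induced_pred : {pred Gam -> R} :=
  [pred F | `[< exists s, F = combination s >]].

Lemma induced_predP F : reflect (exists s, F = combination s) (F \in induced_pred).
Proof. exact: asboolP. Qed.

Fact induced_zmod_closed : zmod_closed induced_pred.
Proof.
split=> [|F F' /induced_predP[s ->] /induced_predP[s' ->]].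
  by apply/induced_predP; exists [::]; apply/funext => x; rewrite /combination big_nil.
apply/induced_predP; exists (s ++ [seq (- q.1, q.2) | q <- s']).
apply/funext => x; rewrite /combination big_cat big_map /=; congr (_ + _).
transitivity (- (\sum_(q <- s') q.1%:~R * coset_fun q.2 x)); first by [].
by rewrite -sumrN; apply: eq_bigr => q _; rewrite mulrNz mulNr.
Qed.

HB.instance Definition _ :=
  GRing.isZmodClosed.Build (Gam -> R) induced_pred induced_zmod_closed.

(* The module induced from [<g>] to [Gam] of [Z[1/k]], on which [g] acts as the
   multiplication by [k], realised as functions on [Gam]. *)
Definition induced_mod : Type := {F : Gam -> R | F \in induced_pred}.

HB.instance Definition _ := SubChoice.on induced_mod.
HB.instance Definition _ := [SubChoice_isSubZmodule of induced_mod by <:].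

Lemma combination_shift s c x :
  combination s (c^-1 * x)%g = combination [seq (q.1, c * q.2)%g | q <- s] x.
Proof.
rewrite /combination big_map; apply: eq_bigr => q _.
by rewrite /= coset_fun_shift.
Qed.

Hypothesis g_inf : forall n, (0 < n)%N -> (g ^+ n <> 1)%g.
Hypothesis k2 : (2 <= k)%N.

Lemma induced_ind (Q : (Gam -> R) -> Prop) :
  Q (fun=> 0) ->
  (forall (m : int) c F, Q F -> Q (fun x => m%:~R * coset_fun c x + F x)) ->
  forall f : induced_mod, Q (val f).
Proof.
move=> Q0 QS f; have /induced_predP[s ->] := valP f.
elim: s => [|[m c] s IHs].
  have -> : combination [::] = fun=> 0 by apply/funext => x; rewrite /combination big_nil.
  exact: Q0.
have -> : combination ((m, c) :: s) = fun x => m%:~R * coset_fun c x + combination s x.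
  by apply/funext => x; rewrite /combination big_cons.
exact: QS.
Qed.

Implicit Types (f : induced_mod).

Lemma induced_right f x : val f (x * g)%g = val f x / k%:R.
Proof.
move: x; apply: (induced_ind (Q := fun F => forall x, F (x * g)%g = F x / k%:R)).
  by move=> x; rewrite mul0r.
by move=> m c F IH x; rewrite coset_fun_right // IH mulrDl mulrA.
Qed.

Let kR0 : 0 < k%:R :> R.
Proof. by rewrite ltr0n (leq_trans _ k2). Qed.

Lemma induced_rightX f x n : val f (x * g ^+ n)%g = val f x / k%:R ^+ n.
Proof.
elim: n => [|n IHn]; first by rewrite expg0 mulg1 expr0 divr1.
by rewrite expgSr mulgA induced_right IHn exprSr invfM mulrA.
Qed.

(** The support itself is infinite unless [f] is 0; the finite number of cosets feeds the pigeonhole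
    argument of [eigenfunction_conj]. *)
Lemma induced_finite f : exists s : seq Gam, forall x, val f x <> 0 ->
  exists2 c, c \in s & exists ab, same_coset g c x ab.
Proof.
apply: (induced_ind (Q := fun F => exists s : seq Gam, forall x, F x <> 0 ->
  exists2 c, c \in s & exists ab, same_coset g c x ab)); first by exists [::].
move=> m c F [s sP]; exists (c :: s) => x Fx.
have [F0|F0] := pselect (F x = 0).
  exists c; first exact: mem_head.
  by apply: (@coset_fun_neq0 R _ g k) => E; apply: Fx; rewrite E F0 mulr0 addr0.
by have [d ds dx] := sP x F0; exists d => //; rewrite inE ds orbT.
Qed.

Lemma induced_integral f x : exists N, val f x * k%:R ^+ N \is a Num.int.
Proof.
move: x; apply: (induced_ind (Q := fun F => forall x,
  exists N, F x * k%:R ^+ N \is a Num.int)).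
  by move=> x; exists 0%N; rewrite mul0r rpred0.
move=> m c F IH x; have [N NP] := IH x.
have kint n : k%:R ^+ n \is a @Num.int R by rewrite rpredX // natr_int.
have [b bP] : exists b, coset_fun c x * k%:R ^+ b \is a @Num.int R.
  case: (coset_funP R g_inf k2 c x) => [a b _|_].
    by exists b; rewrite mulfVK ?gt_eqF ?exprn_gt0.
  by exists 0%N; rewrite mul0r rpred0.
exists (b + N)%N.
have -> : (m%:~R * coset_fun c x + F x) * k%:R ^+ (b + N) =
    m%:~R * (coset_fun c x * k%:R ^+ b) * k%:R ^+ N + F x * k%:R ^+ N * k%:R ^+ b.
  by rewrite exprD; ring.
apply: rpredD; apply: rpredM => //; apply: rpredM => //; exact: intr_int.
Qed.

(** Each step from x to x g divides the value by [k]. Far enough back it is an integer, far enough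
    forward it is nonzero of absolute value below 1. The first non-integral value on the way becomes
    integral when multiplied by [k], and at such a place the [k] phase factors sum to 0. *)
Lemma induced_breakpoint f : f != 0 -> exists i,
  val f i \isn't a Num.int /\ val f i * k%:R \is a Num.int.
Proof.
move=> f0; have [x fx] : exists x, val f x != 0.
  apply/not_existsP => E; case/eqP: f0; apply: val_inj; apply/funext => x.
  by apply/eqP/negPn/negP; exact: E.
have [N NP] := induced_integral f x.
pose y := (x * g ^- N)%g.
have fy : val f y \is a Num.int.
  have -> : val f y = val f x * k%:R ^+ N; last by [].
  have := induced_rightX f y N; rewrite /y mulgVK => ->.
  by rewrite mulfVK // gt_eqF // exprn_gt0.
have fy0 : val f y != 0.
  apply: contra_neq fx => E; have := induced_rightX f y N.
  by rewrite /y mulgVK -/y E mul0r.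
have ex : exists n, val f (y * g ^+ n)%g \isn't a Num.int.
  have [n nP] := @geometric_small R k `|val f y| (1 / 2) k2 (normr_ge0 _) ltac:(lra).
  exists n; rewrite induced_rightX; apply/negP => /intrP[z zE].
  have kn : 0 < k%:R ^+ n :> R by rewrite exprn_gt0.
  have z0 : z != 0.
    apply: contra_neq fy0 => z0; move: zE; rewrite z0 => /eqP.
    by rewrite mulf_eq0 invr_eq0 [k%:R ^+ n == 0]gt_eqF // orbF => /eqP.
  have : `|val f y| / k%:R ^+ n = `|z|%:~R.
    by rewrite intr_norm -zE normrM normfV (ger0_norm (ltW kn)).
  have : 1 <= `|z|%:~R :> R by rewrite (ler_int R 1) ; lia.
  by lra.
case: (ex_minnP ex) => -[|n] nP nmin.
  by move: nP; rewrite expg0 mulg1 fy.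
exists (y * g ^+ n.+1)%g; split=> //.
have : val f (y * g ^+ n)%g \is a Num.int.
  by apply/negPn/negP => /nmin; rewrite ltnn.
rewrite !induced_rightX exprSr invfM mulrA mulfVK //.
by rewrite gt_eqF.
Qed.

Lemma induced_coset_fun_subproof c : coset_fun c \in induced_pred.
Proof.
apply/induced_predP; exists [:: (1, c)]; apply/funext => x.
by rewrite /combination big_seq1 mul1r.
Qed.

Definition induced_coset_fun c : induced_mod :=
  Sub (coset_fun c) (induced_coset_fun_subproof c).

End InducedModule.

(** * Group law, torsion and countability of the semidirect product *)

Section InducedGroup.
Variables (R : realType) (Gam : groupType) (g : Gam) (k : nat).
Local Notation A := (induced_mod R g k).
Implicit Types (f : A) (c d : Gam).

Fact induced_act_subproof c f :
  (fun x => val f (c^-1 * x)%g) \in @induced_pred R Gam g k.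
Proof.
have /induced_predP[s ->] := valP f; apply/induced_predP.
exists [seq (q.1, c * q.2)%g | q <- s]; apply/funext => x.
exact: combination_shift.
Qed.

Definition induced_act c f : A :=
  Sub (fun x => val f (c^-1 * x)%g) (induced_act_subproof c f).

Lemma induced_actE c f x : val (induced_act c f) x = val f (c^-1 * x)%g.
Proof. by []. Qed.

Lemma induced_ext f f' : val f =1 val f' -> f = f'.
Proof. by move=> /funext E; exact: val_inj. Qed.

Lemma induced_valD f f' x : val (f + f') x = val f x + val f' x.
Proof. by []. Qed.

Lemma induced_valN f x : val (- f) x = - val f x.
Proof. by []. Qed.

Lemma induced_actD c f f' : induced_act c (f + f') = induced_act c f + induced_act c f'.
Proof. exact: induced_ext. Qed.

Lemma induced_actN c f : induced_act c (- f) = - induced_act c f.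
Proof. exact: induced_ext. Qed.

Lemma induced_act0 c : induced_act c 0 = 0.
Proof. exact: induced_ext. Qed.

Lemma induced_act1 f : induced_act 1%g f = f.
Proof. by apply: induced_ext => x; rewrite induced_actE invg1 mul1g. Qed.

Lemma induced_actM c d f : induced_act (c * d)%g f = induced_act c (induced_act d f).
Proof. by apply: induced_ext => x; rewrite !induced_actE invgM mulgA. Qed.

Definition induced_semidirect : Type := (A * Gam)%type.

HB.instance Definition _ := Choice.on induced_semidirect.

Implicit Types u v w : induced_semidirect.

Definition isd_one : induced_semidirect := (0, 1%g).
Definition isd_mul u v : induced_semidirect :=
  (u.1 + induced_act u.2 v.1, (u.2 * v.2)%g).
Definition isd_inv u : induced_semidirect :=
  (- induced_act u.2^-1%g u.1, u.2^-1%g).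

Lemma isd_mulA : associative isd_mul.
Proof.
move=> u v w; rewrite /isd_mul /= induced_actD induced_actM addrA.
by rewrite mulgA.
Qed.

Lemma isd_mul1g : left_id isd_one isd_mul.
Proof. by move=> [f c]; rewrite /isd_mul /= induced_act1 add0r mul1g. Qed.

Lemma isd_mulg1 : right_id isd_one isd_mul.
Proof. by move=> [f c]; rewrite /isd_mul /= induced_act0 addr0 mulg1. Qed.

Lemma isd_mulVg : left_inverse isd_one isd_inv isd_mul.
Proof. by move=> [f c]; rewrite /isd_mul /= addNr mulVg. Qed.

Lemma isd_mulgV : right_inverse isd_one isd_inv isd_mul.
Proof.
move=> [f c]; rewrite /isd_mul /= induced_actN -induced_actM mulgV.
by rewrite induced_act1 subrr.
Qed.

HB.instance Definition _ := isGroup.Build induced_semidirect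
  isd_mulA isd_mul1g isd_mulg1 isd_mulVg isd_mulgV.

Lemma isd_mulE u v : (u * v)%g = (u.1 + induced_act u.2 v.1, (u.2 * v.2)%g).
Proof. by []. Qed.

Lemma isd_invE u : u^-1%g = (- induced_act u.2^-1%g u.1, u.2^-1%g).
Proof. by []. Qed.

Lemma isd_exp2 u n : (u ^+ n)%g.2 = (u.2 ^+ n)%g.
Proof. by elim: n => // n IHn; rewrite !expgS isd_mulE /= IHn. Qed.

Lemma isd_exp_base f n : (((f, 1) : induced_semidirect) ^+ n)%g = (f *+ n, 1%g).
Proof.
elim: n => // n IHn; rewrite expgS IHn isd_mulE /= induced_act1 mulg1.
by rewrite mulrS.
Qed.

Lemma induced_mulrn f n x : val (f *+ n) x = val f x *+ n.
Proof. by elim: n => // n IHn; rewrite !mulrS induced_valD IHn. Qed.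

Lemma induced_torsion_free f n : (0 < n)%N -> f *+ n = 0 -> f = 0.
Proof.
move=> n0 fn; apply: induced_ext => x; have := induced_mulrn f n x.
by rewrite fn => /esym/eqP; rewrite mulrn_eq0 gtn_eqF // => /eqP.
Qed.

Lemma isd_torsion_free :
  torsion_free Gam -> torsion_free induced_semidirect.
Proof.
move=> tf [f c] n n0 E.
have c1 : c = 1%g.
  by apply: (tf c n n0); have := isd_exp2 (f, c) n; rewrite E => /esym.
rewrite {}c1 in E *; move: E; rewrite isd_exp_base => -[/(induced_torsion_free n0) ->].
by [].
Qed.

Lemma isd_countable : countable [set: Gam] -> countable [set: induced_semidirect].
Proof.
move=> /countable_injP[e einj].
have ex (f : A) : exists s, val f = combination R g k s.
  by apply/induced_predP; exact: valP.
have [r rP] := choice ex.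
apply/countable_injP.
exists (fun u : induced_semidirect =>
  choice.pickle ([seq (q.1, e q.2) | q <- r u.1], e u.2)) => -[f c] [f' c'] _ _.
move=> /(pcan_inj choice.pickleK) [rf /einj ->]; rewrite ?inE //; congr (_, _).
apply: val_inj; rewrite !rP; congr combination.
apply: inj_map rf => -[m x] [m' x'] /= [-> /einj ->] //; by rewrite inE.
Qed.

End InducedGroup.

(** * The semidirect product acting on l^2 of the wreath product *)

Section Representation.
Variables (R : realType) (H : finGroupType) (Gam : groupType) (g : Gam).
Local Notation k := #|H|.
Variable chi : 'I_k -> H -> R[i].
Hypothesis tab : character_table chi.
Hypothesis g_inf : forall n, (0 < n)%N -> (g ^+ n <> 1)%g.
Hypothesis k2 : (2 <= k)%N.
Local Notation G := (wreath H Gam).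
Local Notation L := (induced_semidirect R g k).
Local Notation lam := (@left_regular R G).
Local Notation coset_fun := (@coset_fun R Gam g k).
Implicit Types (f : induced_mod R g k) (u v : l2 R G) (c : Gam).

Let k_gt0 : 0 < k%:R :> R.
Proof. by rewrite ltr0n (leq_trans _ k2). Qed.

(** The places where [coset_fun c] is non-integral; the exponent starts at 1 because the value at
    [c] itself is 1. *)
Let p c n := (c * g ^+ n.+1)%g.

Let p_inj c : injective (p c).
Proof. by move=> m n /mulgI/(expg_inj_inf g_inf) []. Qed.

Let coset_fun_p c n : coset_fun c (p c n) = k%:R ^- n.+1.
Proof.
rewrite (@coset_funE _ _ _ _ g_inf k2 _ _ 0 n.+1) ?expr0 ?mul1r //.
by rewrite /same_coset /= expg0 mulg1.
Qed.

Lemma coset_fun_int c i :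
  coset_fun c i \is a Num.int \/ exists n, i = p c n.
Proof.
case: (coset_funP R g_inf k2 c i) => [a b ci|_]; last by left; exact: rpred0.
have [ba|ab] := leqP b a.
  left; have -> : k%:R ^+ a / k%:R ^+ b = k%:R ^+ (a - b) :> R.
    by rewrite -{1}(subnK ba) exprD mulfK // expf_neq0 // gt_eqF.
  by rewrite rpredX // natr_int.
right; exists (b - a).-1; rewrite /p prednK ?subn_gt0 //.
apply: (mulIg (g ^+ a)%g); rewrite -mulgA -expgnDr (subnK (ltnW ab)).
exact: ci.
Qed.

Lemma coset_fun_limit (m : int) c : exists2 T,
  phase_limit chi (fun i => m%:~R * coset_fun c i) T &
  forall N u,
  l2_norm (phases chi (fun i => m%:~R * coset_fun c i) (segment (p c) N) u - T u)
  <= 4 * (phase_const R H * `|m%:~R| / k%:R ^+ N) * l2_norm u.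
Proof.
apply: (phase_limit_exists tab k2 (normr_ge0 _)) => [i|n].
  case: (coset_fun_int c i) => [ci|]; [left|by right].
  by apply: rpredM => //; exact: intr_int.
rewrite coset_fun_p normrM; apply: ler_wpM2l; first exact: normr_ge0.
rewrite ger0_norm; last by rewrite invr_ge0 exprn_ge0 // ltW.
rewrite lef_pV2 ?posrE ?exprn_gt0 //.
have k1 : 1 <= k%:R :> R by rewrite ler1n (leq_trans _ k2).
exact: ler_weXn2l k1 _ _ (leqnSn n).
Qed.

Lemma induced_limit f : exists T, phase_limit chi (val f) T.
Proof.
apply: (induced_ind (Q := fun F => exists T, phase_limit chi F T)).
  by exists id; apply: (phase_limit_int tab) => i; exact: rpred0.
move=> m c F [T FT]; have [T' FT' _] := coset_fun_limit m c.
by exists (T' \o T); exact: (phase_limitD tab).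
Qed.

(** The chosen limit is unique, and uniqueness turns sums and shifts of functions into products and
    conjugates of operators. *)
Definition limit_op f : l2 R G -> l2 R G := projT1 (cid (induced_limit f)).

Lemma limit_opP f : phase_limit chi (val f) (limit_op f).
Proof. exact: projT2 (cid (induced_limit f)). Qed.

Definition rep (x : L) : l2 R G -> l2 R G := limit_op x.1 \o lam (wtop H x.2).

Lemma limit_op0 : limit_op 0 = id.
Proof.
apply: (phase_limit_unique (limit_opP 0)).
by apply: (phase_limit_int tab) => i; exact: rpred0.
Qed.

Lemma limit_opD f f' : limit_op (f + f') = limit_op f \o limit_op f'.
Proof.
apply: (phase_limit_unique (limit_opP _)).
exact: (phase_limitD tab (limit_opP f) (limit_opP f')).
Qed.

Lemma limit_op_act c f : limit_op (induced_act c f) =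
  lam (wtop H c) \o limit_op f \o lam (wtop H c^-1).
Proof.
apply: (phase_limit_unique (limit_opP _)).
exact: (phase_limit_shift c (limit_opP f)).
Qed.

Lemma rep_linear x : linear (rep x).
Proof.
by move=> a u v; rewrite /rep /= left_regular_linear (limit_opP x.1).1.
Qed.

Lemma rep_norm x u : l2_norm (rep x u) = l2_norm u.
Proof.
by rewrite /rep /= (phase_limit_norm tab _ (limit_opP x.1)) left_regular_norm.
Qed.

Lemma rep1 : rep 1%g = id.
Proof.
apply/funext => u; rewrite /rep [(1%g : L).1]/(0 : induced_mod R g k) limit_op0 /=.
by rewrite wtop1 left_regular1.
Qed.

Lemma repM x y : rep (x * y)%g = rep x \o rep y.
Proof.
apply/funext => u; rewrite /rep isd_mulE /= limit_opD limit_op_act /=.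
by rewrite !lamM -!wtopM mulKg.
Qed.

(** If c <> 1, the top component of the support has moved away from 1. Otherwise [f] is nonzero, and
    every finite product containing a breakpoint of [f] has coefficient 0. *)
Lemma rep_trace x : x != 1%g -> val (rep x (delta R 1%g)) 1%g = 0.
Proof.
case: x => f c x1; rewrite /rep /= left_regular_delta mulg1.
have [c1|c1] := eqVneq c 1%g; last first.
  apply: (phase_limit_eq0 (s0 := [::]) (limit_opP f)) => s _ _.
  apply: (@phases_top _ _ _ chi c) => [y yc|]; last by apply/eqP; rewrite eq_sym.
  by rewrite deltaE; case: eqP yc => // ->.
rewrite {}c1 in x1 *; rewrite wtop1.
have f0 : f != 0 by apply: contraNneq x1 => ->.
have [i [fi fik]] := induced_breakpoint g_inf k2 f0.
apply: (phase_limit_eq0 (s0 := [:: i]) (limit_opP f)) => s us si.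
have {}si : i \in s by apply: si; rewrite mem_head.
rewrite (phases_rem tab _ _ si); apply: (phase_val_supported tab).
  apply: supported_phases; last exact: supported_delta.
  by rewrite mem_rem_uniqF.
exact: sum_expi_eq0.
Qed.

(** Recovering the first digit of each circle coordinate is enough: every place [i] carries the
    first digit of the generator based at c = i g^-1. *)
Lemma rep_commutant S : bounded_op S ->
  ((forall x, S \o rep x = rep x \o S) <->
   (forall y, S \o lam y = lam y \o S)).
Proof.
move=> bS; split=> [Sx y|Sy [f c]]; last first.
  apply/funext => u; rewrite /rep /=.
  have E y v : S (lam y v) = lam y (S v) by have /(congr1 (fun T0 => T0 v)) := Sy y.
  by rewrite (phase_limit_comm (limit_opP f) bS) ?E.
have Stop c u : S (lam (wtop H c) u) = lam (wtop H c) (S u).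
  have /(congr1 (fun T0 => T0 u)) := Sx (0, c).
  by rewrite /rep /= limit_op0.
have Slim f u : S (limit_op f u) = limit_op f (S u).
  have /(congr1 (fun T0 => T0 u)) := Sx (f, 1%g).
  by rewrite /rep /= wtop1 left_regular1.
have Sproj i j u : S (wproj chi i j u) = wproj chi i j (S u).
  pose c := (i * g^-1)%g.
  have [T TF near_T] := coset_fun_limit 1 c.
  have FE : (fun i => 1%:~R * coset_fun c i) = val (induced_coset_fun R g k c).
    by apply/funext => x; rewrite mul1r.
  have TE : T = limit_op (induced_coset_fun R g k c).
    by rewrite FE in TF; exact: phase_limit_unique TF (limit_opP _).
  have -> : i = p c 0 by rewrite /p expg1 mulgVK.
  apply: (@wproj_commutes _ _ _ _ tab (fun i => 1%:~R * coset_fun c i) (p c) T S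
    (4 * phase_const R H)) => //.
  - by move=> n; rewrite mul1r coset_fun_p.
  - move=> N v; apply: le_trans (near_T N v) _; rewrite normr1 mulr1.
    by rewrite [4 * (_ / _)]mulrA.
  - by rewrite mulr_gt0 // phase_const_gt0.
  - by move=> v; rewrite TE Slim.
apply/funext; elim/wreath_ind: y => [c|i h y IHy] u; first exact: Stop.
rewrite /= -!lamM !(lam_single tab) (lin_sum bS.1); apply: eq_bigr => j _.
by rewrite (lin_Z bS.1) Sproj; have /= -> := IHy u.
Qed.

Lemma star_isomorphic_character_table :
  star_isomorphic (group_vna R L) (group_vna R G).
Proof.
exact: (star_isomorphic_implementation rep_linear rep_norm rep1 repM rep_trace
  rep_commutant).
Qed.

End Representation.

Lemma star_isomorphic_induced (R : realType) (H : finGroupType)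
    (Gam : groupType) (g : Gam) :
  abelian [set: H]%G -> (exists h : H, h <> 1%g) ->
  (forall n, (0 < n)%N -> (g ^+ n <> 1)%g) ->
  star_isomorphic (group_vna R (induced_semidirect R g #|H|))
    (group_vna R (wreath H Gam)).
Proof.
move=> abH [h h1] g_inf; have [chi tab] := character_table_exists R abH.
apply: (star_isomorphic_character_table tab g_inf).
by apply/card_gt1P; exists h, 1%g; split=> //; exact/eqP.
Qed.

(** * Baumslag-Solitar relations *)

Section BaumslagSolitar.
Local Open Scope group_scope.

(* The Baumslag-Solitar relation [b a b^-1 = a^k] with [b] a [2^e]-th power, the
   clause on conjugates forcing [a] into the abelian normal subgroup. *)
Definition bs_power (k e : nat) (G : groupType) := exists y a : G,
  [/\ a <> 1, forall z, commute a (z * a * z^-1) &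
      y ^+ (2 ^ e) * a = a ^+ k * y ^+ (2 ^ e)].

Lemma group_isomorphic_sym (G H : groupType) :
  group_isomorphic G H -> group_isomorphic H G.
Proof.
move=> [f [f' fK f'K]].
have f'M : {morph f' : x y / x * y} := can2_gmulfM fK f'K.
pose m := isMultiplicative.Build H G f' f'M.
pose f'' : {multiplicative H -> G} := HB.pack f' m.
by exists f''; exists f.
Qed.

Lemma bs_power_isomorphic k e (G H : groupType) :
  group_isomorphic G H -> bs_power k e G -> bs_power k e H.
Proof.
move=> [f [f' fK f'K]] [y [a [a1 ac ya]]]; exists (f y), (f a).
have f1 : f 1 = 1 by apply: (mulgI (f 1)); rewrite -gmulfM !mulg1.
have fV x : f x^-1 = (f x)^-1 by apply: (mulgI (f x)); rewrite -gmulfM !mulgV.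
have fX x n : f (x ^+ n) = f x ^+ n.
  by elim: n => // n IHn; rewrite !expgS gmulfM IHn.
split.
- by move=> fa1; apply: a1; apply: (can_inj fK); rewrite fa1 f1.
- by move=> z; rewrite /commute -(f'K z) -fV -!gmulfM ac.
- by rewrite -!fX -!gmulfM ya.
Qed.

(** For [y] over [t], the power y^(2^b) lies over [g], which multiplies the coset function based at
    1 by [k]. *)
Lemma bs_power_induced (R : realType) (Gam : groupType) (t : Gam) k b :
  (forall n, (0 < n)%N -> t ^+ n <> 1) -> (2 <= k)%N ->
  bs_power k b (induced_semidirect R (t ^+ (2 ^ b)) k).
Proof.
move=> t_inf k2; set g := t ^+ _.
have g_inf n : (0 < n)%N -> g ^+ n <> 1.
  by move=> n0; rewrite /g -expgnA; apply: t_inf; rewrite muln_gt0 expn_gt0.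
pose y : induced_semidirect R g k := (0%R, t).
pose a : induced_semidirect R g k := (induced_coset_fun R g k 1, 1).
have yX n : y ^+ n = (0%R, t ^+ n).
  elim: n => // n IHn; rewrite !expgS IHn isd_mulE /= induced_act0 addr0.
  by [].
exists y, a; split.
- move=> /(congr1 fst) /(congr1 (fun f => val f 1)) E.
  have := @coset_fun_self R Gam g k g_inf k2 1.
  have -> : coset_fun R g k 1 1 = 0%R by exact: E.
  by move=> /esym/eqP; rewrite oner_eq0.
- move=> z; have : (z * a * z^-1).2 = 1 by rewrite isd_mulE isd_invE /= mulg1 mulgV.
  case: (z * a * z^-1) => f c /= ->.
  by rewrite /commute !isd_mulE /= !induced_act1 addrC mulg1.
- rewrite yX isd_exp_base !isd_mulE /= add0r mulg1 mul1g induced_act0 addr0 -/g.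
  congr (_, _); apply: induced_ext => x; rewrite induced_mulrn induced_actE.
  transitivity (coset_fun R g k (g * 1) x).
    exact: coset_fun_shift.
  by rewrite mulg1 -[X in coset_fun R g k X](mul1g g) coset_fun_left // mulr_natl.
Qed.

Lemma isd_mul_val (R : realType) (Gam : groupType) (g : Gam) k
    (u v : induced_semidirect R g k) x :
  val (u * v).1 x = (val u.1 x + val v.1 (u.2^-1 * x)%g)%R.
Proof. by []. Qed.

Lemma isd_inv_val (R : realType) (Gam : groupType) (g : Gam) k
    (u : induced_semidirect R g k) x : val (u^-1).1 x = (- val u.1 (u.2 * x)%g)%R.
Proof. by rewrite isd_invE induced_valN induced_actE invgK. Qed.

(** Conjugating by the generator [e] and comparing values at [c] yields E(c) + E(c^-1) = 2. Off
    [<g>] both terms are 0; on it they are k^m and k^-m, which add up to 2 only for m = 0. *)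
Lemma commute_induced_base (R : realType) (Gam : groupType) (g : Gam) k
    (a : induced_semidirect R g k) :
  (forall n, (0 < n)%N -> g ^+ n <> 1) -> (2 <= k)%N ->
  (forall z, commute a (z * a * z^-1)) -> a.2 = 1.
Proof.
move=> g_inf k2 ac; case: a ac => f c ac /=.
pose u : induced_semidirect R g k := (f, c).
rewrite -/u in ac *.
pose E := coset_fun R g k 1.
pose e : induced_semidirect R g k := (induced_coset_fun R g k 1, 1).
have := congr1 (fun w : induced_semidirect R g k => val w.1 c) (ac e).
have -> : val (u * (e * u * e^-1)).1 c =
    (val f c + (E 1%g + val f 1%g - E c^-1%g))%R.
  rewrite !isd_mul_val isd_inv_val !isd_mulE mul1g invg1 !mul1g !mulVg mulg1.
  by [].
have -> : val (e * u * e^-1 * u).1 c =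
    (E c + val f c - E 1%g + val f 1%g)%R.
  rewrite !isd_mul_val isd_inv_val.
  have -> : (e * u * e^-1).2 = c by rewrite !isd_mulE isd_invE /= invg1 mulg1 mul1g.
  have -> : (e * u).2 = c by rewrite isd_mulE /= mul1g.
  by rewrite mulVg /= invg1 !mul1g.
have E1 : E 1%g = 1%R by exact: coset_fun_self.
move=> Ec; have {}Ec : (E c + E c^-1%g = 2)%R by lra.
have kR n : (0 < k%:R ^+ n :> R)%R by rewrite exprn_gt0 // ltr0n (leq_trans _ k2).
move: Ec; rewrite /E; case: (coset_funP R g_inf k2 1 c) => [a b cx|cx].
  rewrite (@coset_funE _ _ _ _ g_inf k2 1 c^-1 b a); last first.
    move: cx; rewrite /same_coset /= !mul1g => <-.
    exact: mulKg.
  move=> Ec; have kab : (k%:R ^+ a = k%:R ^+ b :> R)%R.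
    have := kR a; have := kR b; move: Ec; set p := (k%:R ^+ a)%R; set q := (k%:R ^+ b)%R.
    move=> Ec q0 p0; have : ((p - q) ^+ 2 = 0)%R.
      have <- : ((p / q + q / p - 2) * (p * q) = (p - q) ^+ 2)%R.
        by field; rewrite !gt_eqF.
      by rewrite Ec subrr mul0r.
    by move=> /eqP; rewrite sqrf_eq0 subr_eq0 => /eqP.
  have ab : a = b.
    apply: (@ieexprIn R k%:R) kab => //; first by rewrite ltr0n (leq_trans _ k2).
    by rewrite pnatr_eq1 gtn_eqF.
  by move: cx; rewrite /same_coset /= ab mul1g => /(canRL (mulgK _)); rewrite mulgV.
case: (coset_funP R g_inf k2 1 c^-1) => [a b cx'|cx'] Ec; last by exfalso; lra.
exfalso; apply: (cx (b, a)); move: cx'; rewrite /same_coset /= !mul1g => <-.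
exact: mulKVg.
Qed.

(* The support of [f] meets finitely many cosets of [<g>], so two of the points
   [h^-r x0] lie in the same one; comparing the values of [f] there gives the power
   of [g] by which they differ. *)
Lemma eigenfunction_conj (R : realType) (Gam : groupType) (g h : Gam) k
    (f : induced_mod R g k) :
  (forall n, (0 < n)%N -> g ^+ n <> 1) -> (2 <= k)%N -> f <> 0%R ->
  (forall x, val f (h^-1 * x)%g = (k%:R * val f x)%R) ->
  exists x d, (0 < d)%N /\ h ^+ d = x * g ^+ d * x^-1.
Proof.
move=> g_inf k2 f0 fh.
have [x0 fx0] : exists x, val f x <> 0%R.
  apply/existsNP => E; apply: f0; apply: induced_ext => x; exact: E.
have k0 : (0 < k%:R :> R)%R by rewrite ltr0n (leq_trans _ k2).
have k1 : (k%:R != 1 :> R)%R by rewrite pnatr_eq1 gtn_eqF.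
have kX n : (k%:R ^+ n != 0 :> R)%R by rewrite gt_eqF ?exprn_gt0.
pose X r := h ^- r * x0.
have fX r : val f (X r) = (k%:R ^+ r * val f x0)%R.
  elim: r => [|r IHr]; first by rewrite /X expg0 invg1 !mul1g mul1r.
  rewrite exprS -mulrA -IHr -fh; congr (val f _).
  by rewrite /X expgSr invgM mulgA.
have fX0 r : val f (X r) <> 0%R.
  by rewrite fX => /eqP; rewrite mulf_eq0 (negPf (kX r)) => /eqP.
have [s sP] := induced_finite f.
have ex r : exists c, c \in s /\ exists ab, same_coset g c (X r) ab.
  by have [c cs cX] := sP _ (fX0 r); exists c.
have [c cP] := choice ex.
have /(uniqPn 1)[i [j [ij]]] : ~~ uniq [seq c r | r <- iota 0 (size s).+1].
  apply/negP => /uniq_leq_size le.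
  suff /le : {subset [seq c r | r <- iota 0 (size s).+1] <= s}.
    by rewrite size_map size_iota ltnn.
  by move=> _ /mapP[r _ ->]; case: (cP r).
rewrite size_map size_iota => jn.
rewrite !(nth_map 0%N) ?size_iota ?(ltn_trans ij) // !nth_iota ?(ltn_trans ij) // !add0n.
have [_ [[a b]]] := cP i; have [_ [[a' b']]] := cP j.
rewrite /same_coset /= => Ej Ei cij.
have XE : X i * g ^+ (a + b') = X j * g ^+ (a' + b).
  by rewrite !expgnDr !mulgA Ei Ej cij -!mulgA -!expgnDr addnC.
have ab : (a' + b = a + b' + (j - i))%N.
  have /eqP := congr1 (val f) XE; rewrite !induced_rightX // !fX.
  rewrite eqr_div //.
  have -> : (k%:R ^+ i * val f x0 * k%:R ^+ (a' + b) =
    k%:R ^+ (i + (a' + b)) * val f x0)%R by rewrite [in RHS]exprD mulrAC.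
  have -> : (k%:R ^+ j * val f x0 * k%:R ^+ (a + b') =
    k%:R ^+ (j + (a + b')) * val f x0)%R by rewrite [in RHS]exprD mulrAC.
  move=> /eqP /mulIf E; have : (i + (a' + b) = j + (a + b'))%N.
    by apply: (@ieexprIn R k%:R) => //; apply: E; apply/eqP.
  by lia.
exists (X j), (j - i)%N; rewrite subn_gt0; split=> //.
have Xij : X i = h ^+ (j - i) * X j.
  rewrite /X mulgA; congr (_ * _).
  by rewrite -{2}(subnKC (ltnW ij)) expgnDr invgM mulVKg.
apply: (mulIg (X j)); rewrite mulgVK -Xij; apply: (mulIg (g ^+ (a + b'))).
by rewrite XE ab addnC expgnDr mulgA.
Qed.

(** On module components the relation says that translating [a.1] by the top component of y^(2^e)
    multiplies it by [k], so [a.1] is an eigenfunction in the sense of [eigenfunction_conj]. *)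
Lemma bs_power_conj (R : realType) (Gam : groupType) (g : Gam) k e :
  (forall n, (0 < n)%N -> g ^+ n <> 1) -> (2 <= k)%N ->
  bs_power k e (induced_semidirect R g k) ->
  exists h x d, (0 < d)%N /\ (h ^+ (2 ^ e)) ^+ d = x * g ^+ d * x^-1.
Proof.
move=> g_inf k2 [y [a [a1 ac ya]]].
have a2 := commute_induced_base g_inf k2 ac.
have aE : a = (a.1, 1) by case: a a2 {a1 ac ya} => f c /= ->.
have [x [d [d0 dP]]] : exists x d, (0 < d)%N /\
    (y.2 ^+ (2 ^ e)) ^+ d = x * g ^+ d * x^-1.
  apply: (@eigenfunction_conj R Gam g _ k a.1) => // [a0|x].
    by apply: a1; rewrite aE a0.
  have := congr1 (fun u : induced_semidirect R g k => val u.1 x) ya.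
  rewrite !isd_mul_val isd_exp2 aE isd_exp_base /= invg1 mul1g.
  rewrite mulr_natl induced_mulrn addrC => /addIr.
  by [].
by exists y.2, x, d.
Qed.

End BaumslagSolitar.

(** * Powers in [PSL(n, Z)] *)

Lemma unit_exp_card (K : finUnitRingType) (x : K) :
  x \is a GRing.unit -> x ^+ #|{: {unit K}}| = 1.
Proof.
move=> xu; have /(congr1 val) := expg_cardT (FinRing.unit K xu).
by rewrite FinRing.val_unitX.
Qed.

Section PowersModTwo.
Variables (n' : nat).
Local Notation n := n'.+2.
Local Notation M := 'M[int]_n.
Implicit Types (A V : M).

Lemma exprD1_mulrn V q d : exists V', (1 + V *+ q) ^+ d = 1 + V' *+ q.
Proof.
elim: d => [|d [V' IHd]]; first by exists 0; rewrite expr0 mul0rn addr0.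
exists (V + V' + (V * V') *+ q); rewrite exprS IHd mulrDl mul1r mulrDr mulr1.
rewrite -addrA; congr (1 + _).
by rewrite !mulrnDl mulrnAl mulrnAr addrCA addrA.
Qed.

(** Each squaring gains a factor 2 in the modulus: (1 + q V)^2 = 1 + 2 q (V + (q/2) V^2) for even
    q. *)
Lemma exprD1_double V s : exists V', (1 + V *+ 2) ^+ (2 ^ s) = 1 + V' *+ (2 ^ s.+1).
Proof.
elim: s => [|s [V' IHs]]; first by exists V; rewrite expn0 expr1 expn1.
exists (V' + (V' * V') *+ (2 ^ s)); rewrite expnSr exprM IHs expr2.
rewrite mulrDl mul1r mulrDr mulr1 mulrnAl mulrnAr -!mulrnA mulrnDl -addrA.
congr (1 + _); rewrite addrA -mulrnDr -mulrnA; congr (_ *+ _ + _ *+ _).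
  by rewrite [RHS]expnS; lia.
by rewrite -!expnD; congr expn; lia.
Qed.

Lemma even_intr_F2 (z : int) : (z%:~R == 0 :> 'F_2) = (2%:Z %| z)%Z.
Proof. by rewrite -(dvdz_pcharf (p := 2)) // pchar_Fp. Qed.

(** Lagrange's theorem in GL_n(F_2), applied to the reduction of [A] modulo 2. *)
Lemma expr_card_mod2 A : \det A = 1 ->
  exists V, A ^+ #|{: {unit 'M['F_2]_n}}| = 1 + V *+ 2.
Proof.
move=> detA; set m := #|_|.
pose h : {rmorphism int -> 'F_2} := intr.
have Au : map_mx h A \is a GRing.unit.
  by rewrite unitmxE det_map_mx detA rmorph1 unitr1.
have E : map_mx h (A ^+ m) = 1 by rewrite rmorphXn; exact: unit_exp_card.
have dv i j : (2%:Z %| (A ^+ m - 1) i j)%Z.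
  rewrite -even_intr_F2.
  have -> : (((A ^+ m - 1) i j)%:~R = (map_mx h (A ^+ m - 1)) i j :> 'F_2).
    by rewrite [RHS]mxE.
  by rewrite rmorphB rmorph1 /= E subrr mxE.
rewrite -(subrKC 1 (A ^+ m)); move: (_ - 1) dv => B dv.
exists (\matrix_(i, j) ((B i j) %/ 2)%Z); congr (1 + _); apply/matrixP => i j.
have := divzK (dv i j); rewrite mulmxnE mxE.
by move: (_ %/ _)%Z => w <-; rewrite -[w *+ 2]mulr_natr.
Qed.

End PowersModTwo.

(** * Transvections and the centre of SL(n, Z) *)

Section Transvections.
Variables (n' : nat).
Local Notation n := n'.+2.
Local Notation M := 'M[int]_n.
Local Notation G := (SL int n).
Implicit Types (X Y : G).

Fact transvection_subproof (i j : 'I_n) : i != j ->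
  \det (1%:M + delta_mx i j : 'M[int]_n) == 1.
Proof.
wlog ij : i j / (j < i)%N => [hwlog ij|].
  move: (ij); rewrite neq_ltn => /orP[lt|lt]; last exact: hwlog.
  rewrite -det_tr linearD /= trmx1 trmx_delta; apply: hwlog => //.
  by rewrite eq_sym.
move=> nij; rewrite det_trig; last first.
  apply/is_trig_mxP => a b ab; rewrite !mxE -val_eqE ltn_eqF // add0r.
  case: eqP => // ai; case: eqP => // bj; move: ab ij; rewrite ai bj; lia.
apply/eqP/big1 => a _; rewrite !mxE eqxx.
case: eqP => // ai; case: eqP => // aj; first by move: nij; rewrite -ai -aj eqxx.
Qed.

Definition transvection (i j : 'I_n) (ij : i != j) : G := 
  exist (fun A : 'M[int]_n => \det A == 1) _ (transvection_subproof ij).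

Lemma SL_valM X Y : val (X * Y)%g = val X * val Y.
Proof. by []. Qed.

Lemma SL_valX X m : val (X ^+ m)%g = val X ^+ m.
Proof. by elim: m => // m IHm; rewrite expgS exprS SL_valM IHm. Qed.

(** Commuting with a transvection 1 + E_ij means commuting with the matrix unit E_ij. Comparing
    columns [j] shows that column [i] of [X] has the single entry X_jj, on the diagonal. *)
Lemma central_scalar X : central X -> val X = (val X ord0 ord0)%:M.
Proof.
move=> Xc.
have comm (i j : 'I_n) : i != j -> val X * delta_mx i j = delta_mx i j * val X.
  move=> ij; have := congr1 val (Xc (transvection ij)).
  by rewrite !SL_valM /= mulrDr mulrDl mulr1 mul1r => /addrI.
have key (i j a : 'I_n) : i != j -> val X a i = val X j j *+ (a == i).
  move=> ij; have := congr1 (fun A : M => A a j) (comm i j ij).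
  rewrite !mxE (bigD1 i) //= big1 ?addr0 => [|b bi]; last by rewrite mxE (negPf bi) mulr0.
  rewrite mxE !eqxx mulr1 => ->.
  rewrite (bigD1 j) //= big1 ?addr0 => [|b bj]; last by rewrite mxE (negPf bj) andbF mul0r.
  by rewrite mxE eqxx andbT; case: (a == i); rewrite ?mul1r ?mul0r.
have diag b : val X b b = val X 0 0.
  by have [->//|b0] := eqVneq b 0; rewrite (key b 0) // eqxx.
apply/matrixP => a b; rewrite mxE; have [b0|b0] := eqVneq b 0.
  by rewrite (key b 1) ?b0 // diag.
by rewrite (key b 0).
Qed.

Lemma central_expg X : central X -> (X ^+ n = 1)%g.
Proof.
move=> /central_scalar; move: (val X ord0 ord0) => a XE.
apply: val_inj; rewrite SL_valX XE.
have := eqP (valP X); rewrite XE det_scalar => a1.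
by rewrite -[LHS]rmorphXn a1.
Qed.

Definition elementary : G := transvection (isT : (0 : 'I_n) != 1).

Lemma elementaryX m : val (elementary ^+ m)%g = 1 + delta_mx 0 1 *+ m.
Proof.
elim: m => [|m IHm]; first by rewrite mulr0n addr0.
rewrite expgSr SL_valM IHm /= mulrDr mulr1 mulrDl mul1r mulrnAl.
have -> : (delta_mx 0 1 : M) * delta_mx 0 1 = 0 by exact: mul_delta_mx_0.
by rewrite mul0rn addr0 -addrA -mulrSr.
Qed.

Lemma elementaryX_central m : central (elementary ^+ m)%g -> m = 0%N.
Proof.
move=> /central_scalar; rewrite elementaryX => /(congr1 (fun A : M => A 0 1)).
rewrite mxE mulmxnE !mxE /= add0r; lia.
Qed.

(* The power of [X] by [#|GL_n(F_2)|] is [1] modulo [2], so its [m]-th power is [1]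
   modulo [2^(logn 2 m + 1)]; the factor [n] kills the central [c]. *)
Lemma elementary_conj_powers X Y (c : G) (e b d : nat) :
  central c -> (0 < d)%N ->
  (X ^+ (2 ^ e * d) * Y = Y * elementary ^+ (2 ^ b * d) * c)%g ->
  (2 ^ e.+1 %| 2 ^ b * (n * #|{: {unit 'M['F_2]_n}}|))%N.
Proof.
move=> cc d0 XY; set E0 := #|_|; set E := (n * E0)%N.
have powers (j : nat) :
    (X ^+ (2 ^ e * d * j) * Y =
     Y * (elementary ^+ (2 ^ b * d * j) * c ^+ j))%g.
  elim: j => [|j IHj]; first by rewrite !muln0 !expg0 !mulg1 mul1g.
  rewrite !mulnS !expgnDr -mulgA IHj !mulgA XY expgS.
  rewrite -!mulgA; congr (_ * _)%g; congr (_ * _)%g.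
  by rewrite mulgA (cc (elementary ^+ _)%g) !mulgA.
have /(congr1 val) := powers E.
have -> : (c ^+ E = 1)%g by rewrite /E expgnA central_expg // expg1n.
rewrite mulg1 !SL_valM elementaryX SL_valX.
(* Here d = d' 2^v with d' odd: 2^v raises both exponents of 2 alike and cancels at the end, and d'
   disappears because it is coprime to 2. *)
have [d' d'odd dE] := pfactor_coprime (isT : prime 2) d0; set v := logn 2 d in dE.
have [V VE] : exists V, val X ^+ E0 = 1 + V *+ 2.
  by apply: expr_card_mod2; exact: eqP (valP X).
have [V1 V1E] := exprD1_double V (e + v).
have [V2 V2E] := exprD1_mulrn V1 (2 ^ (e + v).+1) (d' * n).
have -> : (2 ^ e * d * E)%N = (E0 * (2 ^ (e + v) * (d' * n)))%N.
  by rewrite /E dE expnD; lia.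
rewrite 2!exprM VE V1E V2E mulrDl mul1r mulrDr mulr1 => /addrI.
have YV : val (Y^-1)%g * val Y = 1 by rewrite -SL_valM mulVg.
(* After multiplication by Y^-1 the (0, 1) entries are a multiple of 2^(e+v+1) on one side and the
   exponent 2^b d E of the transvection on the other. *)
move=> /(congr1 (fun A => (val (Y^-1)%g * A) 0 1)).
rewrite [LHS](_ : _ = (val (Y^-1)%g * (V2 * val Y)) 0 1 *+ 2 ^ (e + v).+1); last first.
  by rewrite mulrnAl mulrnAr mulmxnE.
rewrite [RHS](_ : _ = (2 ^ b * d * E)%N%:R); last first.
  by rewrite mulrA YV mul1r mulmxnE mxE !eqxx.
move: ((val (Y^-1)%g * (V2 * val Y)) 0 1) => z; rewrite -mulr_natr.
move=> /(congr1 absz); rewrite abszM => zE.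
have : (2 ^ (e + v).+1 %| 2 ^ b * d * E)%N.
  by apply/dvdnP; exists `|z|%N; move: zE; rewrite !natz !absz_nat => ->.
have -> : (2 ^ b * d * E = 2 ^ b * E * d' * 2 ^ v)%N by rewrite {1}dE; lia.
rewrite -addSn expnD dvdn_pmul2r ?expn_gt0 // Gauss_dvdl //.
by rewrite coprimeXl.
Qed.

End Transvections.

(** * Passage to the central quotient *)

Section ProjectiveSpecialLinear.
Variables (n' : nat).
Local Notation n := n'.+2.
Local Notation G := (SL int n).
Local Open Scope quotient_scope.

Definition projective_elementary : PSLZ n := \pi_(center_quotient G) (elementary n').

Local Notation cls := (\pi_(center_quotient G)).

Lemma pi_cquoM (x y : G) : cls (x * y)%g = (cls x * cls y)%g.
Proof. exact: pi_cquo_mul. Qed.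

Lemma pi_cquoX (x : G) m : cls (x ^+ m)%g = (cls x ^+ m)%g.
Proof.
elim: m => [|m IHm].
  apply: (mulgI (\pi_(center_quotient G) (x ^+ 0)%g)).
  by rewrite -pi_cquoM !expg0 !mulg1.
by rewrite !expgS pi_cquoM IHm.
Qed.

Lemma projective_elementary_inf m : (0 < m)%N -> (projective_elementary ^+ m <> 1)%g.
Proof.
move=> m0; rewrite -pi_cquoX => E; suff /elementaryX_central m0' : central (elementary n' ^+ m)%g.
  by rewrite m0' in m0.
rewrite -[(elementary n' ^+ m)%g]mul1g -{1}invg1.
have pi1 : \pi_(center_quotient G) (1 : G)%g = 1%g.
  by rewrite -(expg0 (elementary n')) pi_cquoX.
by apply/eq_mod_centerP; rewrite pi1 E.
Qed.

(** On representatives in SL(n, Z) the relation holds up to a central factor, which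
    [elementary_conj_powers] allows. *)
Lemma projective_elementary_conj (x y : PSLZ n) (e b d : nat) : (0 < d)%N ->
  ((x ^+ (2 ^ e)) ^+ d = y * (projective_elementary ^+ (2 ^ b)) ^+ d * y^-1)%g ->
  (2 ^ e.+1 %| 2 ^ b * (n * #|{: {unit 'M['F_2]_n}}|))%N.
Proof.
move=> d0 E.
have {}E : (x ^+ (2 ^ e * d) * y = y * projective_elementary ^+ (2 ^ b * d))%g.
  by rewrite !expgnA E mulgVK.
have : \pi_(center_quotient G) (repr y * elementary n' ^+ (2 ^ b * d))%g = 
   \pi_(center_quotient G) (repr x ^+ (2 ^ e * d) * repr y)%g.
  by rewrite !pi_cquoM !pi_cquoX !reprK E.
move=> /eqP /eq_mod_centerP; set c := (_ * _)%g => cc.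
apply: (elementary_conj_powers cc d0 (X := repr x) (Y := repr y)).
by rewrite /c mulKVg.
Qed.

End ProjectiveSpecialLinear.

(** * Countability, torsion in the wreath product, and the separation of the groups *)

Lemma PSLZ_countable n : countable [set: PSLZ n].
Proof.
apply/countable_injP.
exists (fun x : PSLZ n => choice.pickle (val (repr (x : center_quotient _)))) => x y _ _.
move=> /(pcan_inj choice.pickleK) /val_inj E.
by rewrite -[x]reprK E reprK.
Qed.

Lemma torsion_free_isomorphic (G H : groupType) :
  group_isomorphic G H -> torsion_free G -> torsion_free H.
Proof.
move=> /group_isomorphic_sym [f [f' fK _]] tf x n n0 xn.
have f1 : (f 1 = 1)%g by apply: (mulgI (f 1%g)); rewrite -gmulfM !mulg1.
have fX m : (f (x ^+ m) = f x ^+ m)%g.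
  by elim: m => // m IHm; rewrite !expgS gmulfM IHm.
by apply: (can_inj fK); rewrite f1; apply: (tf _ n) => //; rewrite -fX xn f1.
Qed.

Lemma wreath_torsion (H : finGroupType) (Gam : groupType) :
  (exists h : H, h <> 1%g) -> ~ torsion_free (wreath H Gam).
Proof.
move=> [h h1] tf; apply: h1.
have X n : (wsingle (1 : Gam) h ^+ n = wsingle 1 (h ^+ n))%g.
  by elim: n => [|n IHn]; rewrite ?wsingle1 // !expgS IHn wsingleM.
have H0 : (0 < #|H|)%N by apply/card_gt0P; exists h.
have := tf (wsingle 1%g h) _ H0; rewrite X expg_cardT wsingle1 => /(_ erefl) [].
by move=> /(congr1 (fun f => dsum_fun f 1%g)); rewrite singleE eqxx dsum_oneE.
Qed.

Lemma card_ge2 (H : finGroupType) : (exists h : H, h <> 1%g) -> (2 <= #|H|)%N.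
Proof.
move=> [h /eqP h1]; rewrite (cardD1 1%g) (cardD1 h) !inE h1.
by [].
Qed.

Local Close Scope ring_scope.

Theorem theorem1p2 (R : realType) :
  (forall (Gam : groupType) (H0 : finGroupType),
     countable [set: Gam] -> torsion_free Gam ->
     (exists g : Gam, g <> 1%g) ->
     abelian [set: H0]%G -> (exists h : H0, h <> 1%g) ->
     exists Lam : groupType,
       [/\ countable [set: Lam],
           torsion_free Lam,
           star_isomorphic (group_vna R Lam) (group_vna R (wreath H0 Gam)) &
           ~ group_isomorphic Lam (wreath H0 Gam)])
  /\
  (forall (n : nat) (H0 : finGroupType),
     (2 <= n)%N ->
     abelian [set: H0]%G -> (exists h : H0, h <> 1%g) ->
     exists Lam : nat -> groupType,
       [/\ forall i, countable [set: Lam i],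
           forall i, star_isomorphic (group_vna R (Lam i))
                       (group_vna R (wreath H0 (PSLZ n))) &
           forall i j, i <> j -> ~ group_isomorphic (Lam i) (Lam j)]).
Proof.
split=> [Gam H0 cGam tf [g g1] abH H1|[|[|n]] // H0 _ abH H1].
  have g_inf m : 0 < m -> (g ^+ m <> 1)%g by move=> m0 /(tf g m m0).
  exists (induced_semidirect R g #|H0|); split.
  - exact: isd_countable.
  - exact: isd_torsion_free.
  - exact: star_isomorphic_induced.
  - move=> iso; apply: (wreath_torsion (Gam := Gam) H1).
    by apply: torsion_free_isomorphic iso _; exact: isd_torsion_free.
have k2 := card_ge2 H1.
pose E := n.+2 * #|{: {unit 'M['F_2]_n.+2}}|.
pose t := projective_elementary n.
have t_inf b m : 0 < m -> ((t ^+ (2 ^ b)) ^+ m <> 1)%g.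
  move=> m0; rewrite -expgnA; apply: projective_elementary_inf.
  by rewrite muln_gt0 expn_gt0.
(* The exponents are spaced by [E]: for i < j an isomorphism would make 2^(jE+1) divide 2^(iE) E,
   hence 2^(E+1) divide [E], although 0 < E < 2^E. *)
pose Lam i : groupType := induced_semidirect R (t ^+ (2 ^ (i * E)))%g #|H0|.
have separated i j : i < j -> ~ group_isomorphic (Lam j) (Lam i).
  move=> ij iso.
  have /(bs_power_isomorphic iso) : bs_power #|H0| (j * E) (Lam j).
    by apply: bs_power_induced => // m m0; have := t_inf 0 m m0; rewrite expn0 expg1.
  move=> /(bs_power_conj (t_inf _) k2) [x [y [d [d0 xy]]]].
  have := projective_elementary_conj d0 xy; rewrite -/E.
  have E0 : 0 < E by rewrite muln_gt0; apply/card_gt0P; exists 1%g.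
  rewrite -(subnKC (leq_mul ij (leqnn E))) -addnS mulSn [E + _]addnC -addnA expnD.
  rewrite dvdn_pmul2l ?expn_gt0 // => /(dvdn_leq E0).
  rewrite leqNgt => /negP; apply; apply: leq_trans (ltn_expl E (ltnSn 1)) _.
  by rewrite leq_exp2l //; lia.
exists Lam; split=> [i|i|i j /eqP ij iso].
- exact/isd_countable/PSLZ_countable.
- apply: star_isomorphic_induced => //; exact: t_inf.
- move: ij; rewrite neq_ltn => /orP[ij|ji]; last exact: separated iso.
  exact: separated (group_isomorphic_sym iso).
Qed.
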